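(* Let $\Lambda$ be an artin algebra and $\mathcal{F}=\mathsf{Sub}\,U$ a functorially finite torsion-free class of $\mathsf{mod}\,\Lambda$, where $U$ is a support $\tau^-$-tilting module. Then the following are equivalent: (1) $\mathcal{F}$ satisfies the Jordan-Hölder property (JHP). (2) The number of isomorphism classes of simple objects in the exact category $\mathcal{F}$ is equal to $|U|$.
   Context: An artin algebra is an algebra over a fixed commutative artinian ring that is finitely generated as a module over it; $\mathsf{mod}\,\Lambda$ is the category of finitely generated right $\Lambda$-modules. $|M|$ is the number of non-isomorphic indecomposable direct summands of $M$. $\mathsf{Sub}\,U$ is the full subcategory of submodules of finite direct sums of copies of $U$. With $\tau^-$ the inverse Auslander–Reiten translation, a module $U$ is $\tau^-$-rigid if $\operatorname{Hom}_\Lambda(\tau^- U,U)=0$, $\tau^-$-tilting if moreover $|U|=|\Lambda|$, and support $\tau^-$-tilting if there is an idempotent $e\in\Lambda$ such that $U$ is a $\tau^-$-tilting $\Lambda/\Lambda e\Lambda$-module. A torsion-free class of $\mathsf{mod}\,\Lambda$ is the second member $\mathcal{F}$ of a torsion pair $(\mathcal{T},\mathcal{F})$ (i.e. $\operatorname{Hom}(\mathcal{T},\mathcal{F})=0$ and every module $X$ has a short exact sequence $0\to TX\to X\to FX\to0$ with $TX\in\mathcal{T}$, $FX\in\mathcal{F}$). A functorially finite torsion-free class is of the form $\mathsf{Sub}\,U$ for a support $\tau^-$-tilting module $U$. $\mathcal{F}$ is extension-closed and is regarded as an exact category whose conflations are the short exact sequences of $\mathsf{mod}\,\Lambda$ with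 all terms in $\mathcal{F}$. For an exact category $\mathcal{E}$ and an object $X$, $\mathsf{P}(X)$ is the poset of inflations $A\to X$ up to isomorphism over $X$, with $A\leq B$ if there is an inflation $A\to B$ compatible with the inflations to $X$; $X/A$ is the cokernel of $A\to X$. $X$ is simple if $X\ne 0$ and there is no conflation $L\to X\to N$ with $L,N\neq 0$. $\mathcal{E}$ is length if for every $X$ the lengths of finite chains in $\mathsf{P}(X)$ are bounded (every extension-closed subcategory of $\mathsf{mod}\,\Lambda$ is length). A composition series of $X$ is a finite maximal chain $0=X_0<\cdots<X_n=X$ in $\mathsf{P}(X)$. Two composition series $(X_i)_{i=0}^n$, $(Y_j)_{j=0}^m$ are isomorphic if $m=n$ and there is a permutation $\sigma$ of $\{1,\dots,n\}$ with $X_i/X_{i-1}\cong Y_{\sigma(i)}/Y_{\sigma(i)-1}$ for all $i$. A length exact category satisfies (JHP) if for every object $X$ all composition series of $X$ are isomorphic to each other. *)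

(* Defs.v *)
From HB Require Import structures.
From mathcomp Require Import all_boot all_fingroup all_algebra.
From mathcomp Require Import boolp classical_sets.

Set Implicit Arguments.
Unset Strict Implicit.
Unset Printing Implicit Defensive.

Import GRing.Theory.
Local Open Scope classical_set_scope.
Local Open Scope ring_scope.

(* A right A-module is an lmodType over the converse ring A^c.  The notions of
   the first sections are stated for left modules over an arbitrary ring K and
   are applied both to K := A and to K := A^c. *)

(* -------------------------------------------------------------------------- *)
Section Modules.
Variable K : pzRingType.
Implicit Types M N X Y : lmodType K.

Definition fingen M : Prop :=
  exists s : seq M, forall x : M, exists c : 'I_(size s) -> K,
    x = \sum_(i < size s) c i *: s`_i.

Definition surj (S T : Type) (f : S -> T) : Prop := forall y, exists x, f x = y.

Definition ker M N (f : {linear M -> N}) : set M := [set x | f x = 0].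

Definition is_zero M : Prop := forall x : M, x = 0.

Definition iso M N : Prop := exists f : {linear M -> N}, bijective f.

Definition short_exact M X N (f : {linear M -> X}) (g : {linear X -> N}) : Prop :=
  [/\ injective f, surj g & range f = ker g].

Definition direct_summand N M : Prop :=
  exists C : lmodType K, iso M (N * C)%type.

Definition indecomposable M : Prop :=
  ~ is_zero M /\
  forall N C : lmodType K, iso M (N * C)%type -> is_zero N \/ is_zero C.

Definition num_iso_classes (P : lmodType K -> Prop) (n : nat) : Prop :=
  exists S : 'I_n -> lmodType K,
    [/\ forall i, P (S i),
        forall i j, iso (S i) (S j) -> i = j &
        forall M, P M -> exists i, iso M (S i)].

(* |M| = n *)
Definition num_indec_summands M (n : nat) : Prop :=
  num_iso_classes (fun N => indecomposable N /\ direct_summand N M) n.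

Definition projective (P : lmodType K) : Prop :=
  forall (M N : lmodType K) (g : {linear M -> N}) (f : {linear P -> N}),
    surj g -> exists h : {linear P -> M}, forall x, g (h x) = f x.

Definition injective_module (J : lmodType K) : Prop :=
  forall (M N : lmodType K) (i : {linear M -> N}) (f : {linear M -> J}),
    injective i -> exists h : {linear N -> J}, forall x, h (i x) = f x.

(* f : P -> M is, onto its image B, an essential epimorphism from a finitely
   generated projective module. *)
Definition projective_cover (P M : lmodType K) (f : {linear P -> M}) (B : set M)
    : Prop :=
  [/\ fingen P, projective P, range f = B &
      forall (Z : lmodType K) (g : {linear Z -> P}),
        (forall b, B b -> exists z, f (g z) = b) -> surj g].

Definition injective_envelope (S J : lmodType K) (i : {linear S -> J}) : Prop :=
  [/\ injective_module J, injective i &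
      forall (Y : lmodType K) (g : {linear J -> Y}),
        injective (g \o i) -> injective g].

Definition minimal_projective_presentation (P1 P0 M : lmodType K)
    (d : {linear P1 -> P0}) (q : {linear P0 -> M}) : Prop :=
  projective_cover q [set: M] /\ projective_cover d (ker q).

(* Classes of modules stand for full subcategories. *)

(* Sub U *)
Definition SubCat (U : lmodType K) (X : lmodType K) : Prop :=
  fingen X /\
  exists (n : nat) (f : {linear X -> {ffun 'I_n -> U}}), injective f.

Definition iso_closed (C : lmodType K -> Prop) : Prop :=
  forall M N, iso M N -> C M -> C N.

Definition torsion_pair (T F : lmodType K -> Prop) : Prop :=
  [/\ (forall X, T X -> fingen X) /\ (forall X, F X -> fingen X),
      iso_closed T /\ iso_closed F,
      forall X Y (f : {linear X -> Y}), T X -> F Y -> forall x, f x = 0 &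
      forall X, fingen X ->
        exists (X1 X2 : lmodType K) (f : {linear X1 -> X}) (g : {linear X -> X2}),
          [/\ T X1, F X2 & short_exact f g]].

Definition torsionfree_class (F : lmodType K -> Prop) : Prop :=
  exists T, torsion_pair T F.

Definition functorially_finite (F : lmodType K -> Prop) : Prop :=
  (forall X, fingen X -> exists (F0 : lmodType K) (f : {linear F0 -> X}),
     F F0 /\ forall (F1 : lmodType K) (g : {linear F1 -> X}), F F1 ->
       exists h : {linear F1 -> F0}, forall x, f (h x) = g x)
  /\
  (forall X, fingen X -> exists (F0 : lmodType K) (f : {linear X -> F0}),
     F F0 /\ forall (F1 : lmodType K) (g : {linear X -> F1}), F F1 ->
       exists h : {linear F0 -> F1}, forall x, h (f x) = g x).

End Modules.

(* -------------------------------------------------------------------------- *)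
(* The exact structure on a class E of K-modules whose conflations are the short
   exact sequences of K-modules with all terms in E. *)
Section ExactCategory.
Variables (K : pzRingType) (E : lmodType K -> Prop).

Definition conflation (L X N : lmodType K) (f : {linear L -> X})
    (g : {linear X -> N}) : Prop :=
  [/\ E L, E X, E N & short_exact f g].

Definition inflation (A X : lmodType K) (f : {linear A -> X}) : Prop :=
  exists (N : lmodType K) (g : {linear X -> N}), conflation f g.

Definition simple_in (X : lmodType K) : Prop :=
  [/\ E X, ~ is_zero X &
      ~ exists (L N : lmodType K) (f : {linear L -> X}) (g : {linear X -> N}),
          [/\ conflation f g, ~ is_zero L & ~ is_zero N]].

Section Subobjects.
Variable X : lmodType K.

(* P(X) is the quotient of this type by adm_eq, ordered by adm_le. *)
Record adm_sub := AdmSub {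
  adm_dom : lmodType K;
  adm_map : {linear adm_dom -> X};
  adm_infl : inflation adm_map }.

Definition adm_eq (A B : adm_sub) : Prop :=
  exists h : {linear adm_dom A -> adm_dom B},
    bijective h /\ forall x, adm_map B (h x) = adm_map A x.

Definition adm_le (A B : adm_sub) : Prop :=
  exists h : {linear adm_dom A -> adm_dom B},
    inflation h /\ forall x, adm_map B (h x) = adm_map A x.

Definition adm_lt (A B : adm_sub) : Prop := adm_le A B /\ ~ adm_eq A B.

(* N is isomorphic to B / A, the cokernel of the inflation A -> B over X. *)
Definition adm_quotient (A B : adm_sub) (N : lmodType K) : Prop :=
  exists (h : {linear adm_dom A -> adm_dom B}) (g : {linear adm_dom B -> N}),
    conflation h g /\ forall x, adm_map B (h x) = adm_map A x.

Definition composition_series (n : nat) (c : 'I_n.+1 -> adm_sub) : Prop :=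
  [/\ is_zero (adm_dom (c ord0)),
      bijective (adm_map (c ord_max)),
      forall i j : 'I_n.+1, (i < j)%N -> adm_lt (c i) (c j) &
      forall B : adm_sub, (forall i, adm_le B (c i) \/ adm_le (c i) B) ->
        exists i, adm_eq B (c i)].

(* N is isomorphic to X_(i+1) / X_i, for i = 0, ..., n-1. *)
Definition series_factor (n : nat) (c : 'I_n.+1 -> adm_sub) (i : 'I_n)
    (N : lmodType K) : Prop :=
  adm_quotient (c (widen_ord (leqnSn n) i)) (c (lift ord0 i)) N.

Definition iso_series (n m : nat) (c : 'I_n.+1 -> adm_sub)
    (d : 'I_m.+1 -> adm_sub) : Prop :=
  exists (e : n = m) (s : 'S_m), forall i : 'I_n,
    exists N N' : lmodType K,
      [/\ series_factor c i N, series_factor d (s (cast_ord e i)) N' & iso N N'].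

End Subobjects.

Definition JHP : Prop :=
  forall X : lmodType K, E X ->
  forall (n m : nat) (c : 'I_n.+1 -> adm_sub X) (d : 'I_m.+1 -> adm_sub X),
    composition_series c -> composition_series d -> iso_series c d.

End ExactCategory.

(* -------------------------------------------------------------------------- *)
Section CommutativeRings.
Variable R : comPzRingType.

Definition is_ideal (I : set R) : Prop :=
  [/\ I 0, forall x y, I x -> I y -> I (x + y) &
      forall a x, I x -> I (a * x)].

Definition artinian : Prop :=
  forall I : nat -> set R, (forall n, is_ideal (I n)) ->
    (forall n, I n.+1 `<=` I n) ->
    exists N : nat, forall n, (N <= n)%N -> I n = I N.

Definition maximal_ideal (M : set R) : Prop :=
  [/\ is_ideal M, M <> setT &
      forall I : set R, is_ideal I -> M `<=` I -> I = M \/ I = setT].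

Definition jacobson_radical : set R :=
  [set x | forall M : set R, maximal_ideal M -> M x].

(* J is an injective envelope of the R-module R / rad R (here S). *)
Definition dualizing_module (J : lmodType R) : Prop :=
  exists (S : lmodType R) (p : {linear R^o -> S}) (i : {linear S -> J}),
    [/\ surj p, ker p = jacobson_radical & injective_envelope i].

End CommutativeRings.

(* -------------------------------------------------------------------------- *)
Section Hom.
Variables (K : pzRingType) (U V : lmodType K).

Definition Hom : Type := {linear U -> V}.
HB.instance Definition _ := gen_eqMixin Hom.
HB.instance Definition _ := gen_choiceMixin Hom.

Definition hom_fun (f : Hom) : U -> V := let g : {linear U -> V} := f in g.
Coercion hom_fun : Hom >-> Funclass.

Lemma HomP (f g : Hom) : f =1 g -> f = g.
Proof.
move=> fg; have {}fg : (f : U -> V) = g by apply/funext.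
case: f g fg => f [[f1] [f2]] [g [[g1] [g2]]]; rewrite /hom_fun /= => fg.
subst g; congr (GRing.Linear.Pack (GRing.Linear.Class _ _)).
  by congr Algebra.isNmodMorphism.Axioms_; exact: Prop_irrelevance.
by congr GRing.isScalable.Axioms_; exact: Prop_irrelevance.
Qed.

Lemma hom_linear (f : Hom) a x y : f (a *: x + y) = a *: f x + f y.
Proof. exact: linearP. Qed.

Fact hom_add_linear (f g : Hom) : linear (fun x => f x + g x).
Proof. by move=> a x y; rewrite !hom_linear scalerDr addrACA. Qed.
Fact hom_opp_linear (f : Hom) : linear (fun x => - f x).
Proof. by move=> a x y; rewrite hom_linear opprD scalerN. Qed.
Fact hom_zero_linear : linear (fun _ : U => 0 : V).
Proof. by move=> a x y; rewrite scaler0 addr0. Qed.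

End Hom.

Definition mkHom (K : pzRingType) (U V : lmodType K) (f : U -> V)
    (fL : linear f) : Hom U V :=
  HB.pack_for {linear U -> V} f (GRing.isLinear.Build K U V _ f fL).

Section HomZmodule.
Variables (K : pzRingType) (U V : lmodType K).

Definition hom_add (f g : Hom U V) : Hom U V := mkHom (hom_add_linear f g).
Definition hom_opp (f : Hom U V) : Hom U V := mkHom (hom_opp_linear f).
Definition hom_zero : Hom U V := mkHom (@hom_zero_linear K U V).

Fact hom_addA : associative hom_add.
Proof. by move=> f g h; apply: HomP => x; exact: addrA. Qed.
Fact hom_addC : commutative hom_add.
Proof. by move=> f g; apply: HomP => x; exact: addrC. Qed.
Fact hom_add0 : left_id hom_zero hom_add.
Proof. by move=> f; apply: HomP => x; exact: add0r. Qed.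
Fact hom_addN : left_inverse hom_zero hom_opp hom_add.
Proof. by move=> f; apply: HomP => x; exact: addNr. Qed.

HB.instance Definition _ := GRing.isZmodule.Build (Hom U V)
  hom_addA hom_addC hom_add0 hom_addN.

End HomZmodule.

(* -------------------------------------------------------------------------- *)
(* R-algebras as ring morphisms R -> A with central image.  The library's
   algType is not used because it imposes 1 != 0 in A, whereas the quotient
   A / A e A below may be the zero ring. *)
Structure pzAlg (R : comPzRingType) := PzAlg {
  alg_ring :> pzRingType;
  alg_in : {rmorphism R -> alg_ring};
  alg_in_central : forall r x, alg_in r * x = x * alg_in r }.
Arguments alg_in {R} _.

Section Algebras.
Variables (R : comPzRingType) (A : pzAlg R).

(* The R-module underlying a right A-module. *)
Section Restriction.
Variable U : lmodType A^c.

Definition restr : Type := U.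
HB.instance Definition _ := GRing.Zmodule.on restr.

Definition restr_scale (r : R) (u : restr) : restr := (alg_in A r : A^c) *: (u : U).

Fact restr_scaleA a b v :
  restr_scale a (restr_scale b v) = restr_scale (a * b) v.
Proof. by rewrite /restr_scale scalerA mulrC rmorphM. Qed.
Fact restr_scale1 : left_id 1 restr_scale.
Proof. by move=> v; rewrite /restr_scale rmorph1; exact: scale1r. Qed.
Fact restr_scaleDr : right_distributive restr_scale +%R.
Proof. by move=> a u v; exact: scalerDr. Qed.
Fact restr_scaleDl v : {morph restr_scale^~ v : a b / a + b}.
Proof. by move=> a b; rewrite /restr_scale rmorphD; exact: scalerDl. Qed.

HB.instance Definition _ := GRing.Zmodule_isLmodule.Build R restr
  restr_scaleA restr_scale1 restr_scaleDr restr_scaleDl.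
End Restriction.

(* D U = Hom_R(U, J), a left A-module by (a f)(u) = f(u a). *)
Section Dual.
Variables (J : lmodType R) (U : lmodType A^c).

Definition dual : Type := Hom (restr U) J.
HB.instance Definition _ := GRing.Zmodule.on dual.

Fact dual_scale_linear (a : A) (f : dual) :
  linear (fun u : restr U => f ((a : A^c) *: (u : U))).
Proof.
move=> r u v; rewrite -hom_linear; congr (f _).
rewrite [LHS]scalerDr; congr (_ + _).
change ((a : A^c) *: ((alg_in A r : A^c) *: (u : U)) =
  (alg_in A r : A^c) *: ((a : A^c) *: (u : U))).
by rewrite !scalerA; congr GRing.scale; exact: alg_in_central.
Qed.

Definition dual_scale (a : A) (f : dual) : dual := mkHom (dual_scale_linear a f).

Fact dual_scaleA a b f : dual_scale a (dual_scale b f) = dual_scale (a * b) f.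
Proof.
by apply: HomP => u; rewrite /dual_scale /hom_fun /=; congr (hom_fun f _);
   rewrite scalerA.
Qed.
Fact dual_scale1 : left_id 1 dual_scale.
Proof. by move=> f; apply: HomP => u; exact: (congr1 (hom_fun f) (scale1r (u : U))). Qed.
Fact dual_scaleDr : right_distributive dual_scale +%R.
Proof. by move=> a f g; apply: HomP. Qed.
Fact dual_scaleDl f : {morph dual_scale^~ f : a b / a + b}.
Proof.
move=> a b; apply: HomP => u.
transitivity (f ((a : A^c) *: (u : U) + (b : A^c) *: (u : U) : restr U)).
  exact: (congr1 (hom_fun f) (scalerDl (u : U) (a : A^c) (b : A^c))).
exact: (linearD (f : {linear restr U -> J})).
Qed.

HB.instance Definition _ := GRing.Zmodule_isLmodule.Build A dual
  dual_scaleA dual_scale1 dual_scaleDr dual_scaleDl.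
End Dual.

(* P^* = Hom_A(P, A), a right A-module by (f a)(p) = f(p) a. *)
Section Star.
Variable P : lmodType A.

Definition star : Type := Hom P A^o.
HB.instance Definition _ := GRing.Zmodule.on star.

Fact star_scale_linear (a : A^c) (f : star) :
  linear (fun p : P => (f p : A) * (a : A) : A^o).
Proof.
move=> b p q.
transitivity ((b * (f p : A) + (f q : A)) * (a : A)).
  exact: (congr1 (fun z : A => z * (a : A)) (hom_linear f b p q)).
by rewrite mulrDl -mulrA.
Qed.

Definition star_scale (a : A^c) (f : star) : star := mkHom (star_scale_linear a f).

Fact star_scaleA a b f : star_scale a (star_scale b f) = star_scale (a * b) f.
Proof. by apply: HomP => p; rewrite /= /star_scale /hom_fun /= -mulrA. Qed.
Fact star_scale1 : left_id 1 star_scale.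
Proof. by move=> f; apply: HomP => p; exact: mulr1. Qed.
Fact star_scaleDr : right_distributive star_scale +%R.
Proof. by move=> a f g; apply: HomP => p; exact: mulrDl. Qed.
Fact star_scaleDl f : {morph star_scale^~ f : a b / a + b}.
Proof. by move=> a b; apply: HomP => p; exact: mulrDr. Qed.

HB.instance Definition _ := GRing.Zmodule_isLmodule.Build A^c star
  star_scaleA star_scale1 star_scaleDr star_scaleDl.
End Star.

Definition artin_algebra : Prop :=
  artinian R /\ fingen (restr (A^c)^o : lmodType R).

(* T is (isomorphic to) Tr M: the cokernel of d^* : P0^* -> P1^* for a minimal
   projective presentation P1 -d-> P0 -> M -> 0. *)
Definition is_transpose (M : lmodType A) (T : lmodType A^c) : Prop :=
  exists (P1 P0 : lmodType A) (d : {linear P1 -> P0}) (q : {linear P0 -> M}),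
    minimal_projective_presentation d q /\
    exists p : {linear star P1 -> T},
      surj p /\
      forall g : star P1,
        p g = 0 <-> exists f : star P0, forall x : P1, g x = f (d x).

(* T is (isomorphic to) tau^- U = Tr D U. *)
Definition is_tauinv (U T : lmodType A^c) : Prop :=
  exists J : lmodType R, dualizing_module J /\ is_transpose (dual J U) T.

Definition tauinv_rigid (U : lmodType A^c) : Prop :=
  fingen U /\
  exists T : lmodType A^c, is_tauinv U T /\
    forall f : {linear T -> U}, forall x, f x = 0.

Definition tauinv_tilting (U : lmodType A^c) : Prop :=
  tauinv_rigid U /\
  exists n : nat, num_indec_summands U n /\
                  num_indec_summands ((A^c)^o : lmodType A^c) n.

End Algebras.

Definition idempotent_ideal (R : comPzRingType) (A : pzAlg R) (e : A) : set A :=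
  [set x | exists s : seq (A * A), x = \sum_(p <- s) p.1 * e * p.2].

(* (G, pi) is the quotient algebra A / A e A, and V is U viewed as a module over
   it (in particular U is annihilated by A e A). *)
Definition support_tauinv_tilting (R : comPzRingType) (A : pzAlg R)
    (U : lmodType A^c) : Prop :=
  exists (e : A) (G : pzAlg R) (pi : {rmorphism A -> G}),
    [/\ e * e = e,
        forall r, pi (alg_in A r) = alg_in G r,
        surj pi,
        forall x, pi x = 0 <-> idempotent_ideal e x &
        exists (V : lmodType G^c) (h : {additive U -> V}),
          [/\ bijective h,
              forall (a : A) (u : U), h ((a : A^c) *: u) = (pi a : G^c) *: h u &
              tauinv_tilting V]].

(* Main.v *)
(* Write E = Sub U and n = |U|, and call a function on E additive when it is
   additive on conflations.

   Tau^- -rigidity makes every U-valued map on an admissible subobject extend: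
   if P1 -> P0 -> DU is a projective presentation and N lies in E, then
   Hom(tau^- U, N) = 0 says that N (x) P1 -> N (x) P0 is injective, and dualizing
   over the base ring gives Ext^1(N, U) = 0.  Hence for the indecomposable
   summands U_1, ..., U_n of U the functions X |-> length Hom(X, U_i) are additive
   on E; an argument of Bongartz shows that they are linearly independent.

   Conversely an additive function is determined by its differences h(X) - h(X')
   over one pair X' < X in E for each simple module X / X'.  These simple modules
   live over the quotient algebra, and there are at most n of them because an
   indecomposable projective has a unique simple quotient.

   If (JHP) holds, the multiplicities of the simple objects of E in composition
   series are additive functions forming a basis dual to the simple objects, so
   there are exactly n of these.  If there are exactly n simple objects, the matrix
   (length Hom(S_k, U_i)) is invertible, so the multiplicities in a composition
   series of X are determined by the numbers length Hom(X, U_i). *)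
From HB Require Import structures.
From mathcomp Require Import all_boot all_fingroup all_algebra.
From mathcomp Require Import boolp classical_sets.
Require Import Defs.

Set Implicit Arguments.
Unset Strict Implicit.
Unset Printing Implicit Defensive.

Import GRing.Theory.
Local Open Scope classical_set_scope.
Local Open Scope ring_scope.

(** * Submodules and quotients *)

(** The group of additive functions is never built. Rational functions on modules stand for its
    elements, and dimension counts become left kernels of rational matrices: Hom lengths evaluated
    at the simple objects for the bound from below, multiplicities evaluated at the pairs X' < X for
    the bound from above. (JHP) supplies the second bound: it makes multiplicities independent of
    the chosen series, hence additive.

    Hom(X, U_i) carries no action of the algebra, so its length is taken over the base ring R.
    Finiteness then rests on R having finite length, which is derived from the descending chain
    condition on ideals. Duality over R uses an injective envelope J of R / rad R, and biduality
    comes from bounding lengths.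

    Tensor products are avoided: a functional on X (x) P is a balanced map from X and P to J.
    Krull-Schmidt decompositions are avoided too: Fitting's lemma is applied to the particular
    endomorphisms at hand.

    That inflations compose is deduced from the vanishing of Ext^1(N, U) for N in E. *)

Section Submodules.
Variable K : pzRingType.
Implicit Types M N X Y Z : lmodType K.

Definition lin_of X Y (f : X -> Y) (fL : linear f) : {linear X -> Y} :=
  (mkHom fL : {linear X -> Y}).

Record submod X := Submod {
  sm_set :> X -> Prop;
  sm0 : sm_set 0;
  smL : forall a x y, sm_set x -> sm_set y -> sm_set (a *: x + y) }.

Lemma submod_eq X (V W : submod X) : sm_set V = sm_set W -> V = W.
Proof.
case: V W => [V V0 VL] [W W0 WL] /= VW; subst W.
by congr Submod; exact: Prop_irrelevance.
Qed.

Section Closure.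
Variables (X : lmodType K) (W : submod X).

Lemma smZ a x : W x -> W (a *: x).
Proof. by move=> Wx; rewrite -[_ *: _]addr0; apply: smL Wx (sm0 W). Qed.
Lemma smD x y : W x -> W y -> W (x + y).
Proof. by move=> Wx Wy; rewrite -[x]scale1r; apply: smL. Qed.
Lemma smN x : W x -> W (- x).
Proof. by move=> Wx; rewrite -scaleN1r; apply: smZ. Qed.
Lemma smB x y : W x -> W y -> W (x - y).
Proof. by move=> Wx Wy; apply: smD => //; apply: smN. Qed.
Definition sm_pred : {pred X} := fun x => `[< W x >].
Lemma sm_predP x : reflect (W x) (x \in sm_pred).
Proof. exact: asboolP. Qed.

Fact sm_pred_closed : submod_closed sm_pred.
Proof.
split; first by apply/sm_predP; exact: sm0.
by move=> a x y /sm_predP Wx /sm_predP Wy; apply/sm_predP; exact: smL.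
Qed.
HB.instance Definition _ :=
  GRing.isSubmodClosed.Build K X sm_pred sm_pred_closed.

Definition sub_mod := {x : X | x \in sm_pred}.
HB.instance Definition _ := Choice.on sub_mod.
HB.instance Definition _ := SubChoice.on sub_mod.
HB.instance Definition _ := [SubChoice_isSubLmodule of sub_mod by <:].

Lemma sub_modP (x : sub_mod) : W (val x).
Proof. by apply/sm_predP; exact: valP. Qed.

Definition to_sub x (Wx : W x) : sub_mod := Sub x (introT (sm_predP x) Wx).
Lemma val_to_sub x (Wx : W x) : val (to_sub Wx) = x.
Proof. exact: SubK. Qed.

Fact incl_linear : linear (val : sub_mod -> X).
Proof. by move=> a x y; rewrite linearP. Qed.
Definition incl : {linear sub_mod -> X} := lin_of incl_linear.
Lemma inclE x : incl x = val x. Proof. by []. Qed.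
Lemma incl_inj : injective incl. Proof. exact: val_inj. Qed.
Lemma range_incl : range incl = sm_set W.
Proof.
apply/seteqP; split=> [_ [x _ <-]|x Wx]; first exact: sub_modP.
by exists (to_sub Wx).
Qed.
End Closure.

(* Quotients live on a set of representatives, chosen classically. *)
Section Quotient.
Variables (X : lmodType K) (W : submod X).

Definition quo_rep (x : X) : X := xget 0 [set y | W (x - y)].
Lemma quo_repP x : W (x - quo_rep x).
Proof.
apply: (@xgetPex _ 0 [set y | W (x - y)]).
by exists x; rewrite /= subrr; exact: sm0.
Qed.
Lemma quo_rep_eq x y : W (x - y) -> quo_rep x = quo_rep y.
Proof.
move=> Wxy; congr xget; apply/seteqP; split=> z /= Wz.
  by rewrite -(subrKA x) -opprB; apply: smD => //; apply: smN.
by rewrite -(subrKA y); apply: smD.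
Qed.
Lemma quo_rep_id x : quo_rep (quo_rep x) = quo_rep x.
Proof. by apply: quo_rep_eq; rewrite -opprB; apply: smN; exact: quo_repP. Qed.

Definition quo_pred : pred X := fun x => quo_rep x == x.
Definition quo_mod := {x : X | quo_pred x}.
HB.instance Definition _ := SubChoice.on quo_mod.
HB.instance Definition _ := Choice.on quo_mod.

Definition quo_fun (x : X) : quo_mod :=
  exist quo_pred (quo_rep x) (introT eqP (quo_rep_id x)).

Lemma quo_fun_eq x y : quo_fun x = quo_fun y <-> W (x - y).
Proof.
split=> [/(congr1 val) /= e|/quo_rep_eq e]; last by apply: val_inj.
rewrite -(subrKA (quo_rep x)); apply: smD; first exact: quo_repP.
by rewrite -opprB e; apply: smN; exact: quo_repP.
Qed.
Lemma quo_funK (q : quo_mod) : quo_fun (val q) = q.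
Proof. by apply: val_inj => /=; apply/eqP; exact: valP q. Qed.
Lemma quo_val_fun x : W (val (quo_fun x) - x).
Proof. by rewrite -opprB; apply: smN; exact: quo_repP. Qed.

Definition quo_add (p q : quo_mod) := quo_fun (val p + val q).
Definition quo_opp (p : quo_mod) := quo_fun (- val p).
Definition quo_scale (a : K) (p : quo_mod) := quo_fun (a *: val p).

Lemma quo_addE x y : quo_add (quo_fun x) (quo_fun y) = quo_fun (x + y).
Proof.
apply/quo_fun_eq; rewrite opprD addrACA.
by apply: smD; exact: quo_val_fun.
Qed.
Lemma quo_oppE x : quo_opp (quo_fun x) = quo_fun (- x).
Proof. by apply/quo_fun_eq; rewrite -opprD; apply: smN; exact: quo_val_fun. Qed.
Lemma quo_scaleE a x : quo_scale a (quo_fun x) = quo_fun (a *: x).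
Proof. by apply/quo_fun_eq; rewrite -scalerBr; apply: smZ; exact: quo_val_fun. Qed.

Fact quo_addA : associative quo_add.
Proof.
move=> p q s; rewrite -(quo_funK p) -(quo_funK q) -(quo_funK s).
by rewrite !quo_addE addrA.
Qed.
Fact quo_addC : commutative quo_add.
Proof. by move=> p q; rewrite /quo_add addrC. Qed.
Fact quo_add0 : left_id (quo_fun 0) quo_add.
Proof. by move=> p; rewrite -(quo_funK p) quo_addE add0r. Qed.
Fact quo_addN : left_inverse (quo_fun 0) quo_opp quo_add.
Proof. by move=> p; rewrite -(quo_funK p) quo_oppE quo_addE addNr. Qed.
HB.instance Definition _ := GRing.isZmodule.Build quo_mod
  quo_addA quo_addC quo_add0 quo_addN.

Fact quo_scaleA a b p : quo_scale a (quo_scale b p) = quo_scale (a * b) p.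
Proof. by rewrite -(quo_funK p) !quo_scaleE scalerA. Qed.
Fact quo_scale1 : left_id 1 quo_scale.
Proof. by move=> p; rewrite -(quo_funK p) quo_scaleE scale1r. Qed.
Fact quo_scaleDr : right_distributive quo_scale +%R.
Proof.
move=> a p q; rewrite -(quo_funK p) -(quo_funK q).
by rewrite [_ + _ in LHS]quo_addE !quo_scaleE [RHS]quo_addE scalerDr.
Qed.
Fact quo_scaleDl p : {morph quo_scale^~ p : a b / a + b}.
Proof.
move=> a b; rewrite -(quo_funK p) !quo_scaleE.
by rewrite [RHS]quo_addE scalerDl.
Qed.
HB.instance Definition _ := GRing.Zmodule_isLmodule.Build K quo_mod
  quo_scaleA quo_scale1 quo_scaleDr quo_scaleDl.

Fact quo_linear : linear quo_fun.
Proof. by move=> a x y; rewrite -quo_addE -quo_scaleE. Qed.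
Definition quo : {linear X -> quo_mod} := lin_of quo_linear.
Lemma quo_surj : surj quo.
Proof. by move=> q; exists (val q); exact: quo_funK. Qed.
Lemma quo_eq0 x : quo x = 0 <-> W x.
Proof. by rewrite -{2}[x]subr0; exact: quo_fun_eq. Qed.
End Quotient.

Section LinearMaps.
Variables X Y : lmodType K.
Variable f : {linear X -> Y}.

Definition sm_ker : submod X.
Proof.
exists (fun x => f x = 0); first exact: linear0.
by move=> a x y; rewrite linearP => -> ->; rewrite scaler0 addr0.
Defined.

Definition sm_im (W : submod X) : submod Y.
Proof.
exists (fun y => exists2 x, W x & f x = y); first by exists 0; rewrite ?linear0 //; exact: sm0.
move=> a _ _ [x Wx <-] [y Wy <-]; exists (a *: x + y); last by rewrite linearP.
exact: smL.
Defined.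

Definition sm_pre (W : submod Y) : submod X.
Proof.
exists (fun x => W (f x)); first by rewrite /= linear0; exact: sm0.
by move=> a x y /= Wx Wy; rewrite linearP; exact: smL.
Defined.

Definition sm_full : submod X.
Proof. by exists (fun _ => True). Defined.

Definition sm_zero : submod X.
Proof. by exists (fun x => x = 0) => // a x y /= -> ->; rewrite scaler0 addr0. Defined.

Lemma lin_injP : (forall x, f x = 0 -> x = 0) -> injective f.
Proof.
move=> f0 x y fxy; apply/eqP; rewrite -subr_eq0; apply/eqP/f0.
by rewrite linearB fxy subrr.
Qed.

Lemma lin_inj0 : injective f -> forall x, f x = 0 -> x = 0.
Proof. by move=> fI x fx; apply: fI; rewrite fx linear0. Qed.

Lemma bij_inj_surj : bijective f <-> injective f /\ surj f.
Proof.
split=> [[g fg gf]|[fI fS]]; first by split; [exact: can_inj fg|move=> y; exists (g y)].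
have [g gP] := choice fS; exists g => // x.
by apply: fI; rewrite gP.
Qed.

Definition im_mod := sub_mod (sm_im sm_full).
Definition to_im : {linear X -> im_mod}.
Proof.
apply: (@lin_of _ _ (fun x => to_sub (W := sm_im sm_full) (ex_intro2 _ _ x I erefl))).
by move=> a x y; apply: val_inj; rewrite [RHS]linearP; exact: linearP.
Defined.
Lemma val_to_im x : val (to_im x) = f x. Proof. by []. Qed.
Lemma to_im_surj : surj to_im.
Proof.
move=> y; have [x _ xy] := sub_modP y.
by exists x; apply: val_inj.
Qed.
Lemma to_im_eq0 x : to_im x = 0 <-> f x = 0.
Proof.
split=> [e|fx]; first by rewrite -val_to_im e linear0.
by apply: val_inj; rewrite linear0 val_to_im.
Qed.

End LinearMaps.

Lemma lin_inv X Y (f : {linear X -> Y}) : bijective f ->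
  exists g : {linear Y -> X}, cancel f g /\ cancel g f.
Proof.
move=> [g fg gf]; have gL : linear g.
  by move=> a x y; apply: (can_inj fg); rewrite linearP !gf.
by exists (lin_of gL).
Qed.

Lemma iso_refl X : iso X X.
Proof. by exists (idfun : {linear X -> X}); exists idfun. Qed.
Lemma iso_sym X Y : iso X Y -> iso Y X.
Proof.
move=> [f /lin_inv[g [fg gf]]]; exists g; by exists f.
Qed.
Lemma iso_trans X Y Z : iso X Y -> iso Y Z -> iso X Z.
Proof. by move=> [f fb] [g gb]; exists (g \o f); exact: bij_comp. Qed.

Lemma lin_factor X Y Z (p : {linear X -> Y}) (f : {linear X -> Z}) :
  surj p -> (forall x, p x = 0 -> f x = 0) ->
  exists g : {linear Y -> Z}, forall x, g (p x) = f x.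
Proof.
move=> pS pf; have [s sP] := choice pS.
have key x y : p x = p y -> f x = f y.
  move=> e; apply/eqP; rewrite -subr_eq0 -linearB; apply/eqP/pf.
  by rewrite linearB e subrr.
have gL : linear (fun y => f (s y)).
  by move=> a x y; rewrite -linearP; apply: key; rewrite linearP !sP.
exists (lin_of gL) => x /=; exact/key/sP.
Qed.

Lemma lin_lift X Y Z (i : {linear X -> Y}) (f : {linear Z -> Y}) :
  injective i -> (forall z, exists x, i x = f z) ->
  exists g : {linear Z -> X}, forall z, i (g z) = f z.
Proof.
move=> iI fi; have [g gP] := choice fi.
have gL : linear g by move=> a x y; apply: iI; rewrite linearP !gP linearP.
by exists (lin_of gL).
Qed.

End Submodules.

Arguments sm_full {K X}.
Arguments sm_zero {K X}.

(** * Length *)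

Lemma ex_maximal (T : Type) (P : T -> Prop) (mu : T -> nat) (b : nat) :
  (exists x, P x) -> (forall x, P x -> (mu x <= b)%N) ->
  exists x, P x /\ forall y, P y -> (mu y <= mu x)%N.
Proof.
move=> [x0 Px0] Pb.
pose Q := fun n => `[< exists x, P x /\ mu x = n >].
have exQ : exists n, Q n by exists (mu x0); apply/asboolP; exists x0.
have Qb n : Q n -> (n <= b)%N by move=> /asboolP[x [/Pb Px <-]].
case: (ex_maxnP exQ Qb) => n /asboolP[x [Px <-]] nmax.
by exists x; split=> // y Py; apply: nmax; apply/asboolP; exists y.
Qed.

Lemma ex_minimal (T : Type) (P : T -> Prop) (mu : T -> nat) :
  (exists x, P x) -> exists x, P x /\ forall y, P y -> (mu x <= mu y)%N.
Proof.
move=> [x0 Px0].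
pose Q := fun n => `[< exists x, P x /\ mu x = n >].
have exQ : exists n, Q n by exists (mu x0); apply/asboolP; exists x0.
case: (ex_minnP exQ) => n /asboolP[x [Px <-]] nmin.
by exists x; split=> // y Py; apply: nmin; apply/asboolP; exists y.
Qed.

Section Length.
Variable K : pzRingType.
Implicit Types L M N X Y : lmodType K.

Definition strict M (V W : submod M) : Prop :=
  (forall x, V x -> W x) /\ exists x, W x /\ ~ V x.

Inductive chain_to M : nat -> submod M -> Prop :=
| chain_nil W : chain_to 0 W
| chain_step n V W : chain_to n V -> strict V W -> chain_to n.+1 W.

Definition has_chain M n := exists W : submod M, chain_to n W.
Definition fin_len M : Prop := exists b, forall n, has_chain M n -> (n <= b)%N.
(** Length is the largest number of strict inclusions, not the length of a composition series, so
    additivity on exact sequences needs no Jordan-Hölder theorem for modules. The value is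
    meaningful only under [fin_len]. *)
Definition len M : nat :=
  xget 0%N [set n | has_chain M n /\ forall m, has_chain M m -> (m <= n)%N].

Lemma lenP M : fin_len M ->
  has_chain M (len M) /\ forall n, has_chain M n -> (n <= len M)%N.
Proof.
move=> [b hb].
apply: (@xgetPex _ 0%N
  [set n | has_chain M n /\ forall m, has_chain M m -> (m <= n)%N]).
apply: (@ex_maximal nat (has_chain M) id b) => //.
by exists 0%N, sm_zero; exact: chain_nil.
Qed.

Lemma len_bound M b : (forall n, has_chain M n -> (n <= b)%N) ->
  fin_len M /\ (len M <= b)%N.
Proof.
move=> hb; have fM : fin_len M by exists b.
by split=> //; apply: hb; case: (lenP fM).
Qed.

Lemma chain_weak M n (V W : submod M) :
  (forall x, V x -> W x) -> chain_to n V -> chain_to n W.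
Proof.
move=> VW cV; case: cV VW => [V' _|m V' W' cV [VW' [x [Wx nVx]]] WW].
  exact: chain_nil.
apply: chain_step cV _; split; first by move=> y /VW'/WW.
by exists x; split=> //; exact: WW.
Qed.

Lemma chain_im M N (f : {linear M -> N}) n W : injective f ->
  chain_to n W -> chain_to n (sm_im f W).
Proof.
move=> fI; elim=> {n W} [W|n V W _ IH [VW [x [Wx nVx]]]]; first exact: chain_nil.
apply: chain_step IH _; split; first by move=> _ [y /VW Wy <-]; exists y.
by exists (f x); split; [exists x | move=> [y Vy /fI e]; apply: nVx; rewrite -e].
Qed.

Lemma chain_pre M N (f : {linear M -> N}) n W : surj f ->
  chain_to n W -> chain_to n (sm_pre f W).
Proof.
move=> fS; elim=> {n W} [W|n V W _ IH [VW [x [Wx nVx]]]]; first exact: chain_nil.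
apply: chain_step IH _; split; first by move=> y; exact: VW.
by have [y yx] := fS x; exists y; rewrite /= yx.
Qed.

Lemma has_chain_inj M N (f : {linear M -> N}) n : injective f ->
  has_chain M n -> has_chain N n.
Proof. by move=> fI [W cW]; exists (sm_im f W); exact: chain_im. Qed.

Lemma has_chain_surj M N (f : {linear M -> N}) n : surj f ->
  has_chain N n -> has_chain M n.
Proof. by move=> fI [W cW]; exists (sm_pre f W); exact: chain_pre. Qed.

Lemma fin_len_inj M N (f : {linear M -> N}) : injective f ->
  fin_len N -> fin_len M /\ (len M <= len N)%N.
Proof.
by move=> fI /lenP[_ hN]; apply: len_bound => n /(has_chain_inj fI); exact: hN.
Qed.

Lemma fin_len_surj M N (f : {linear M -> N}) : surj f ->
  fin_len M -> fin_len N /\ (len N <= len M)%N.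
Proof.
by move=> fI /lenP[_ hN]; apply: len_bound => n /(has_chain_surj fI); exact: hN.
Qed.

Section Exact.
Variables (L X N : lmodType K) (f : {linear L -> X}) (g : {linear X -> N}).
Hypothesis fg : short_exact f g.

Let fI : injective f. Proof. by case: fg. Qed.
Let gS : surj g. Proof. by case: fg. Qed.
Lemma short_exact_ker x : g x = 0 <-> exists y, f y = x.
Proof.
case: fg => _ _ e.
have -> : (g x = 0) = range f x by rewrite e.
by split=> [[y _ <-]|[y <-]]; [exists y|exists y].
Qed.

Lemma chain_cat a b : has_chain L a -> has_chain N b -> has_chain X (a + b)%N.
Proof.
move=> [W cW] [V cV]; exists (sm_pre g V); elim: cV => {b V} [V|n V V' _ IH [VV [x [Vx nVx]]]].
  rewrite addn0; apply: chain_weak (chain_im fI cW) => _ [y _ <-] /=.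
  have -> : g (f y) = 0 by apply/short_exact_ker; exists y.
  exact: sm0.
rewrite addnS; apply: chain_step IH _; split; first by move=> y; exact: VV.
by have [y yx] := gS x; exists y; rewrite /= yx.
Qed.

(** Each strict step V < W grows in L or in N: if some x in W outside V has the same image in N as
    some z in V, then x - z comes from L, lies in W and not in V. *)
Lemma chain_split n (W : submod X) : chain_to n W -> exists a b,
  [/\ (n <= a + b)%N, chain_to a (sm_pre f W) & chain_to b (sm_im g W)].
Proof.
elim=> {n W} [W|n V W _ [a [b [nab cL cN]]] [VW [x [Wx nVx]]]].
  by exists 0%N, 0%N; split=> //; exact: chain_nil.
have VWL y : sm_pre f V y -> sm_pre f W y by move=> /= /VW.
have VWN y : sm_im g V y -> sm_im g W y by move=> /= [z /VW Wz <-]; exists z.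
have [st|nst] := pselect (sm_im g V (g x)); last first.
  exists a, b.+1; split; [by rewrite addnS|exact: chain_weak cL|].
  by apply: chain_step cN _; split=> //; exists (g x); split=> //; exists x.
exists a.+1, b; split; [by []| |exact: chain_weak cN].
apply: chain_step cL _; split=> //; have [z Vz gz] := st.
have [y fy] : exists y, f y = x - z.
  by apply/short_exact_ker; rewrite linearB gz subrr.
exists y; split; rewrite /= fy; first by apply: smB => //; exact: VW.
by move=> Vxz; apply: nVx; rewrite -(subrK z x); exact: smD.
Qed.

Lemma len_exact : fin_len L -> fin_len N ->
  fin_len X /\ len X = (len L + len N)%N.
Proof.
move=> /lenP[cL hL] /lenP[cN hN].
have [|fX le] := @len_bound X (len L + len N)%N.
  move=> n [W /chain_split[a [b [nab ca cb]]]]; apply: (leq_trans nab).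
  by apply: leq_add; [apply: hL; exists (sm_pre f W)|apply: hN; exists (sm_im g W)].
split=> //; apply/eqP; rewrite eqn_leq le /=.
by have [_ h] := lenP fX; apply: h; exact: chain_cat.
Qed.

Lemma len_exactE : fin_len X -> len X = (len L + len N)%N.
Proof.
move=> fX; have [fL _] := fin_len_inj fI fX; have [fN _] := fin_len_surj gS fX.
by case: (len_exact fL fN).
Qed.
End Exact.

Lemma ker_im_exact X N (g : {linear X -> N}) :
  short_exact (incl (sm_ker g)) (to_im g).
Proof.
split; [exact: incl_inj|exact: to_im_surj|rewrite range_incl].
by apply/seteqP; split=> x /= h; apply/(to_im_eq0 g x).
Qed.

Lemma len_zero M : is_zero M -> fin_len M /\ len M = 0%N.
Proof.
move=> M0; have [|fM] := @len_bound M 0.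
  move=> n [W cW]; case: cW => // m V V' _ [_ [x [_ nVx]]].
  by case: nVx; rewrite (M0 x); exact: sm0.
by rewrite leqn0 => /eqP.
Qed.

Lemma len_inj_surj L X (f : {linear L -> X}) : injective f -> fin_len X ->
  (len X <= len L)%N -> surj f.
Proof.
move=> fI fX le; apply: contrapT => nS.
have [y ny] : exists y, ~ exists x, f x = y by apply/existsNP.
have [fL _] := fin_len_inj fI fX; have [[W cW] _] := lenP fL.
have [_ hX] := lenP fX.
have : (len L < len X)%N.
  apply: hX; exists sm_full; apply: chain_step (chain_im fI cW) _.
  by split=> //; exists y; split=> // -[x _ fx]; apply: ny; exists x.
by rewrite ltnNge le.
Qed.

Lemma len_eq0 M : fin_len M -> len M = 0%N -> is_zero M.
Proof.
move=> fM lM.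
have Z : is_zero (sub_mod (@sm_zero _ M)).
  by move=> x; apply: val_inj; rewrite linear0; exact: sub_modP x.
have S : surj (incl (@sm_zero _ M)).
  by apply: (len_inj_surj (@incl_inj _ _ _) fM); rewrite lM.
by move=> x; have [y <-] := S x; rewrite (Z y) linear0.
Qed.

Lemma len_iso M N : iso M N -> fin_len M -> fin_len N /\ len N = len M.
Proof.
move=> [f fb] fM; have [g [fg gf]] := lin_inv fb.
have [fI fS] := (bij_inj_surj f).1 fb.
have [fN le] := fin_len_surj fS fM.
have [_ ge] := fin_len_inj fI fN.
by split=> //; apply/eqP; rewrite eqn_leq le ge.
Qed.

Lemma im_surj_len X N (f : {linear X -> N}) :
  surj f -> fin_len N -> len (im_mod f) = len N.
Proof.
move=> fS fN; apply: (proj2 (len_iso _ fN)); apply: iso_sym.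
exists (incl (sm_im f sm_full)); apply/bij_inj_surj; split; first exact: incl_inj.
by move=> y; have [x <-] := fS y; exists (to_im f x).
Qed.

Lemma len_inj_bij M (f : {linear M -> M}) : fin_len M -> injective f -> bijective f.
Proof. by move=> fM fI; apply/bij_inj_surj; split=> //; exact: len_inj_surj. Qed.
Lemma fin_len_sub M (W : submod M) : fin_len M ->
  fin_len (sub_mod W) /\ (len (sub_mod W) <= len M)%N.
Proof. exact: (fin_len_inj (@incl_inj _ _ W)). Qed.

Lemma len_strict M (V W : submod M) : fin_len M -> strict V W ->
  (len (sub_mod V) < len (sub_mod W))%N.
Proof.
move=> fM [VW [x [Wx nVx]]].
have [f fE] := @lin_lift _ _ _ _ (incl W) (incl V) (@incl_inj _ _ W)
  (fun v => ex_intro _ (to_sub (VW _ (sub_modP v))) erefl).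
rewrite ltnNge; apply/negP=> le.
have fI : injective f.
  by move=> v w e; apply: val_inj; rewrite -!inclE -!fE e.
have [v vE] := len_inj_surj fI (fin_len_sub W fM).1 le (to_sub Wx).
by apply: nVx; have := fE v; rewrite vE !inclE val_to_sub => ->; exact: sub_modP.
Qed.

Lemma len_strict_full M (W : submod M) : fin_len M -> ~ (forall x, W x) ->
  (len (sub_mod W) < len M)%N.
Proof.
move=> fM nW; rewrite ltnNge; apply/negP => le; apply: nW => x.
have [y <-] := len_inj_surj (@incl_inj _ _ W) fM le x.
by exact: sub_modP.
Qed.

Lemma ex_max_submod M (P : submod M -> Prop) : fin_len M -> (exists W, P W) ->
  exists W, P W /\ forall V, P V -> (forall x, W x -> V x) -> V = W.
Proof.
move=> fM exP; have [|W [PW Wmax]] :=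
    @ex_maximal _ P (fun W => len (sub_mod W)) (len M) exP.
  by move=> W _; case: (fin_len_sub W fM).
exists W; split=> // V PV WV; apply: submod_eq; apply/seteqP; split=> // x Vx.
apply: contrapT => nWx; have := Wmax V PV; rewrite leqNgt => /negP; apply.
by apply: len_strict => //; split=> //; exists x.
Qed.

Lemma ex_min_submod M (P : submod M -> Prop) : fin_len M -> (exists W, P W) ->
  exists W, P W /\ forall V, P V -> (forall x, V x -> W x) -> V = W.
Proof.
move=> fM exP; have [W [PW Wmin]] :=
    @ex_minimal _ P (fun W => len (sub_mod W)) exP.
exists W; split=> // V PV VW; apply: submod_eq; apply/seteqP; split=> // x Wx.
apply: contrapT => nWx; have := Wmin V PV; rewrite leqNgt => /negP; apply.
by apply: len_strict => //; split=> //; exists x.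
Qed.

Lemma prod_exact X Y : exists (f : {linear X -> (X * Y)%type})
  (g : {linear (X * Y)%type -> Y}), short_exact f g.
Proof.
have fL : linear (fun x : X => (x, 0 : Y)).
  by move=> a x y; congr pair; rewrite /= scaler0 addr0.
have gL : linear (fun p : X * Y => p.2) by [].
exists (lin_of fL), (lin_of gL); split.
- by move=> x y [].
- by move=> y; exists (0, y).
- apply/seteqP; split=> [_ [x _ <-] //|[x y] /= e]; exists x => //.
  by congr pair; exact/esym.
Qed.

Lemma len_prod X Y : fin_len X -> fin_len Y ->
  fin_len (X * Y)%type /\ len (X * Y)%type = (len X + len Y)%N.
Proof. by move=> fX fY; have [f [g fg]] := prod_exact X Y; exact: (len_exact fg). Qed.

Lemma fin_len_ffun X n : fin_len X -> fin_len {ffun 'I_n -> X}.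
Proof.
move=> fX; elim: n => [|n IH].
  have Z : is_zero {ffun 'I_0 -> X} by move=> x; apply/ffunP => -[].
  by case: (len_zero Z).
have fL : linear (fun x : {ffun 'I_n.+1 -> X} =>
    (x ord0, [ffun i : 'I_n => x (lift ord0 i)])).
  by move=> a x y; congr pair; [|apply/ffunP=> i]; rewrite !ffunE.
have fI : injective (lin_of fL).
  move=> x y [e0 /ffunP e]; apply/ffunP=> i.
  by case: (unliftP ord0 i) => [j ->|->] //; have := e j; rewrite !ffunE.
by case: (fin_len_inj fI (len_prod fX IH).1).
Qed.

Lemma fingen_surj M : fingen M <->
  exists n (f : {linear {ffun 'I_n -> K^o} -> M}), surj f.
Proof.
split=> [[s sP]|[n [f fS]]].
  have fL : linear (fun c : {ffun 'I_(size s) -> K^o} =>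
      \sum_(i < size s) (c i : K) *: s`_i).
    move=> a x y; rewrite scaler_sumr -big_split /=; apply: eq_bigr => i _.
    by rewrite !ffunE scalerDl scalerA.
  exists (size s), (lin_of fL) => x; have [c ->] := sP x.
  by exists [ffun i => c i] => /=; apply: eq_bigr => i _; rewrite ffunE.
pose e (i : 'I_n) : {ffun 'I_n -> K^o} := [ffun j => (j == i)%:R].
pose s := [seq f (e i) | i <- enum 'I_n].
have sz : size s = n by rewrite size_map size_enum_ord.
exists s => y; have [c <-] := fS y; exists (fun i => c (cast_ord sz i)).
have cE : c = \sum_(i < n) (c i : K) *: e i.
  apply/ffunP => j; rewrite sum_ffunE (bigD1 j) //= big1 ?addr0.
    by rewrite !ffunE eqxx [RHS]mulr1.
  by move=> i ij; rewrite !ffunE eq_sym (negPf ij) [LHS]mulr0.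
rewrite [in LHS]cE linear_sum (reindex (cast_ord sz)) /=; last first.
  by exists (cast_ord (esym sz)) => i _; rewrite ?cast_ordK ?cast_ordKV.
apply: eq_bigr => i _; rewrite linearZ (nth_map (cast_ord sz i)) ?size_enum_ord -?sz //.
congr (_ *: f (e _)).
by apply: val_inj; rewrite /= nth_enum_ord // -sz.
Qed.

Lemma fingen_fin_len M : fin_len (K^o : lmodType K) -> fingen M -> fin_len M.
Proof.
move=> fK /fingen_surj[n [f fS]].
by case: (fin_len_surj fS (fin_len_ffun n fK)).
Qed.
End Length.

(** * Artinian rings *)

Section Cyclic.
Variables (K : pzRingType) (M : lmodType K).

Fact scale_at_linear (v : M) : linear (fun a : K^o => (a : K) *: v).
Proof. by move=> a x y; rewrite scalerDl scalerA. Qed.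
Definition scale_at v : {linear K^o -> M} := lin_of (scale_at_linear v).
Definition sm_cycl v : submod M := sm_im (scale_at v) sm_full.
Lemma sm_cyclP v x : sm_cycl v x <-> exists a : K, x = a *: v.
Proof. by split=> [[a _ <-]|[a ->]]; exists a. Qed.

Definition sm_add (V W : submod M) : submod M.
Proof.
exists (fun x => exists v w, [/\ V v, W w & x = v + w]).
  by exists 0, 0; split; [exact: sm0|exact: sm0|rewrite addr0].
move=> a _ _ [v [w [Vv Ww ->]]] [v' [w' [Vv' Ww' ->]]].
exists (a *: v + v'), (a *: w + w'); split; [exact: smL|exact: smL|].
by rewrite scalerDr addrACA.
Defined.

Lemma sm_add_surj (V W : submod M) :
  exists f : {linear (sub_mod V * sub_mod W)%type -> sub_mod (sm_add V W)}, surj f.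
Proof.
have H (p : sub_mod V * sub_mod W) : sm_add V W (val p.1 + val p.2).
  by exists (val p.1), (val p.2); split=> //; exact: sub_modP.
have fL : linear (fun p => to_sub (H p)).
  move=> a p q; apply: val_inj; rewrite [RHS]linearP /=.
  by rewrite scalerDr addrACA.
exists (lin_of fL) => x; have [v [w [Vv Ww xE]]] := sub_modP x.
by exists (to_sub Vv, to_sub Ww); apply: val_inj; rewrite xE.
Qed.

Lemma fin_len_add (V W : submod M) : fin_len (sub_mod V) -> fin_len (sub_mod W) ->
  fin_len (sub_mod (sm_add V W)).
Proof.
move=> fV fW; have [f fS] := sm_add_surj V W.
by case: (fin_len_surj fS (len_prod fV fW).1).
Qed.

Lemma len_le1 : (forall x y : M, x <> 0 -> exists a : K, y = a *: x) ->
  fin_len M /\ (len M <= 1)%N.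
Proof.
move=> H; apply: len_bound => n [W cW].
case: cW => // m V V' cV [_ [x [V'x nVx]]].
case: cV V'x nVx => // k U U' _ [_ [z [U'z nUz]]] _ nUx.
have [a ax] : exists a : K, x = a *: z by apply: H => z0; apply: nUz; rewrite z0; exact: sm0.
by case: nUx; rewrite ax; exact: smZ.
Qed.

Lemma fin_len_full : fin_len (sub_mod (@sm_full _ M)) -> fin_len M.
Proof.
move=> f; have S : surj (incl (@sm_full _ M)) by move=> x; exists (@to_sub _ _ sm_full x I).
by case: (fin_len_surj S f).
Qed.
End Cyclic.

Section ArtinianRing.
Variable R : comPzRingType.

Definition ideal_of (W : submod R^o) : set R := sm_set W.
Lemma ideal_ofP W : is_ideal (ideal_of W).
Proof. by split; [exact: sm0|move=> x y; exact: smD|move=> a x; exact: smZ]. Qed.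

Definition submod_of_ideal (I : set R) (HI : is_ideal I) : submod R^o.
Proof.
exists (I : R^o -> Prop); first by case: HI.
by case: HI => _ ID IM a x y Ix Iy; apply: ID => //; exact: IM.
Defined.

Lemma artinian_min (P : submod R^o -> Prop) : artinian R -> (exists W, P W) ->
  exists W, P W /\ forall V, P V -> (forall x, V x -> W x) -> V = W.
Proof.
move=> aR [W0 PW0]; apply: contrapT => nmin.
have step (W : {W | P W}) : exists V : {W | P W}, strict (sval V) (sval W).
  case: W => W PW; apply: contrapT => nV; apply: nmin; exists W; split=> // V PV VW.
  apply: submod_eq; apply/seteqP; split=> // x Wx.
  by apply: contrapT => nVx; apply: nV; exists (exist _ V PV); split=> //; exists x.
have [f fP] := choice step.
pose c n := sval (iter n f (exist _ W0 PW0)).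
have [||N cN] := aR (fun n => ideal_of (c n)).
- by move=> n; exact: ideal_ofP.
- by move=> n x; have [h _] := fP (iter n f (exist _ W0 PW0)); exact: h.
have [_ [x [Wx nVx]]] := fP (iter N f (exist _ W0 PW0)).
by apply: nVx; have /seteqP[_ h] := cN N.+1 (leqnSn N); exact: (h x Wx).
Qed.

Fact mul_by_linear (x : R) : linear (fun i : R^o => x * (i : R) : R^o).
Proof. by move=> a i j; rewrite [LHS]mulrDr; congr (_ + _); exact: mulrCA. Qed.
Definition mul_by x : {linear R^o -> R^o} := lin_of (mul_by_linear x).

(** Maximality must come from Zorn's lemma, because [I] will be an ideal not yet known to have
    finite length. In the minimal ideal below, [W] is the hyperplane complementary to the line
    through [v]. *)
Lemma ex_avoiding (M : lmodType R) (I : submod M) (v : M) : v <> 0 ->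
  exists W : submod M, [/\ forall x, W x -> I x, ~ W v &
    forall V : submod M, (forall x, V x -> I x) -> ~ V v ->
      (forall x, W x -> V x) -> V = W].
Proof.
move=> v0; pose P (W : submod M) := (forall x, W x -> I x) /\ ~ W v.
pose T := {W : submod M | P W}.
have z0 : (forall x, @sm_zero _ M x -> I x) /\ ~ @sm_zero _ M v.
  by split=> // x ->; exact: sm0.
pose r (V W : T) := `[< forall x, sval V x -> sval W x >].
have [||||[W [WI nWv]] Wmax] := @Zorn T r.
- by move=> V; apply/asboolP.
- by move=> V W U /asboolP h /asboolP g; apply/asboolP => x /h/g.
- move=> [V pV] [W pW] /asboolP /= h /asboolP /= g.
  have e : V = W by apply: submod_eq; apply/seteqP; split.
  by subst W; congr exist; exact: Prop_irrelevance.
- move=> C Ctot; have [[c0 Cc0]|nC] := pselect (exists c, C c); last first.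
    by exists (exist P _ z0) => s Cs; case: nC; exists s.
  have Ud : forall a x y, (exists2 c, C c & sval c x) -> (exists2 c, C c & sval c y) ->
      exists2 c, C c & sval c (a *: x + y).
    move=> a x y [c Cc cx] [d Cd dy].
    have [/asboolP h|/asboolP h] := Ctot c d Cc Cd.
      by exists d => //; apply: smL => //; exact: h.
    by exists c => //; apply: smL => //; exact: h.
  pose U := Submod (ex_intro2 _ _ c0 Cc0 (sm0 (sval c0))) Ud.
  have pU : (forall x, U x -> I x) /\ ~ U v.
    split; first by move=> x [c _ cx]; have [h _] := svalP c; exact: h.
    by move=> [c _ cx]; have [_ h] := svalP c; exact: h.
  by exists (exist P U pU) => s Cs; apply/asboolP => x sx; exists s.
exists W; split=> // V VI nVv WV.
have /(congr1 sval) := Wmax (exist P V (conj VI nVv)) (asboolT WV).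
by [].
Qed.

(* A minimal ideal [I] of infinite length would be a vector space over the field
   [R / ann I], all of whose hyperplanes have finite length. *)
Lemma artinian_fin_len : artinian R -> fin_len (R^o : lmodType R).
Proof.
move=> aR; apply: contrapT => nR.
have [|I [nI Imin]] := @artinian_min (fun W => ~ fin_len (sub_mod W)) aR.
  by exists sm_full => /fin_len_full.
have fprop (V : submod R^o) : (forall x, V x -> I x) -> ~ fin_len (sub_mod V) ->
    forall x, I x -> V x.
  by move=> VI nV; rewrite (Imin V nV VI).
(* Kernel and image of multiplication by [x] on [I] cannot both have finite length, and by
   minimality the one that does not is all of [I]. *)
have dich (x : R) : (forall i : R, I i -> x * i = 0) \/
    (forall i : R, I i -> exists2 j : R, I j & i = x * j).
  pose m : {linear sub_mod I -> R^o} := mul_by x \o incl I.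
  have [fi|nfi] := pselect (fin_len (im_mod m)).
    left=> i Ii; have nk : ~ fin_len (sub_mod (sm_ker m)).
      by move=> fk; apply: nI; case: (len_exact (ker_im_exact m) fk fi).
    pose W := sm_im (incl I) (sm_ker m).
    have nW : ~ fin_len (sub_mod W).
      move=> fW; apply: nk.
      have [g gE] := @lin_lift _ _ _ _ (incl W) (incl I \o incl (sm_ker m))
        (@incl_inj _ _ W) (fun z => ex_intro _
          (to_sub (ex_intro2 _ _ (incl (sm_ker m) z) (sub_modP z) erefl : W _)) erefl).
      have gI : injective g.
        move=> a b e; apply: incl_inj; apply: incl_inj.
        by rewrite -[LHS]gE -[RHS]gE e.
      by case: (fin_len_inj gI fW).
    have WI z : W z -> I z by move=> [y _ <-]; exact: sub_modP.
    have [y ky yi] := fprop W WI nW i Ii.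
    by rewrite -yi; exact: ky.
  right=> i Ii.
  have [|j _ ji] := fprop (sm_im m sm_full) _ nfi i Ii.
    by move=> _ [j _ <-]; apply: (smZ (W := I)); exact: sub_modP.
  by exists (val j) => //; exact: sub_modP.
(* An [x] that does not kill [I] satisfies x I = I, so every i is x^N j. The chain of ideals
   generated by the powers of x stops, which gives x^N = r x^(N+1), and this [r] inverts [x] on
   [I]. *)
have inv (x : R) : ~ (forall i : R, I i -> x * i = 0) ->
    exists r : R, forall i : R, I i -> r * x * i = i.
  move=> nx; have xI : forall i : R, I i -> exists2 j : R, I j & i = x * j.
    by case: (dich x).
  have xnI n : forall i : R, I i -> exists2 j : R, I j & i = x ^+ n * j.
    elim: n => [|n IH] i Ii; first by exists i => //; rewrite mul1r.
    have [j Ij ->] := IH i Ii; have [k Ik ->] := xI j Ij.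
    by exists k => //; rewrite mulrA -exprSr.
  pose X n : submod R^o := sm_cycl (x ^+ n : R^o).
  have [||N XN] := aR (fun n => ideal_of (X n)); first by move=> n; exact: ideal_ofP.
    move=> n z [a _ <-]; exists (a * x) => //=.
    by rewrite exprS; exact/esym/mulrA.
  have : ideal_of (X N.+1) (x ^+ N) by rewrite (XN N.+1 (leqnSn N)); exists 1 => //=; exact: mul1r.
  move=> [r _ /= rE]; exists r => i Ii; have [j Ij ->] := xnI N i Ii.
  by rewrite -{2}rE -[_ *: _]/(r * x ^+ N.+1) exprS !mulrA.
have [v [Iv v0]] : exists v : R, I v /\ v <> 0.
  apply: contrapT => nv; apply: nI.
  have z : is_zero (sub_mod I).
    move=> i; apply: val_inj; rewrite linear0; apply: contrapT => i0.
    by apply: nv; exists (val i); split=> //; exact: sub_modP.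
  by case: (len_zero z).
have [W [WI nWv Wmax]] := @ex_avoiding R^o I v v0.
have [fW|nfW] := pselect (fin_len (sub_mod W)); last first.
  by apply: nWv; exact: (fprop W).
have invv (a : R) (u : R) : I u -> a * u <> 0 -> exists r, r * (a * u) = u.
  move=> Iu au; have [|r rE] := inv a; first by move=> h; apply: au; exact: h.
  by exists r; rewrite mulrA; exact: rE.
have fv : fin_len (sub_mod (sm_cycl (v : R^o))).
  apply: (proj1 (len_le1 _)) => x y x0.
  have [a ax] := (sm_cyclP (v : R^o) (val x)).1 (sub_modP x).
  have [b bE] := (sm_cyclP (v : R^o) (val y)).1 (sub_modP y).
  have [|r rE] := invv a v Iv.
    by move=> e; apply: x0; apply: val_inj; rewrite linear0 ax.
  exists (b * r); apply: val_inj; rewrite linearZ /= ax bE.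
  by rewrite -[RHS]/(b * r * (a * v)) -mulrA rE.
apply: nI; have [f1 _] := len_iso (iso_refl _) (fin_len_add fW fv).
suff WvI : forall u, I u -> sm_add W (sm_cycl (v : R^o)) u.
  have [g gE] := @lin_lift _ _ _ _ (incl _) (incl I) (@incl_inj _ _ (sm_add W (sm_cycl (v : R^o))))
    (fun z => ex_intro _ (to_sub (WvI _ (sub_modP z))) erefl).
  have gI : injective g by move=> a b e; apply: incl_inj; rewrite -[LHS]gE -[RHS]gE e.
  by case: (fin_len_inj gI f1).
(* Exchange: by maximality of [W], adding [u] brings in v = w + a u with a u nonzero, and inverting
   [a] on [u] expresses [u] through [w] and [v]. *)
move=> u Iu; apply: contrapT => nu.
have [Wu|nWu] := pselect (W u).
  by apply: nu; exists u, 0; split=> //; [exact: sm0|rewrite addr0].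
pose V := sm_add W (sm_cycl (u : R^o)).
have WV x : W x -> V x by move=> Wx; exists x, 0; split=> //; [exact: sm0|rewrite addr0].
have Vu : V u.
  exists 0, u; split; [exact: sm0| |by rewrite add0r].
  by apply/sm_cyclP; exists 1; rewrite scale1r.
have VI x : V x -> I x.
  move=> [w [t [Ww /sm_cyclP[a ->] ->]]]; apply: smD; first exact: WI.
  exact: smZ.
have [Vv|nVv] := pselect (V v); last by apply: nWu; rewrite -(Wmax V VI nVv WV).
have [w [t [Ww /sm_cyclP[a tE] vE]]] := Vv.
have [|r rE] := invv a u Iu.
  move=> e; apply: nWv; rewrite vE tE.
  by rewrite -[_ *: _]/(a * u) e addr0.
apply: nu; exists (- (r *: w)), (r *: (v : R^o)); split.
- by apply: smN; exact: smZ.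
- by apply/sm_cyclP; exists r.
- rewrite vE scalerDr addrA addNr add0r tE; exact/esym.
Qed.
End ArtinianRing.

(** * Matlis duality *)

Section HomModule.
Variables (R : comPzRingType) (K : pzRingType).

Record central_map := CentralMap {
  cmap :> R -> K;
  cmapD : forall a b, cmap (a + b) = cmap a + cmap b;
  cmapM : forall a b, cmap (a * b) = cmap a * cmap b;
  cmap1 : cmap 1 = 1;
  cmap_central : forall r x, cmap r * x = x * cmap r }.

Variables (c : central_map) (X Y : lmodType K).

(** The vacuous [let] keeps [c] in the type, so that the R-action, which depends on [c], can be
    attached as an instance. *)
Definition chom : Type := let _ := c in Hom X Y.
HB.instance Definition _ := GRing.Zmodule.on chom.

Fact chom_scale_linear (r : R) (f : chom) : linear (fun x => c r *: f x).
Proof.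
move=> a x y; rewrite linearP scalerDr !scalerA.
by rewrite cmap_central.
Qed.
Definition chom_scale (r : R) (f : chom) : chom := mkHom (chom_scale_linear r f).
Fact chom_scaleA a b f : chom_scale a (chom_scale b f) = chom_scale (a * b) f.
Proof. by apply: HomP => x; rewrite /chom_scale /hom_fun /= scalerA cmapM. Qed.
Fact chom_scale1 : left_id 1 chom_scale.
Proof. by move=> f; apply: HomP => x; rewrite /chom_scale /hom_fun /= cmap1 scale1r. Qed.
Fact chom_scaleDr : right_distributive chom_scale +%R.
Proof. by move=> a f g; apply: HomP => x; exact: scalerDr. Qed.
Fact chom_scaleDl f : {morph chom_scale^~ f : a b / a + b}.
Proof.
move=> a b; apply: HomP => x; rewrite /chom_scale {1}/hom_fun /= cmapD.
exact: scalerDl.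
Qed.
HB.instance Definition _ := GRing.Zmodule_isLmodule.Build R chom
  chom_scaleA chom_scale1 chom_scaleDr chom_scaleDl.

Lemma chomDE (f g : chom) x : (f + g : chom) x = f x + g x. Proof. by []. Qed.
Lemma chomZE r (f : chom) x : (r *: f : chom) x = c r *: f x. Proof. by []. Qed.
Lemma chomP (f g : chom) : (forall x, f x = g x) -> f = g.
Proof. exact: HomP. Qed.
End HomModule.

Section HomFunctor.
Variables (R : comPzRingType) (K : pzRingType) (c : central_map R K).
Implicit Types X Y Z : lmodType K.

Fact chom_pre_linear X Y Z (f : {linear X -> Y}) :
  linear (fun g : chom c Y Z => (((g : {linear Y -> Z}) \o f : {linear X -> Z}) : chom c X Z)).
Proof. by move=> a g h; apply: chomP. Qed.
Definition chom_pre X Y Z (f : {linear X -> Y}) : {linear chom c Y Z -> chom c X Z} :=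
  lin_of (@chom_pre_linear X Y Z f).
Lemma chom_preE X Y Z (f : {linear X -> Y}) (g : chom c Y Z) x :
  chom_pre Z f g x = g (f x).
Proof. by []. Qed.

Definition to_chom X Y (f : {linear X -> Y}) : chom c X Y := f.
Lemma to_chomE X Y (f : {linear X -> Y}) x : to_chom f x = f x. Proof. by []. Qed.
End HomFunctor.

Definition id_central (R : comPzRingType) : central_map R R :=
  @CentralMap R R id (fun _ _ => erefl) (fun _ _ => erefl) erefl (@mulrC R).

Section Dualizing.
Variables (R : comPzRingType) (J : lmodType R).
Hypothesis fR : fin_len (R^o : lmodType R).
Hypothesis dJ : dualizing_module J.

Lemma max_ideal_field (m : set R) (x : R) : maximal_ideal m -> ~ m x ->
  exists r : R, m (1 - r * x).
Proof.
move=> [[m0 mD mM] mT mmax] nmx.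
pose I : set R := fun y => exists a r, m a /\ y = a + r * x.
have II : is_ideal I.
  split; first by exists 0, 0; rewrite mul0r addr0.
    move=> _ _ [a [r [ma ->]]] [b [s [mb ->]]]; exists (a + b), (r + s).
    by split; [exact: mD|rewrite mulrDl addrACA].
  move=> t _ [a [r [ma ->]]]; exists (t * a), (t * r).
  by split; [exact: mM|rewrite mulrDr mulrA].
have [|eI|eI] := mmax I II; first by move=> a ma; exists a, 0; rewrite mul0r addr0.
- by case: nmx; rewrite -eI; exists 0, 1; rewrite mul1r add0r.
- have : I 1 by rewrite eI.
  by move=> [a [r [ma ->]]]; exists r; rewrite addrK.
Qed.

Lemma max_ideal_prime (m : set R) (x y : R) : maximal_ideal m ->
  m (x * y) -> ~ m x -> m y.
Proof.
move=> mm mxy nmx; have [r mr] := max_ideal_field mm nmx.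
case: mm => [[_ mD mM] _ _].
have -> : y = y * (1 - r * x) + r * (x * y).
  by rewrite mulrBr mulr1 mulrCA (mulrC y) mulrA subrK.
by apply: mD; apply: mM.
Qed.

Lemma max_ideal_not1 (m : set R) : maximal_ideal m -> ~ m 1.
Proof.
move=> [[_ _ mM] mT _] m1; apply: mT; apply/seteqP; split=> // x _.
by rewrite -[x]mulr1; exact: mM.
Qed.

Lemma max_ideal_above (N : submod (R^o : lmodType R)) : ~ N 1 ->
  exists m : set R, maximal_ideal m /\ sm_set N `<=` m.
Proof.
move=> nN; have [|W [[NW nW] Wmax]] :=
    @ex_max_submod _ R^o (fun W => (forall x, N x -> W x) /\ ~ W 1) fR.
  by exists N.
exists (ideal_of W); split=> //; split; first exact: ideal_ofP.
  by move=> e; apply: nW; have : ideal_of W 1 by rewrite e.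
move=> I II WI; have [I1|nI1] := pselect (I 1).
  right; apply/seteqP; split=> // x _; case: II => _ _ IM.
  by rewrite -[x]mulr1; exact: IM.
left; rewrite -(Wmax (submod_of_ideal II)) //.
by split=> // x Nx; apply: WI; exact: NW.
Qed.

(* For a maximal ideal [m], an ideal [K] that is minimal among those not inside
   [m] lies in all other maximal ideals. *)
Lemma max_ideal_socle (m : set R) : maximal_ideal m ->
  exists x : R, ~ m x /\ forall y, m y -> jacobson_radical (y * x).
Proof.
move=> mm; have [|K [[x0 [Kx0 nmx0]] Kmin]] :=
    @ex_min_submod _ R^o (fun W => exists x, W x /\ ~ m x) fR.
  by exists sm_full, 1; split=> //; exact: max_ideal_not1.
exists x0; split=> // y my m' mm'.
have [[_ _ mM'] nT' max'] := mm'; have [Im nT max] := mm.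
have [e|ne] := pselect (m = m').
  by rewrite -e mulrC; case: Im => _ _; apply.
apply: (mM'); have [a [ma na]] : exists a, m' a /\ ~ m a.
  apply: contrapT => h; case: (max' m Im) => [a ma|e|e //]; last exact: ne.
  by apply: contrapT => nma; apply: h; exists a.
pose aK := sm_im (mul_by a) K.
have aKK : aK = K.
  apply: Kmin; last by move=> _ [k Kk <-]; exact: smZ.
  exists (a * x0); split; first by exists x0.
  by move=> h; apply: nmx0; exact: max_ideal_prime mm h na.
have [k _ <-] : aK x0 by rewrite aKK.
by rewrite [mul_by a k]mulrC; exact: mM'.
Qed.

Let rad := @jacobson_radical R.

(** The [x] of [max_ideal_socle] spans a copy of R / m inside R / rad R, which embeds in J. *)
Lemma killed_functional (m : set R) : maximal_ideal m ->
  exists j : J, j <> 0 /\ forall y, m y -> y *: j = 0.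
Proof.
move=> mm; have [x [nmx mx]] := max_ideal_socle mm.
case: dJ => S [p [i [pS pk [_ iI _]]]].
have pr y : p y = 0 <-> rad y by rewrite /rad -pk.
exists (i (p x)); split.
  by move=> /(lin_inj0 iI)/pr h; apply: nmx; exact: h.
by move=> y my; rewrite -!linearZ (_ : p _ = 0) ?linear0 //; apply/pr; exact: mx.
Qed.

Lemma J_inj : injective_module J.
Proof. by case: dJ => S [p [i [_ _ []]]]. Qed.

(** The annihilator of [v] lies in some maximal ideal m, so the cyclic module on [v] maps to J by
    sending [v] to a nonzero element killed by m; injectivity of J extends this map to V. *)
Lemma cogenerator (V : lmodType R) (v : V) : v <> 0 ->
  exists f : {linear V -> J}, f v <> 0.
Proof.
move=> v0; pose q := to_im (scale_at v).
have [|m [mm Nm]] := @max_ideal_above (sm_ker (scale_at v)).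
  by rewrite /= scale1r.
have [j [j0 mj]] := killed_functional mm.
have [|g gE] := @lin_factor _ _ _ _ q (scale_at j) (@to_im_surj _ _ _ _).
  by move=> x /to_im_eq0 e; apply: mj; exact: Nm.
have [h hE] := J_inj g (@incl_inj _ _ (sm_im (scale_at v) sm_full)).
have : h (scale_at v 1) = scale_at j 1 by rewrite -gE -hE.
by rewrite /= !scale1r => e; exists h; rewrite e.
Qed.

(** The part of J killed by m is a line over R / m. Essentiality puts it inside R / rad R, and there
    its nonzero elements are represented by ring elements that lie in every maximal ideal except m;
    two such agree modulo rad R up to a factor. *)
Lemma socle_killed (m : set R) (j j' : J) : maximal_ideal m -> j <> 0 ->
  (forall y, m y -> y *: j = 0) -> (forall y, m y -> y *: j' = 0) ->
  exists r, j' = r *: j.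
Proof.
move=> mm j0 mj mj'; case: dJ => S [p [i [pS pk [_ iI ess]]]].
have pr y : p y = 0 <-> rad y by rewrite /rad -pk.
have soc (u : J) : u <> 0 -> (forall y, m y -> y *: u = 0) ->
    exists x : R, u = i (p x) /\ ~ rad x.
  move=> u0 mu; pose g := quo (sm_cycl u).
  have [s [s0 gs]] : exists s, s <> 0 /\ g (i s) = 0.
    apply: contrapT => h; apply: u0; have gI : injective g.
      apply: ess; apply: (@lin_injP _ _ _ (g \o i)) => s gs.
      by apply: contrapT => s0; apply: h; exists s.
    apply: (lin_inj0 gI); apply/quo_eq0/sm_cyclP.
    by exists 1; rewrite scale1r.
  have [r rE] := (sm_cyclP u (i s)).1 ((quo_eq0 _ _).1 gs).
  have nmr : ~ m r.
    by move=> /mu e; apply: s0; apply: (lin_inj0 iI); rewrite rE.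
  have [t mt] := max_ideal_field mm nmr; have [x xs] := pS (t *: s).
  have uE : u = i (p x).
    rewrite xs linearZ /= rE scalerA; apply/eqP; rewrite -subr_eq0.
    by rewrite -{1}[u]scale1r -scalerBl mu.
  exists x; split=> // /pr e; apply: u0.
  by rewrite uE e linear0.
have [/asboolP e|/asboolP j'0] := boolP `[< j' = 0 >].
  by exists 0; rewrite scale0r.
have [x [jE nx]] := soc j j0 mj; have [x' [jE' nx']] := soc j' j'0 mj'.
have key (u : J) (z : R) : u = i (p z) -> (forall y, m y -> y *: u = 0) ->
    forall m' : set R, maximal_ideal m' -> m' <> m -> m' z.
  move=> uE mu m' mm' ne; have [a [ma na]] : exists a, m a /\ ~ m' a.
    case: (mm') (mm) => [Im' nT' max'] [Im nT max].
    apply: contrapT => h; case: (max m' Im') => [a ma|e|e //]; last exact: ne.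
    by apply: contrapT => nma; apply: h; exists a.
  apply: (max_ideal_prime mm' _ na).
  suff : rad (a * z) by apply.
  apply/pr/(lin_inj0 iI); rewrite -[a * z]/(a *: (z : R^o)).
  by rewrite linearZ /= linearZ /= -uE mu.
have nmx : ~ m x.
  move=> mx; apply: nx => m' mm'.
  by have [->//|ne] := pselect (m' = m); exact: key jE mj m' mm' ne.
have [r mr] := max_ideal_field mm nmx; exists (x' * r).
rewrite jE jE' -linearZ -linearZ; apply/eqP; rewrite -subr_eq0 -linearB -linearB.
suff -> : p (x' - (x' * r) *: (x : R^o)) = 0 by rewrite linear0.
apply/pr => m' mm'; have [->|ne] := pselect (m' = m).
  rewrite -[_ *: _]/(x' * r * x) -mulrA -{1}[x']mulr1 -mulrBr.
  by case: mm => [[_ _ mM] _ _]; exact: mM.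
have mx := key _ _ jE mj m' mm' ne; have mx' := key _ _ jE' mj' m' mm' ne.
case: mm' => [[_ mD mM] _ _]; apply: mD => //.
rewrite -[_ *: _]/(x' * r * x) -mulNr; exact: mM.
Qed.

Definition Dmod (V : lmodType R) : lmodType R := chom (id_central R) V J.

(** The inequality suffices: applied twice, it turns the injective evaluation map of [biduality]
    into a bijection. *)
Lemma len_dual (V : lmodType R) : fin_len V ->
  fin_len (Dmod V) /\ (len (Dmod V) <= len V)%N.
Proof.
move: {2}(len V) (leqnn (len V)) => n; elim: n V => [|n IH] V le fV.
  have Z : is_zero V by apply: len_eq0 => //; apply/eqP; rewrite -leqn0.
  have DZ : is_zero (Dmod V).
    by move=> f; apply: chomP => x; rewrite (Z x); exact: (linear0 (f : {linear V -> J})).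
  by have [h1 h2] := len_zero DZ; rewrite h2.
have [Z|nZ] := pselect (is_zero V).
  by apply: IH => //; have [_ ->] := len_zero Z.
have [|W [nW Wmax]] := @ex_max_submod _ V (fun W => ~ forall x, W x) fV.
  by exists sm_zero => h; apply: nZ.
have [fW _] := fin_len_sub W fV; have ltW := len_strict_full fV nW.
have [|fDW leDW] := IH (sub_mod W) _ fW.
  by rewrite -ltnS; exact: leq_trans ltW _.
pose g := chom_pre (id_central R) J (incl W).
have [v0 nv0] : exists v, ~ W v by apply/existsNP.
pose m : set R := fun r => W (r *: v0).
have Im : is_ideal m.
  split; first by rewrite /m scale0r; exact: sm0.
    by move=> x y; rewrite /m scalerDl; exact: smD.
  by move=> a x; rewrite /m -scalerA; exact: smZ.
have Wfull (u v : V) : ~ W u -> exists r, W (v - r *: u).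
  move=> nu; pose W' := sm_add W (sm_cycl u).
  have [full|nf] := pselect (forall x, W' x).
    have [w [t [Ww /sm_cyclP[r ->] ->]]] := full v.
    by exists r; rewrite addrK.
  have e : W' = W.
    apply: Wmax => // x Wx; exists x, 0; split=> //; [exact: sm0|by rewrite addr0].
  case: nu; rewrite -e; exists 0, u; split; [exact: sm0| |by rewrite add0r].
  by apply/sm_cyclP; exists 1; rewrite scale1r.
have mm : maximal_ideal m.
  split=> //.
    by move=> e; apply: nv0; rewrite -[v0]scale1r -/(m 1) e.
  move=> I [_ ID IM] mI; have [e|ne] := pselect (I `<=` m).
    by left; apply/seteqP; split.
  have [r [Ir nmr]] : exists r, I r /\ ~ m r.
    by apply: contrapT => h; apply: ne => r Ir; apply: contrapT => nr; apply: h; exists r.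
  right; apply/seteqP; split=> // x _.
  have [s Ws] := Wfull (r *: v0) v0 nmr.
  have : m (1 - s * r) by rewrite /m scalerBl scale1r -scalerA.
  move=> /mI I1; rewrite -[x]mulr1 -(subrK (s * r) 1); apply: (IM).
  by apply: ID => //; exact: IM.
(* This kernel is D(V / W) with V / W simple: a map vanishing on [W] is determined by its value at
   [v0], which is killed by [m], so [socle_killed] applies. *)
have [fk lek] : fin_len (sub_mod (sm_ker g)) /\ (len (sub_mod (sm_ker g)) <= 1)%N.
  apply: len_le1 => f f' f0.
  have fW0 (h : sub_mod (sm_ker g)) w : W w -> (val h : chom _ _ _) w = 0.
    move=> Ww; have := sub_modP h => /= e.
    by have := congr1 (fun k : chom (id_central R) (sub_mod W) J => k (to_sub Ww)) e.
  have fE (h : sub_mod (sm_ker g)) v r : W (v - r *: v0) ->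
      (val h : chom _ _ _) v = r *: (val h : chom _ _ _) v0.
    move=> /(fW0 h); rewrite (linearB (val h : {linear V -> J})) linearZ => /eqP.
    by rewrite subr_eq0 => /eqP.
  have kill (h : sub_mod (sm_ker g)) y : m y -> y *: (val h : chom _ _ _) v0 = 0.
    by move=> my; have := fW0 h _ my; rewrite linearZ.
  have [|a aE] := socle_killed mm _ (kill f) (kill f').
    move=> e; apply: f0; apply: val_inj; rewrite linear0; apply: chomP => v.
    by have [r /(fE f) ->] := Wfull v0 v nv0; rewrite e scaler0.
  exists a; apply: val_inj; rewrite linearZ; apply: chomP => v.
  have [r Wr] := Wfull v0 v nv0.
  by rewrite chomZE (fE f' _ _ Wr) (fE f _ _ Wr) aE !scalerA mulrC.
have [fi lei] := fin_len_sub (sm_im g sm_full) fDW.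
have [fD ->] := len_exact (ker_im_exact g) fk fi; split=> //.
apply: leq_trans ltW; rewrite -add1n; apply: leq_add => //.
exact: leq_trans lei leDW.
Qed.

(** Evaluation V -> DDV is injective because J is a cogenerator, and DDV is no longer than V. *)
Lemma biduality (V : lmodType R) (Phi : {linear Dmod V -> J}) : fin_len V ->
  exists v : V, forall f : Dmod V, Phi f = (f : chom _ _ _) v.
Proof.
move=> fV; have [fD leD] := len_dual fV; have [fDD leDD] := len_dual fD.
have evL (v : V) : linear (fun f : Dmod V => (f : chom _ _ _) v) by [].
have evL' : linear (fun v => to_chom (id_central R) (lin_of (evL v)) : Dmod (Dmod V)).
  by move=> a x y; apply: chomP => f; exact: (linearP (f : {linear V -> J})).
have evI : injective (lin_of evL').
  apply: lin_injP => v e; apply: contrapT => v0; have [f] := cogenerator v0; apply.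
  exact: (congr1 (fun k : chom (id_central R) (Dmod V) J => k (f : Dmod V)) e).
have [v vE] := len_inj_surj evI fDD (leq_trans leDD leD) (Phi : Dmod (Dmod V)).
exists v => f.
exact: (esym (congr1 (fun k : chom (id_central R) (Dmod V) J => k f) vE)).
Qed.
End Dualizing.

(** * Vanishing of extensions *)

Section FiniteGeneration.
Variables (K : pzRingType) (M : lmodType K).

Fixpoint span (s : seq M) : submod M :=
  if s is x :: s' then sm_add (sm_cycl x) (span s') else sm_zero.

Lemma span_sum s x : span s x ->
  exists c : 'I_(size s) -> K, x = \sum_(i < size s) c i *: s`_i.
Proof.
elim: s x => [|y s IH] x /=.
  by move=> ->; exists (fun _ => 0); rewrite big_ord0.
move=> [_ [w [/sm_cyclP[a ->] /IH[c ->] ->]]].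
exists (fun i => if unlift ord0 i is Some j then c j else a).
rewrite big_ord_recl unlift_none; congr (_ + _).
by apply: eq_bigr => j _; rewrite liftK.
Qed.

Lemma fin_len_fingen : fin_len M -> fingen M.
Proof.
move=> fM.
have [||s [_ smax]] :=
    @ex_maximal (seq M) (fun _ => True) (fun s => len (sub_mod (span s))) (len M).
- by exists [::].
- by move=> s _; case: (fin_len_sub (span s) fM).
exists s => x; apply: span_sum; apply: contrapT => nx.
have := smax (x :: s) I; rewrite leqNgt => /negP; apply; apply: len_strict => //.
split; first by move=> y sy; exists 0, y; split=> //; [exact: sm0|rewrite add0r].
exists x; split=> //; exists x, 0; split; [|exact: sm0|by rewrite addr0].
by apply/sm_cyclP; exists 1; rewrite scale1r.
Qed.

Lemma ffun_basis n (c : {ffun 'I_n -> K^o}) :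
  c = \sum_(i < n) (c i : K) *: ([ffun j => (j == i)%:R] : {ffun 'I_n -> K^o}).
Proof.
apply/ffunP => j; rewrite sum_ffunE (bigD1 j) //= big1 ?addr0.
  by rewrite !ffunE eqxx [RHS]mulr1.
by move=> i ij; rewrite !ffunE eq_sym (negPf ij) [LHS]mulr0.
Qed.

Lemma dual_basis : fingen M -> projective M ->
  exists n (p : 'I_n -> M) (phi : 'I_n -> {linear M -> K^o}),
    forall x, x = \sum_(i < n) (phi i x : K) *: p i.
Proof.
move=> /fingen_surj[n [f fS]] /(_ _ _ f (idfun : {linear M -> M}) fS)[h hE].
have phiL i : linear (fun x => h x i : K^o).
  by move=> a x y; rewrite linearP !ffunE.
exists n, (fun i => f [ffun j => (j == i)%:R]), (fun i => lin_of (phiL i)) => x.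
rewrite -[LHS](hE x) [h x in LHS]ffun_basis linear_sum.
by apply: eq_bigr => i _; rewrite linearZ.
Qed.
End FiniteGeneration.

Section AlgebraModules.
Variables (R : comPzRingType) (A : pzAlg R).
Implicit Types X Y N : lmodType A^c.

Definition alg_central : central_map R A^c.
Proof.
apply: (@CentralMap R A^c (fun r => alg_in A r)) => [a b|a b||r x].
- exact: (rmorphD (alg_in A) a b).
- by rewrite [a * b]mulrC; exact: (rmorphM (alg_in A) b a).
- exact: (rmorph1 (alg_in A)).
- exact/esym/(alg_in_central r x).
Defined.

Lemma restr_scaleE X (r : R) (x : restr X) :
  r *: x = ((alg_in A r : A^c) *: (x : X) : X).
Proof. by []. Qed.

Fact restr_linear X Y (f : {linear X -> Y}) : linear (f : restr X -> restr Y).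
Proof. by move=> r x y; exact: linearP. Qed.
Definition restr_lin X Y (f : {linear X -> Y}) : {linear restr X -> restr Y} :=
  lin_of (restr_linear f).

Definition restr_sub X (W : submod X) : submod (restr X).
Proof. by exists (sm_set W : restr X -> Prop); [exact: sm0|move=> r x y; exact: smL]. Defined.

Lemma fin_len_restr X : fin_len (restr X) -> fin_len X.
Proof.
move=> [b hb]; exists b => n [W cW]; apply: hb; exists (restr_sub W).
elim: cW => [V|m V V' _ IH VV']; first exact: chain_nil.
exact: chain_step IH _.
Qed.

Lemma fin_len_alg X : fin_len (restr (A^c)^o) -> fingen X -> fin_len (restr X).
Proof.
move=> fA /fingen_surj[n [f fS]].
have fL : linear (fun c : {ffun 'I_n -> restr (A^c)^o} =>
    f ([ffun i => c i] : {ffun 'I_n -> (A^c)^o}) : restr X).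
  move=> r x y; rewrite restr_scaleE -linearP; congr (f _).
  by apply/ffunP => i; rewrite !ffunE.
apply: (proj1 (@fin_len_surj _ _ _ (lin_of fL) _ (fin_len_ffun n fA))).
move=> x; have [c cx] := fS x; exists [ffun i => c i] => /=.
by rewrite -cx; congr (f _); apply/ffunP => i; rewrite !ffunE.
Qed.

Lemma fin_len_chom X Y : fingen X -> fin_len (restr Y) ->
  fin_len (chom alg_central X Y).
Proof.
move=> [s sP] fY.
have gL : linear (fun f : chom alg_central X Y =>
    [ffun i : 'I_(size s) => (f s`_i : restr Y)]).
  by move=> r f g; apply/ffunP => i; rewrite !ffunE.
apply: (proj1 (@fin_len_inj _ _ _ (lin_of gL) _ (fin_len_ffun (size s) fY))).
move=> f g /ffunP e; apply: chomP => x; have [c ->] := sP x.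
rewrite !linear_sum; apply: eq_bigr => i _.
by rewrite !linearZ; congr (_ *: _); have := e i; rewrite !ffunE.
Qed.
End AlgebraModules.

Section ExtVanishing.
Variables (R : comPzRingType) (A : pzAlg R) (J : lmodType R).
Implicit Types (X N V : lmodType A^c) (P : lmodType A).
Hypothesis fR : fin_len (R^o : lmodType R).
Hypothesis dJ : dualizing_module J.

(* Maps [X (x)_A P -> J] over R. *)
Definition balanced X P (b : X -> P -> J) : Prop :=
  [/\ forall x y p, b (x + y) p = b x p + b y p,
      forall x p q, b x (p + q) = b x p + b x q,
      forall (a : A) x p, b ((a : A^c) *: x) p = b x (a *: p) &
      forall r x p, b x (alg_in A r *: p) = r *: b x p].

Section BalancedTheory.
Variables (X : lmodType A^c) (P : lmodType A) (b : X -> P -> J).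
Hypothesis bb : balanced b.
Lemma bal0 x : b x 0 = 0.
Proof. by case: bb => _ bD _ _; apply: (addIr (b x 0)); rewrite -bD !add0r. Qed.
Lemma bal_sum x I (r : seq I) (F : I -> P) :
  b x (\sum_(i <- r) F i) = \sum_(i <- r) b x (F i).
Proof. by case: bb => _ bD _ _; apply: (big_morph (b x)) => //; exact: bal0. Qed.
Lemma bal_scale r x p : b ((alg_in A r : A^c) *: x) p = r *: b x p.
Proof. by case: bb => _ _ -> ->. Qed.
End BalancedTheory.

(** This is Hom_R(- (x) P, J) turning an injection into a surjection. A dual basis of [P] reduces
    the form to the finitely many R-linear functionals x |-> b x (p k), each of which extends since
    J is injective. *)
Lemma balanced_ext X X' (i : {linear X' -> X}) P (b : X' -> P -> J) :
  injective i -> fingen P -> projective P -> balanced b ->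
  exists b' : X -> P -> J, balanced b' /\ forall x p, b' (i x) p = b x p.
Proof.
move=> iI fP pP bb; have [n [p [phi pE]]] := dual_basis fP pP.
have [bDl bDr bA bR] := bb.
have eL k : linear (fun x : restr X' => b x (p k)).
  by move=> r x y; rewrite bDl restr_scaleE (bal_scale bb).
have /choice[e eE] k : exists e : {linear restr X -> J},
    forall x : X', e (i x : restr X) = b x (p k).
  have [h hE] := J_inj dJ (i := restr_lin i) (lin_of (eL k)) iI.
  by exists h.
exists (fun x q => \sum_(k < n) e k ((phi k q : A^c) *: x : restr X)).
split; last first.
  move=> x q; rewrite [in RHS](pE q) (bal_sum bb); apply: eq_bigr => k _.
  by rewrite -bA -eE linearZ.
split=> [x y q|x q q'|a x q|r x q].
- by rewrite -big_split; apply: eq_bigr => k _; rewrite scalerDr; exact: linearD.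
- rewrite -big_split; apply: eq_bigr => k _.
  rewrite linearD -[RHS]linearD; congr (e k _).
  exact: (scalerDl (x : X) (phi k q : A^c) (phi k q' : A^c)).
- by apply: eq_bigr => k _; congr (e k _); rewrite scalerA linearZ.
- rewrite scaler_sumr; apply: eq_bigr => k _; rewrite -[RHS]linearZ; congr (e k _).
  rewrite restr_scaleE scalerA linearZ.
  exact: (congr1 (fun a : A^c => a *: (x : X)) (alg_in_central r (phi k q : A))).
Qed.

Section Presentation.
Variables (P1 P0 : lmodType A) (d : {linear P1 -> P0}).
Variables (T : lmodType A^c) (t : {linear star P1 -> T}).
Hypotheses (fP1 : fingen P1) (pP1 : projective P1).
Hypothesis tS : surj t.
Hypothesis tker : forall g : star P1,
  t g = 0 <-> exists f : star P0, forall x, g x = f (d x).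

Fact star_pre_linear : linear (fun f : star P0 => ((f : {linear P0 -> A^o}) \o d : star P1)).
Proof. by move=> a f g; apply: HomP. Qed.
Let dstar : {linear star P0 -> star P1} := lin_of star_pre_linear.

(* Homs from [T] vanish on [N] exactly when [N (x) P1 -> N (x) P0] is injective,
   by [N (x) P = Hom (star P) N]. *)
Lemma balanced_lift N (b : N -> P1 -> J) :
  (forall (f : {linear T -> N}) x, f x = 0) -> balanced b ->
  exists b' : N -> P0 -> J, balanced b' /\ forall x p, b' x (d p) = b x p.
Proof.
move=> T0 bb; have [n [p [phi pE]]] := dual_basis fP1 pP1.
have [bDl bDr bA bR] := bb.
pose c := alg_central A.
pose D : {linear chom c (star P1) N -> chom c (star P0) N} := chom_pre c N dstar.
have DI : injective D.
  apply: lin_injP => g g0; apply: chomP => h.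
  have [|g' g'E] := lin_factor (f := g : {linear _ -> _}) tS.
    move=> u /tker[f fE]; have -> : u = dstar f by apply: HomP.
    exact: (congr1 (fun k : chom c (star P0) N => k f) g0).
  by rewrite -g'E T0.
(* Under N (x) P1 = Hom(star P1, N), written in a dual basis of [P1], the form [b] is this
   functional. As [D] is injective, it extends along [D] to Hom(star P0, N). *)
have bL : linear (fun g : chom c (star P1) N => \sum_(k < n) b (g (phi k)) (p k)).
  move=> r g h; rewrite scaler_sumr -big_split; apply: eq_bigr => k _ /=.
  by rewrite -(bal_scale bb) -bDl.
have [G GE] := J_inj dJ (i := D) (lin_of bL) DI.
(* The image of the pure tensor x (x) q in Hom(star P, N). *)
have evL P x (q : P) : linear (fun f : star P => (f q : A^c) *: x : N).
  by move=> a f g; rewrite scalerA -scalerDl.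
pose ev P x (q : P) : chom c (star P) N := to_chom c (lin_of (evL P x q)).
exists (fun x q => G (ev P0 x q)); split; last first.
  move=> x q; have -> : ev P0 x (d q) = D (ev P1 x q) by apply: chomP.
  rewrite GE /= [in RHS](pE q) (bal_sum bb); apply: eq_bigr => k _.
  exact: bA.
split=> [x y q|x q q'|a x q|r x q].
- by rewrite -linearD; congr (G _); apply: chomP => f; exact: scalerDr.
- rewrite -linearD; congr (G _); apply: chomP => f.
  rewrite chomDE /ev !to_chomE /= -scalerDl; congr (_ *: _); exact: linearD.
- congr (G _); apply: chomP => f; rewrite /ev !to_chomE /= scalerA.
  exact: (esym (congr1 (fun u : A^c => u *: x) (linearZ_LR (f : {linear P0 -> A^o}) a q))).
- rewrite -linearZ; congr (G _); apply: chomP => f.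
  rewrite chomZE /ev !to_chomE /= scalerA linearZ.
  exact: (congr1 (fun a : A^c => a *: x) (alg_in_central r (hom_fun f q : A))).
Qed.
End Presentation.

(** By biduality a map X -> V amounts to a balanced form on X and P0 that vanishes on the image of
    P1. The form [b0] of [f] extends to a form [b1] on X. Along d, [b1] depends only on classes in
    N, giving a form [b2] on N and P1, and the vanishing of Hom(T, N) lifts it to [b3] on N and P0.
    Subtracting [b3] from [b1] kills the image of P1 and changes nothing on X'. *)
Lemma tauinv_ext V T X' X N (i : {linear X' -> X}) (g : {linear X -> N})
    (f : {linear X' -> V}) :
  fin_len (restr V) -> is_transpose (dual J V) T ->
  (forall (h : {linear T -> N}) x, h x = 0) ->
  short_exact i g -> exists F : {linear X -> V}, forall x, F (i x) = f x.
Proof.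
move=> fV [P1 [P0 [d [q [[cov0 cov1] [t [tS tker]]]]]]] TN ig.
have [iI gS _] := ig; have gk := short_exact_ker ig.
have [fP0 pP0 qS _] := cov0; have [fP1 pP1 dq _] := cov1.
have qd p : q (d p) = 0 by have : range d (d p) by [exists p]; rewrite dq.
have qex m : exists p, q p = m by have : [set: dual J V] m by []; rewrite -qS => -[p _]; exists p.
pose b0 (x : X') (p : P0) : J := (q p : Hom (restr V) J) (f x : restr V).
have bb0 : balanced b0.
  split=> [x y p|x p p'|a x p|r x p].
  - by rewrite /b0 linearD; exact: linearD.
  - by rewrite /b0 linearD.
  - by rewrite /b0 !linearZ.
  - rewrite /b0 linearZ; exact: (linearZ_LR (q p : {linear restr V -> J})).
have [b1 [bb1 b1E]] := balanced_ext iI fP0 pP0 bb0.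
have [s sE] := choice gS.
have [b1Dl b1Dr b1A b1R] := bb1.
have b1d x x' p : g x = g x' -> b1 x (d p) = b1 x' (d p).
  move=> e; have [y yE] : exists y, i y = x - x' by apply/gk; rewrite linearB e subrr.
  rewrite -(subrK x' x) b1Dl -yE b1E /b0 qd.
  by rewrite -[RHS]add0r; congr (_ + _).
pose b2 (z : N) (p : P1) := b1 (s z) (d p).
have bb2 : balanced b2.
  split=> [x y p|x p p'|a x p|r x p].
  - by rewrite /b2 -b1Dl; apply: b1d; rewrite linearD !sE.
  - by rewrite /b2 linearD b1Dr.
  - by rewrite /b2 linearZ /= -b1A; apply: b1d; rewrite linearZ /= !sE.
  - by rewrite /b2 linearZ b1R.
have [b3 [bb3 b3E]] := balanced_lift fP1 pP1 tS tker TN bb2.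
have [b3Dl b3Dr b3A b3R] := bb3.
pose b x p := b1 x p - b3 (g x) p.
have bb : balanced b.
  split=> [x y p|x p p'|a x p|r x p]; rewrite /b.
  - by rewrite linearD b1Dl b3Dl opprD addrACA.
  - by rewrite b1Dr b3Dr opprD addrACA.
  - by rewrite linearZ b1A b3A.
  - by rewrite b1R b3R scalerBr.
have [bDl bDr bA bR] := bb.
have bd x p : b x (d p) = 0.
  by rewrite /b b3E (b1d x (s (g x))) ?sE ?subrr.
have bi x p : b (i x) p = b0 x p.
  rewrite /b b1E; have -> : g (i x) = 0 by apply/gk; exists x.
  by rewrite -[X in b3 X](scale0r (0 : N)) b3A scale0r (bal0 bb3) subr0.
have [r rE] := choice qex.
have brq x p : b x (r (q p)) = b x p.
  have [u _ du] : range d (r (q p) - p) by rewrite dq /ker /= linearB rE subrr.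
  by rewrite -(subrK p (r (q p))) bDr -du bd add0r.
have PhiL x : linear (fun m : Dmod J (restr V) => b x (r (m : dual J V))).
  move=> a m m'; rewrite -(bR a) -bDr -[RHS]brq linearD linearZ !rE.
  congr (b x (r (_ + _))); apply: HomP => u.
  exact: (esym (linearZ_LR (m : {linear restr V -> J}) a u)).
(* For fixed x the form [b] descends to a functional on D V, and [F x] is the element of V at which
   this functional evaluates. *)
have [F FE] := choice (fun x => biduality fR dJ (lin_of (PhiL x)) fV).
have bF x p : b x p = (q p : Hom (restr V) J) (F x).
  by rewrite -brq; exact: FE x (q p).
have Funiq (v v' : restr V) :
    (forall p, (q p : Hom (restr V) J) v = (q p : Hom (restr V) J) v') -> v = v'.
  move=> e; apply/eqP; rewrite -subr_eq0; apply/eqP; apply: contrapT => h.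
  have [m] := cogenerator fR dJ h; apply.
  have [p pm] := qex m; move: (e p); rewrite pm => mvv.
  by rewrite linearB; apply/eqP; rewrite subr_eq0; apply/eqP; exact: mvv.
have FL : linear (F : X -> V).
  move=> a x y; apply: Funiq => p; rewrite -bF bDl bA !bF linearZ.
  exact/esym/linearD.
by exists (lin_of FL) => x; apply: Funiq => p; rewrite -bF bi.
Qed.
End ExtVanishing.

(** * Indecomposable and simple modules *)

Section Indecomposables.
Variable K : pzRingType.
Implicit Types M N P Q S Y : lmodType K.

Lemma iso_prodC M N : iso (M * N)%type (N * M)%type.
Proof.
have hL : linear (fun p : M * N => (p.2, p.1)) by [].
by exists (lin_of hL); exists (fun p => (p.2, p.1)) => [[x y]|[x y]].
Qed.

Lemma direct_summand_isor M N N' : iso N N' -> direct_summand M N -> direct_summand M N'.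
Proof. by move=> /iso_sym i [D iD]; exists D; exact: iso_trans i iD. Qed.

Lemma direct_summandP N M : direct_summand N M <->
  exists (a : {linear N -> M}) (e : {linear M -> N}), cancel a e.
Proof.
split=> [[C [f /lin_inv[g [fg gf]]]]|[a [e ae]]].
  have aL : linear (fun x : N => g (x, 0 : C)).
    move=> r x y; rewrite -linearP; congr (g _); congr pair.
    by rewrite /= scaler0 addr0.
  have eL : linear (fun y => (f y).1) by move=> r x y; rewrite linearP.
  by exists (lin_of aL), (lin_of eL) => x /=; rewrite gf.
exists (sub_mod (sm_ker e)).
have H (y : M) : sm_ker e (y - a (e y)) by rewrite /= linearB ae subrr.
have fL : linear (fun y => (e y, to_sub (H y))).
  move=> r x y; congr pair; first exact: linearP.
  apply: val_inj; rewrite [RHS]linearP /= [e _]linearP [a _]linearP scalerBr.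
  by rewrite opprD addrACA.
exists (lin_of fL); exists (fun p => a p.1 + val p.2) => [y|[x k]] /=.
  by rewrite addrC subrK.
have ek : e (val k) = 0 by exact: sub_modP k.
congr pair; first by rewrite linearD ae ek addr0.
by apply: val_inj => /=; rewrite linearD ae ek addr0 addrC addKr.
Qed.

Lemma direct_summand_trans N M P :
  direct_summand N M -> direct_summand M P -> direct_summand N P.
Proof.
move=> /direct_summandP[a [e ae]] /direct_summandP[b [f bf]].
by apply/direct_summandP; exists (b \o a), (e \o f); exact: can_comp.
Qed.

Lemma fin_len_summand N M : direct_summand N M -> fin_len M -> fin_len N.
Proof.
by move=> /direct_summandP[a [e /can_inj aI]] fM; case: (fin_len_inj aI fM).
Qed.

Fixpoint lin_iter M (f : {linear M -> M}) n : {linear M -> M} :=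
  if n is m.+1 then f \o lin_iter f m else idfun.

Lemma lin_iterD M (f : {linear M -> M}) m n x :
  lin_iter f (m + n) x = lin_iter f m (lin_iter f n x).
Proof. by elim: m => //= m ->. Qed.

(** At an exponent where the kernels of the iterates stop growing, kernel and image of the iterate
    meet in 0 and their lengths add up to that of M, so M is their direct sum. *)
Lemma fitting M (f : {linear M -> M}) : fin_len M -> indecomposable M ->
  bijective f \/ exists n, forall x, lin_iter f n x = 0.
Proof.
move=> fM [nz indec].
have [||n [_ nmax]] := @ex_maximal nat (fun _ => True)
  (fun n => len (sub_mod (sm_ker (lin_iter f n)))) (len M).
- by exists 0%N.
- by move=> n _; case: (fin_len_sub (sm_ker (lin_iter f n)) fM).
have stab m x : lin_iter f (m + n) x = 0 -> lin_iter f n x = 0.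
  move=> fx; apply: contrapT => nfx.
  have := nmax (m + n)%N I; rewrite leqNgt => /negP; apply; apply: len_strict => //.
  split; first by move=> y /= fy; rewrite lin_iterD fy linear0.
  by exists x.
pose g := lin_iter f n.
have sL : linear (fun p : sub_mod (sm_ker g) * im_mod g => val p.1 + val p.2).
  by move=> a p q; rewrite /= scalerDr addrACA.
have sI : injective (lin_of sL).
  apply: lin_injP => -[k i] /= ki0.
  have gk : g (val k) = 0 by exact: sub_modP k.
  have [z _ gz] := sub_modP i.
  have i0 : val i = 0.
    rewrite -gz; apply: (stab n); rewrite lin_iterD -/g gz.
    by have := congr1 g ki0; rewrite linearD gk add0r linear0.
  have k0 : val k = 0 by move: ki0; rewrite i0 addr0.
  by congr pair; apply: val_inj; rewrite linear0.
have fk := (fin_len_sub (sm_ker g) fM).1.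
have fi := (fin_len_sub (sm_im g sm_full) fM).1.
have [fp lp] := len_prod fk fi.
have sS : surj (lin_of sL).
  by apply: (len_inj_surj sI fM); rewrite lp -(len_exactE (ker_im_exact g) fM).
have [k0|i0] := indec _ _ (iso_sym (ex_intro _ _ ((bij_inj_surj _).2 (conj sI sS)))).
  left; apply: (len_inj_bij fM); apply: lin_injP => x fx.
  have gx : sm_ker g x.
    by apply: (stab 1%N); rewrite addnC lin_iterD /= fx linear0.
  by have := congr1 val (k0 (to_sub gx)); rewrite val_to_sub linear0.
right; exists n => x; have := congr1 val (i0 (to_im g x)).
by rewrite val_to_im linear0.
Qed.

Lemma local_end M (f g : {linear M -> M}) : fin_len M -> indecomposable M ->
  (forall x, f x + g x = x) -> bijective f \/ bijective g.
Proof.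
move=> fM iM fg; have [fb|[n fn]] := fitting f fM iM; first by left.
right; apply: (len_inj_bij fM); apply: lin_injP => x gx.
have fx : f x = x by rewrite -[RHS]fg gx addr0.
rewrite -(fn x); elim: n {fn} => //= n <-; exact/esym.
Qed.

(** [h] is any automorphism, and not just the identity, so that the induction can continue with the
    sum of the remaining terms. *)
Lemma local_sum M I (r : seq I) (F : I -> {linear M -> M}) (h : {linear M -> M}) :
  fin_len M -> indecomposable M -> bijective h ->
  (forall x, h x = \sum_(i <- r) F i x) -> exists i, bijective (F i).
Proof.
move=> fM iM; elim: r h => [|i r IH] h hb hE.
  case: iM => nz _; case: nz => x; apply: (lin_inj0 ((bij_inj_surj h).1 hb).1).
  by rewrite hE big_nil.
have [k [hk kh]] := lin_inv hb.
have gL : linear (fun x => \sum_(i <- r) F i x).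
  move=> a x y; rewrite scaler_sumr -big_split; apply: eq_bigr => j _.
  exact: linearP.
have [|b|b] := @local_end M (k \o F i) (k \o lin_of gL) fM iM.
- by move=> x /=; rewrite -linearD -[RHS]hk hE big_cons.
- exists i; apply: (eq_bij (bij_comp hb b)) => x /=; exact: kh.
- apply: (IH (lin_of gL)) => //.
  apply: (eq_bij (bij_comp hb b)) => x /=; exact: kh.
Qed.

Lemma retract_iso M N (a : {linear M -> N}) (b : {linear N -> M}) :
  ~ is_zero M -> indecomposable N -> bijective (b \o a) -> iso M N.
Proof.
move=> nz [_ iN] ba; have [k [hk kh]] := @lin_inv _ _ _ (b \o a) ba.
pose e : {linear N -> M} := k \o b.
have ae : cancel a e by move=> x; exact: hk.
have ds : direct_summand M N by apply/direct_summandP; exists a, e.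
have [C iC] := ds; have [//|C0] := iN _ _ iC.
apply: iso_trans (iso_sym iC).
have fL : linear (fun x : M => (x, 0 : C)).
  by move=> r x y; congr pair; rewrite /= scaler0 addr0.
exists (lin_of fL); exists fst => // -[x y]; congr pair.
by rewrite (C0 y).
Qed.

Definition simple_mod S := ~ is_zero S /\
  forall W : submod S, (forall x, W x) \/ (forall x, W x -> x = 0).

Lemma simple_surj S Y (f : {linear Y -> S}) y : simple_mod S -> f y <> 0 -> surj f.
Proof.
move=> [_ sS] fy x; have [/(_ x)[z _ <-]|h] := sS (sm_im f sm_full); first by exists z.
by case: fy; apply: h; exists y.
Qed.

Lemma simple_inj S Y (f : {linear S -> Y}) x : simple_mod S -> f x <> 0 -> injective f.
Proof.
move=> [_ sS] fx; apply: lin_injP => y fy.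
by have [/(_ x)//|] := sS (sm_ker f); apply.
Qed.

(** Stands in for a decomposition of Y into indecomposables. A shortest summand with a nonzero map
    to S cannot split into two nonzero parts, because the map would stay nonzero on one of them. *)
Lemma ex_indec_summand Y S (f : {linear Y -> S}) y : fin_len Y -> f y <> 0 ->
  exists P, [/\ indecomposable P, direct_summand P Y &
    exists (g : {linear P -> S}) x, g x <> 0].
Proof.
move=> fY fy.
have [|P [[dP [g [x gx]]] Pmin]] := @ex_minimal (lmodType K)
    (fun P => direct_summand P Y /\ exists (g : {linear P -> S}) x, g x <> 0) (fun P => len P).
  exists Y; split; last by exists f, y.
  by apply/direct_summandP; exists idfun, idfun.
exists P; split=> //; last by exists g, x.
split; first by move=> z; apply: gx; rewrite (z x) linear0.
have key (N C : lmodType K) (i : iso P (N * C)%type) : ~ is_zero C ->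
    forall h : {linear N -> S}, forall u, h u = 0.
  move=> nz h u; apply: contrapT => hu.
  have dN : direct_summand N P by exists C.
  have := Pmin N (conj (direct_summand_trans dN dP) (ex_intro _ h (ex_intro _ u hu))).
  have fP := fin_len_summand dP fY.
  have fN := fin_len_summand dN fP.
  have fC : fin_len C.
    by apply: (fin_len_summand _ fP); exists N; exact: iso_trans i (iso_prodC _ _).
  have [_ <-] := len_iso i fP; have [_ ->] := len_prod fN fC.
  rewrite leqNgt -addn1 leq_add2l => /negP; apply; rewrite lt0n.
  by apply/eqP => /(len_eq0 fC).
move=> N C i.
have [Nz|Nnz] := pselect (is_zero N); first by left.
have [Cz|Cnz] := pselect (is_zero C); first by right.
case: (i) => phi /lin_inv[psi [pp qq]].
have aL : linear (fun u : N => g (psi (u, 0))).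
  move=> r u v; rewrite -!linearP; congr (g (psi _)); congr pair.
  by rewrite /= scaler0 addr0.
have bL : linear (fun v : C => g (psi (0, v))).
  move=> r u v; rewrite -!linearP; congr (g (psi _)); congr pair.
  by rewrite /= scaler0 addr0.
case: gx; rewrite -(pp x); case: (phi x) => u v.
have -> : (u, v) = (u, 0) + (0, v) by congr pair; rewrite /= ?addr0 ?add0r.
have e1 : g (psi (u, 0)) = 0 := key _ _ i Cnz (lin_of aL) u.
rewrite !linearD e1 add0r.
exact: (key _ _ (iso_trans i (iso_prodC _ _)) Nnz (lin_of bL) v).
Qed.

(* The endomorphism ring of [Q] is local. *)
Lemma simple_top_unique Q S S' (p : {linear Q -> S}) (p' : {linear Q -> S'}) x x' :
  fin_len Q -> indecomposable Q -> direct_summand Q K^o ->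
  simple_mod S -> simple_mod S' -> p x <> 0 -> p' x' <> 0 -> iso S S'.
Proof.
move=> fQ iQ /direct_summandP[a [e ae]] sS sS' px px'.
have pS := simple_surj sS px; have pS' := simple_surj sS' px'.
have [sub|nsub] := pselect (forall z, p z = 0 -> p' z = 0).
  have [h hE] := lin_factor pS sub.
  have hx' : h (p x') <> 0 by rewrite hE.
  exists h; apply/bij_inj_surj; split; first exact: simple_inj hx'.
  exact: simple_surj hx'.
have [z [pz p'z]] : exists z, p z = 0 /\ p' z <> 0.
  apply: contrapT => h; apply: nsub => z pz; apply: contrapT => p'z.
  by apply: h; exists z.
(* [r] is chosen so that the endomorphism q |-> a(q) r z of Q becomes the identity after [p']. Its
   values lie in the kernel of [p], and those of the identity minus it lie in the kernel of [p']; so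
   neither is surjective, against locality. *)
have [r rE] : exists r, p' (e 1) = r *: p' z.
  apply/sm_cyclP; have [|h] := sS'.2 (sm_cycl (p' z)); first by apply.
  by case: p'z; apply: h; apply/sm_cyclP; exists 1; rewrite scale1r.
have fL : linear (fun q => (a q : K) *: (r *: z)).
  by move=> s q q'; rewrite linearP scalerDl [in RHS]scalerA.
have gL : linear (fun q => q - (a q : K) *: (r *: z)).
  by move=> s q q'; rewrite (fL s q q') scalerBr opprD addrACA.
have p'f q : p' ((a q : K) *: (r *: z)) = p' q.
  rewrite linearZ /= linearZ /= -rE -linearZ -linearZ -[RHS](congr1 p' (ae q)).
  by congr (p' (e _)); exact: mulr1.
have [|fb|gb] := @local_end Q (lin_of fL) (lin_of gL) fQ iQ.
- by move=> q /=; rewrite addrC subrK.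
- have [q qx] := ((bij_inj_surj _).1 fb).2 x.
  by case: px; rewrite -qx /= linearZ /= linearZ /= pz !scaler0.
- have [q qx] := ((bij_inj_surj _).1 gb).2 x'.
  by case: px'; rewrite -qx /= linearB p'f subrr.
Qed.

Lemma num_simple_le n t (S : 'I_t -> lmodType K) : fin_len (K^o : lmodType K) ->
  num_indec_summands (K^o : lmodType K) n ->
  (forall i, simple_mod (S i)) -> (forall i j, iso (S i) (S j) -> i = j) ->
  (t <= n)%N.
Proof.
move=> fK [Q [iQ _ Qall]] sS Sinj.
have /choice[k kP] i : exists k, exists (g : {linear Q k -> S i}) x, g x <> 0.
  have [s s0] : exists s : S i, s <> 0.
    by apply: contrapT => h; apply: (sS i).1 => s; apply: contrapT => s0; apply: h; exists s.
  have [|P [iP dP [g [x gx]]]] := @ex_indec_summand _ _ (scale_at s) 1 fK.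
    by rewrite /= scale1r.
  have [k /iso_sym[f fb]] := Qall P (conj iP dP).
  have [y fy] := ((bij_inj_surj f).1 fb).2 x.
  by exists k, (g \o f), y; rewrite /= fy.
have kI : injective k.
  move=> i j kij; apply: Sinj; have [g [x gx]] := kP i; have := kP j.
  rewrite -kij => -[h [y hy]]; have [ik dk] := iQ (k i).
  exact: simple_top_unique (fin_len_summand dk fK) ik dk (sS i) (sS j) gx hy.
by have := leq_card k kI; rewrite !card_ord.
Qed.
End Indecomposables.

(** * Change of rings *)

(** Bare data, so that one morphism of algebras can be reused between the converse rings, with the
    factors of each product exchanged. *)
Record quotient_map (B C : pzRingType) := QuotientMap {
  qmap :> B -> C;
  qmapD : forall a b, qmap (a + b) = qmap a + qmap b;
  qmapM : forall a b, qmap (a * b) = qmap a * qmap b;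
  qmap1 : qmap 1 = 1;
  qmap_surj : forall c, exists b, qmap b = c }.

Section ChangeOfRings.
Variables (B C : pzRingType) (pi : quotient_map B C).
Implicit Types (X : lmodType B) (Y : lmodType C).

Definition killed X := forall b (x : X), pi b = 0 -> b *: x = 0.

Section Down.
Variable Y : lmodType C.
(** Restriction of scalars along [pi]. Both [down] and [up] keep the carrier, so the same function
    serves as a linear map on either side. *)
Definition down : Type := let _ := pi in Y.
HB.instance Definition _ := GRing.Zmodule.on down.
Definition down_scale (b : B) (y : down) : down := pi b *: (y : Y).
Fact down_scaleA a b v : down_scale a (down_scale b v) = down_scale (a * b) v.
Proof. by rewrite /down_scale scalerA qmapM. Qed.
Fact down_scale1 : left_id 1 down_scale.
Proof. by move=> v; rewrite /down_scale qmap1; exact: scale1r. Qed.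
Fact down_scaleDr : right_distributive down_scale +%R.
Proof. by move=> a u v; exact: scalerDr. Qed.
Fact down_scaleDl v : {morph down_scale^~ v : a b / a + b}.
Proof. by move=> a b; rewrite /down_scale qmapD; exact: scalerDl. Qed.
HB.instance Definition _ := GRing.Zmodule_isLmodule.Build B down
  down_scaleA down_scale1 down_scaleDr down_scaleDl.
Lemma down_scaleE b (y : down) : b *: y = (pi b *: (y : Y) : Y).
Proof. by []. Qed.
Lemma down_killed : killed down.
Proof. by move=> b x pb; rewrite down_scaleE pb; exact: (scale0r (x : Y)). Qed.
End Down.

Section Up.
Variables (X : lmodType B) (kX : killed X).
(** A module killed by the kernel of [pi], seen over the quotient ring; scalars act through
    arbitrary preimages. *)
Definition up : Type := let _ := kX in X.
HB.instance Definition _ := GRing.Zmodule.on up.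
Let sec (c : C) : B := xget 0 [set b | pi b = c].
Lemma secK c : pi (sec c) = c.
Proof. by apply: (@xgetPex _ 0 [set b | pi b = c]); exact: qmap_surj. Qed.
Definition up_scale (c : C) (x : up) : up := sec c *: (x : X).
Lemma up_key a b (x : X) : pi a = pi b -> a *: x = b *: x.
Proof.
move=> e; apply/eqP; rewrite -subr_eq0 -scalerBl; apply/eqP/kX.
apply: (addIr (pi b)); by rewrite -qmapD subrK add0r.
Qed.
Lemma up_scaleE' b (x : X) : up_scale (pi b) x = b *: x.
Proof. by apply: up_key; exact: secK. Qed.
Fact up_scaleA a b v : up_scale a (up_scale b v) = up_scale (a * b) v.
Proof. by rewrite /up_scale scalerA; apply: up_key; rewrite qmapM !secK. Qed.
Fact up_scale1 : left_id 1 up_scale.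
Proof.
by move=> v; rewrite -(qmap1 pi) up_scaleE' scale1r.
Qed.
Fact up_scaleDr : right_distributive up_scale +%R.
Proof. by move=> a u v; exact: scalerDr. Qed.
Fact up_scaleDl v : {morph up_scale^~ v : a b / a + b}.
Proof.
move=> a b; rewrite /up_scale -[RHS](scalerDl (v : X)); apply: up_key.
by rewrite qmapD !secK.
Qed.
HB.instance Definition _ := GRing.Zmodule_isLmodule.Build C up
  up_scaleA up_scale1 up_scaleDr up_scaleDl.
Lemma up_scaleE b (x : up) : pi b *: x = (b *: (x : X) : X).
Proof. exact: up_scaleE'. Qed.
End Up.

Lemma down_linear Y Y' (f : Y -> Y') :
  (linear f -> linear (f : down Y -> down Y')) *
  (linear (f : down Y -> down Y') -> linear f).
Proof.
split=> fL a x y; first exact: (fL (pi a) x y).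
by have [b <-] := qmap_surj pi a; exact: fL b x y.
Qed.

Lemma up_linear X X' (kX : killed X) (kX' : killed X') (f : X -> X') :
  (linear f -> linear (f : up kX -> up kX')) *
  (linear (f : up kX -> up kX') -> linear f).
Proof.
split=> fL a x y; last by have := fL (pi a) x y; rewrite !up_scaleE.
by have [b <-] := qmap_surj pi a; rewrite !up_scaleE; exact: fL b x y.
Qed.

Lemma updown_linear X (kX : killed X) Y (f : X -> Y) :
  (linear (f : X -> down Y) -> linear (f : up kX -> Y)) *
  (linear (f : up kX -> Y) -> linear (f : X -> down Y)).
Proof.
split=> fL a x y; last by have := fL (pi a) x y; rewrite up_scaleE.
by have [b <-] := qmap_surj pi a; rewrite up_scaleE; exact: fL b x y.
Qed.

Definition down_lin Y Y' (f : {linear Y -> Y'}) : {linear down Y -> down Y'} :=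
  lin_of ((down_linear f).1 (@linearP _ _ _ _ f)).
Definition of_down_lin Y Y' (f : {linear down Y -> down Y'}) : {linear Y -> Y'} :=
  lin_of ((down_linear (f : Y -> Y')).2 (@linearP _ _ _ _ f)).
Definition up_lin X X' (kX : killed X) (kX' : killed X') (f : {linear X -> X'}) :
    {linear up kX -> up kX'} :=
  lin_of ((up_linear kX kX' f).1 (@linearP _ _ _ _ f)).
Definition of_up_lin X X' (kX : killed X) (kX' : killed X')
    (f : {linear up kX -> up kX'}) : {linear X -> X'} :=
  lin_of ((up_linear kX kX' (f : X -> X')).2 (@linearP _ _ _ _ f)).
Definition to_down X (kX : killed X) Y (f : {linear up kX -> Y}) : {linear X -> down Y} :=
  lin_of ((updown_linear kX (f : X -> Y)).2 (@linearP _ _ _ _ f)).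
Definition of_down X (kX : killed X) Y (f : {linear X -> down Y}) : {linear up kX -> Y} :=
  lin_of ((updown_linear kX (f : X -> Y)).1 (@linearP _ _ _ _ f)).

Lemma iso_down Y Y' : iso (down Y) (down Y') <-> iso Y Y'.
Proof.
split=> [[f fb]|[f fb]]; first by exists (of_down_lin f).
by exists (down_lin f).
Qed.

Lemma iso_up X X' (kX : killed X) (kX' : killed X') :
  iso (up kX) (up kX') <-> iso X X'.
Proof.
split=> [[f fb]|[f fb]]; first by exists (of_up_lin f).
by exists (up_lin kX kX' f).
Qed.

Lemma iso_updown X (kX : killed X) Y : iso (up kX) Y <-> iso X (down Y).
Proof.
split=> [[f fb]|[f fb]]; first by exists (to_down f).
by exists (of_down kX f).
Qed.

Lemma killed_inj X X' (f : {linear X -> X'}) : injective f -> killed X' -> killed X.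
Proof. by move=> fI kX b x pb; apply: fI; rewrite linear0 linearZ; exact: kX. Qed.

Lemma killed_surj X X' (f : {linear X -> X'}) : surj f -> killed X -> killed X'.
Proof.
move=> fS kX b x' pb; have [x <-] := fS x'.
by rewrite -linearZ (kX b x pb) linear0.
Qed.

Lemma killed_iso X X' : iso X X' -> killed X -> killed X'.
Proof. by move=> [f /bij_inj_surj[_ fS]]; exact: killed_surj. Qed.

Lemma indecomposable_down Y : indecomposable Y -> indecomposable (down Y).
Proof.
move=> [nz iY]; split=> // N D i.
have [f fb] := i.
have kND := killed_iso i (@down_killed Y).
have kN : killed N by move=> b x pb; exact: (congr1 fst (kND b (x, 0) pb)).
have kD : killed D by move=> b x pb; exact: (congr1 snd (kND b (0, x) pb)).
have gL : linear (f : Y -> (up kN * up kD)%type).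
  move=> a x y; have [b <-] := qmap_surj pi a.
  have := linearP f b x y; rewrite down_scaleE => e.
  apply: (etrans e); congr pair; congr (_ + _); exact/esym/up_scaleE.
by apply: (iY (up kN) (up kD)); exists (lin_of gL).
Qed.

Lemma indecomposable_up X (kX : killed X) : indecomposable X -> indecomposable (up kX).
Proof.
move=> [nz iX]; split=> // N D [f fb].
have gL : linear (f : X -> (down N * down D)%type).
  by move=> b x y; have := linearP f (pi b) x y; rewrite up_scaleE.
by apply: (iX (down N) (down D)); exists (lin_of gL).
Qed.

Lemma num_indec_summands_down X Y n : iso X (down Y) ->
  num_indec_summands Y n -> num_indec_summands X n.
Proof.
move=> iXY [S [iS Sinj Sall]]; exists (fun i => down (S i)); split=> [i|i j|M [iM dM]].
- have [indS /direct_summandP[a [e ae]]] := iS i.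
  split; first exact: indecomposable_down.
  apply: direct_summand_isor (iso_sym iXY) _.
  by apply/direct_summandP; exists (down_lin a), (down_lin e).
- by move=> /iso_down; exact: Sinj.
have /direct_summandP[a [e ae]] := direct_summand_isor iXY dM.
have kM : killed M := killed_inj (can_inj ae) (@down_killed Y).
have [|i /iso_updown] := Sall (up kM); last by exists i.
split; first exact: indecomposable_up.
apply/direct_summandP.
have eL : linear (e : Y -> up kM).
  move=> c x y; have [b <-] := qmap_surj pi c; rewrite up_scaleE; exact: (linearP e b x y).
by exists (of_down kM a), (lin_of eL).
Qed.

Lemma simple_mod_up X (kX : killed X) : simple_mod X -> simple_mod (up kX).
Proof.
move=> [nz sX]; split=> // W.
have W'L : forall a x y, W x -> W y -> W (a *: (x : X) + (y : X) : X).
  by move=> a x y Wx Wy; rewrite -(up_scaleE a (x : up kX)); exact: smL.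
exact: (sX (@Submod B X (sm_set W) (sm0 W) W'L)).
Qed.
End ChangeOfRings.

(** * Support tau^- -tilting modules *)

Section SupportTilting.
Variables (R : comPzRingType) (L : pzAlg R) (U : lmodType L^c).
Hypothesis hL : artin_algebra L.
Hypothesis hU : support_tauinv_tilting U.

Lemma artin_algebra_fin_len :
  fin_len (R^o : lmodType R) /\ fin_len (restr (L^c)^o : lmodType R).
Proof.
have fR := artinian_fin_len hL.1; split=> //.
exact: fingen_fin_len fR hL.2.
Qed.

Definition ext_injective (K : pzRingType) (E : lmodType K -> Prop) (I : lmodType K) :=
  forall (X' X N : lmodType K) (i : {linear X' -> X}) (g : {linear X -> N})
    (f : {linear X' -> I}), E X -> E N -> short_exact i g ->
    exists F : {linear X -> I}, forall x, F (i x) = f x.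

(** Everything the counting argument takes from tilting theory. [I] is the kernel of the map to the
    quotient algebra; modules killed by it are modules over that quotient, which has as many
    indecomposable projective summands as U has summands. In this form the quotient algebra need not
    be mentioned again. *)
Lemma support_tilting_facts :
  fingen U /\ ext_injective (SubCat U) U /\
  exists n, num_indec_summands U n /\ exists I : set L,
    (forall (a : L^c) (u : U), I a -> a *: u = 0) /\
    forall t (S : 'I_t -> lmodType L^c), (forall i, simple_mod (S i)) ->
      (forall i (a : L^c) (s : S i), I a -> a *: s = 0) ->
      (forall i j, iso (S i) (S j) -> i = j) -> (t <= n)%N.
Proof.
have [fR fL] := artin_algebra_fin_len.
have [e [G [p [_ pR pS _ [V [h [hb hZ [[fV [T [[J [dJ tT]] TV]]] [n [nV nG]]]]]]]]]] := hU.
pose pi : quotient_map L^c G^c := @QuotientMap L^c G^c p (rmorphD p)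
  (fun a b => rmorphM p b a) (rmorph1 p) pS.
have fG : fin_len (restr (G^c)^o : lmodType R).
  have gL : linear (p : restr (L^c)^o -> restr (G^c)^o).
    move=> r x y; rewrite rmorphD; congr (_ + _).
    rewrite !restr_scaleE [LHS](rmorphM p (x : L) (alg_in L r)).
    by rewrite pR.
  by case: (fin_len_surj (f := lin_of gL) pS fL).
have fVR := fin_len_alg fG fV.
have hL' : linear (h : U -> down pi V).
  by move=> a x y; rewrite raddfD hZ.
have iUV : iso U (down pi V) by exists (lin_of hL').
have kU : killed pi U := killed_iso (iso_sym iUV) (@down_killed _ _ pi V).
have [k [hk kh]] := lin_inv (f := lin_of hL') hb.
split.
  have [s sP] := fV.
  apply: fin_len_fingen.
  have fVL := fin_len_restr fVR.
  have fd : fin_len (down pi V).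
    have [b bP] := fVL; exists b => m [W cW]; apply: bP.
    have WL (W' : submod (down pi V)) : forall a (x y : V), W' x -> W' y -> W' (a *: x + y).
      by move=> c x y Wx Wy; have [a <-] := qmap_surj pi c; exact: (smL (s := W') a Wx Wy).
    exists (Submod (sm0 W : sm_set W (0 : V)) (WL W)); elim: cW => [W'|j W1 W2 _ IH st].
      exact: chain_nil.
    exact: chain_step IH _.
  by case: (len_iso (iso_sym iUV) fd).
split.
  move=> X' X N i g f [_ [kX [jX jXI]]] [_ [kN [jN jNI]]] ig.
  have kffun m : killed pi {ffun 'I_m -> U}.
    by move=> b x pb; apply/ffunP => z; rewrite !ffunE; exact: kU.
  have kXk := killed_inj jXI (kffun _); have kNk := killed_inj jNI (kffun _).
  have [iI gS ker] := ig; have kX'k := killed_inj iI kXk.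
  (* N embeds in a power of U, and U is V up to change of rings, so a nonzero map T -> N would have
     a nonzero component T -> V. *)
  have TN (q : {linear T -> up kNk}) x : q x = 0.
    apply: jNI; rewrite linear0; apply/ffunP => z; rewrite !ffunE.
    have qL : linear (fun y : T => h (jN (q y) z)).
      move=> c u v; have [b <-] := qmap_surj pi c.
      rewrite linearP up_scaleE [jN _]linearP !ffunE raddfD; congr (_ + _).
      exact: hZ.
    have /= e0 := TV (lin_of qL) x.
    by apply: (bij_inj hb); rewrite e0 raddf0.
  have ig' : short_exact (up_lin kX'k kXk i) (up_lin kXk kNk g) by split.
  have [F FE] := tauinv_ext fR dJ (of_down kX'k (lin_of hL' \o f)) fVR tT TN ig'.
  exists (k \o to_down F) => x /=.
  by rewrite -[RHS]hk; congr (k _); exact: FE.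
exists n; split; first exact: num_indec_summands_down iUV nV.
exists [set a | p a = 0]; split; first exact: kU.
move=> t S sS kS Sinj.
have kSi i : killed pi (S i) := kS i.
apply: (@num_simple_le _ n t (fun i => up (kSi i)) (fin_len_restr fG) nG).
  by move=> i; exact: simple_mod_up.
by move=> i j /iso_up; exact: Sinj.
Qed.
End SupportTilting.

(** * The exact category Sub U *)

Lemma surj_iso (K : pzRingType) (X N N' : lmodType K) (g : {linear X -> N})
    (g' : {linear X -> N'}) : surj g -> surj g' ->
  (forall x, g x = 0 <-> g' x = 0) -> iso N N'.
Proof.
move=> gS gS' gg; have [f fE] := lin_factor gS (fun x => (gg x).1).
have [f' f'E] := lin_factor gS' (fun x => (gg x).2).
exists f; exists f' => y.
  by have [x <-] := gS y; rewrite fE f'E.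
by have [x <-] := gS' y; rewrite f'E fE.
Qed.

Lemma incl_im_exact (K : pzRingType) (X Y : lmodType K) (W : submod X)
    (t : {linear X -> Y}) : (forall x, t x = 0 <-> W x) ->
  short_exact (incl W) (to_im t).
Proof.
move=> tW; split; [exact: incl_inj|exact: to_im_surj|rewrite range_incl].
apply/seteqP; split=> x; first by move=> /tW tx; apply/(to_im_eq0 t x).
by move=> /(to_im_eq0 t x)/tW.
Qed.

Section SubCategory.
Variables (K : pzRingType) (U : lmodType K).
Hypothesis fK : fin_len (K^o : lmodType K).
Hypothesis fU : fingen U.
Hypothesis extU : ext_injective (SubCat U) U.
Let E := SubCat U.
Implicit Types A X Y N M : lmodType K.

Lemma SubCat_fin_len X : E X -> fin_len X.
Proof. by move=> [fX _]; exact: fingen_fin_len fK fX. Qed.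

Lemma SubCat_sub X Y (f : {linear X -> Y}) : injective f -> E Y -> E X.
Proof.
move=> fI EY; split; last by have [_ [n [g gI]]] := EY; exists n, (g \o f); exact: inj_comp.
by apply: fin_len_fingen; case: (fin_len_inj fI (SubCat_fin_len EY)).
Qed.

Lemma SubCat_iso X Y : iso X Y -> E X -> E Y.
Proof. by move=> /iso_sym[f /bij_inj_surj[fI _]]; exact: SubCat_sub fI. Qed.

Lemma SubCat_subm X (W : submod X) : E X -> E (sub_mod W).
Proof. exact: SubCat_sub (@incl_inj _ _ W). Qed.

Lemma SubCat_im X Y (f : {linear X -> Y}) : E Y -> E (im_mod f).
Proof. exact: SubCat_subm. Qed.

Lemma SubCat_prod X Y : E X -> E Y -> E (X * Y)%type.
Proof.
move=> EX EY; have [_ [n [f fI]]] := EX; have [_ [m [g gI]]] := EY.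
split; first exact: fin_len_fingen (len_prod (SubCat_fin_len EX) (SubCat_fin_len EY)).1.
pose h (p : X * Y) : {ffun 'I_(n + m) -> U} :=
  [ffun i => match fintype.split i with inl j => f p.1 j | inr j => g p.2 j end].
have hL : linear h.
  move=> a p q; apply/ffunP => i; rewrite !ffunE.
  by case: (fintype.split i) => j; rewrite linearP !ffunE.
exists (n + m)%N, (lin_of hL) => -[x y] [x' y'] /ffunP e; congr pair.
  apply: fI; apply/ffunP => j; have := e (unsplit (inl j)).
  by rewrite !ffunE unsplitK.
apply: gI; apply/ffunP => j; have := e (unsplit (inr j)).
by rewrite !ffunE unsplitK.
Qed.

Lemma SubCat_zero X : is_zero X -> E X.
Proof.
move=> X0; split; first exact: fin_len_fingen (len_zero X0).1.
have hL : linear (fun x : X => 0 : {ffun 'I_0 -> U}).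
  by move=> a x y; rewrite scaler0 addr0.
by exists 0%N, (lin_of hL) => x y _; rewrite (X0 x) (X0 y).
Qed.

Lemma SubCat_ffun X n : E X -> E {ffun 'I_n -> X}.
Proof.
move=> EX; elim: n => [|n IH].
  by apply: SubCat_zero => x; apply/ffunP => -[].
have fL : linear (fun x : {ffun 'I_n.+1 -> X} =>
    (x ord0, [ffun i : 'I_n => x (lift ord0 i)])).
  by move=> a x y; congr pair; [|apply/ffunP=> i]; rewrite !ffunE.
apply: (@SubCat_sub _ _ (lin_of fL) _ (SubCat_prod EX IH)) => x y [e0 /ffunP e].
apply/ffunP=> i; case: (unliftP ord0 i) => [j ->|->] //.
by have := e j; rewrite !ffunE.
Qed.

Lemma SubCat_gen : E U.
Proof.
split=> //; have hL : linear (fun u : U => [ffun i : 'I_1 => u]).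
  by move=> a x y; apply/ffunP => i; rewrite !ffunE.
by exists 1%N, (lin_of hL) => x y /ffunP/(_ ord0); rewrite !ffunE.
Qed.

Lemma SubCat_summand M : direct_summand M U -> E M.
Proof. by move=> /direct_summandP[a [e /can_inj aI]]; exact: SubCat_sub aI SubCat_gen. Qed.

Lemma ext_ffun n X' X N (i : {linear X' -> X}) (g : {linear X -> N})
    (f : {linear X' -> {ffun 'I_n -> U}}) : E X -> E N -> short_exact i g ->
  exists F : {linear X -> {ffun 'I_n -> U}}, forall x, F (i x) = f x.
Proof.
move=> EX EN ig; have fL (j : 'I_n) : linear (fun x => f x j).
  by move=> a x y; rewrite linearP !ffunE.
have [F FE] := choice (fun j => extU (lin_of (fL j)) EX EN ig).
have FL : linear (fun x => [ffun j => F j x]).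
  by move=> a x y; apply/ffunP => j; rewrite !ffunE linearP.
by exists (lin_of FL) => x; apply/ffunP => j; rewrite ffunE FE.
Qed.

(* [X / W] lies in [E]; as [E] is closed under submodules, these [W] are the
   points of P(X), ordered by inclusion. *)
Definition closed X (W : submod X) : Prop :=
  exists Y (th : {linear X -> Y}), E Y /\ forall x, th x = 0 <-> W x.

(** Inflations compose. As X / W lies in E, the map [th] followed by an embedding of Y into a power
    of U extends from W to X, and the extension paired with [t] has kernel exactly [W']. *)
Lemma closed_trans X (W W' : submod X) Y (th : {linear sub_mod W -> Y}) :
  E X -> closed W -> E Y -> (forall x, W' x -> W x) ->
  (forall w, th w = 0 <-> W' (val w)) -> closed W'.
Proof.
move=> EX [Z [t [EZ tW]]] EY WW thW'; have [_ [n [j jI]]] := EY.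
have ex := incl_im_exact tW.
have [F FE] := ext_ffun (j \o th) EX (SubCat_im t EZ) ex.
have pL : linear (fun x => (t x, F x)) by move=> a x y; congr pair; rewrite linearP.
exists (Z * {ffun 'I_n -> U})%type, (lin_of pL); split.
  by apply: SubCat_prod => //; apply: SubCat_ffun; exact: SubCat_gen.
move=> x; split=> [[/tW Wx Fx]|W'x].
  have := FE (to_sub Wx); rewrite inclE val_to_sub Fx => /esym/(lin_inj0 jI)/thW'.
  by rewrite val_to_sub.
have Wx := WW x W'x; congr pair; first exact/tW.
have := FE (to_sub Wx); rewrite inclE val_to_sub => ->.
by rewrite /= (_ : th _ = 0) ?linear0 //; apply/thW'; rewrite val_to_sub.
Qed.

Lemma conflation_ker X Y (th : {linear X -> Y}) : E X -> E Y ->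
  conflation E (incl (sm_ker th)) (to_im th).
Proof.
by move=> EX EY; split=> //; [exact: SubCat_subm|exact: SubCat_im|exact: ker_im_exact].
Qed.

(** Half of Schur's lemma: the image is a submodule of an object of E, hence in E, so kernel and
    image form a conflation. A nonzero map need not be surjective. *)
Lemma simple_in_ker X Y (th : {linear X -> Y}) : simple_in E X -> E Y ->
  (forall x, th x = 0 -> x = 0) \/ (forall x, th x = 0).
Proof.
move=> [EX nz ns] EY.
have [kz|knz] := pselect (is_zero (sub_mod (sm_ker th))).
  left=> x tx; have := congr1 val (kz (@to_sub _ _ (sm_ker th) x tx)).
  by rewrite val_to_sub linear0.
have [iz|inz] := pselect (is_zero (im_mod th)).
  by right=> x; apply/(to_im_eq0 th x); exact: iz.
case: ns; exists (sub_mod (sm_ker th)), (im_mod th), (incl (sm_ker th)), (to_im th).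
by split=> //; exact: conflation_ker.
Qed.

Definition adm_range X (A : adm_sub E X) : submod X := sm_im (adm_map A) sm_full.

Lemma adm_rangeP X (A : adm_sub E X) x :
  adm_range A x <-> exists a, adm_map A a = x.
Proof. by split=> [[a _ <-]|[a <-]]; exists a. Qed.

Lemma adm_inj X (A : adm_sub E X) : injective (adm_map A).
Proof. by have [N [g [_ _ _ []]]] := adm_infl A. Qed.

Lemma adm_dom_E X (A : adm_sub E X) : E (adm_dom A).
Proof. by have [N [g []]] := adm_infl A. Qed.

Lemma adm_range_closed X (A : adm_sub E X) : closed (adm_range A).
Proof.
have [N [g [_ _ EN ex]]] := adm_infl A; exists N, g; split=> // x.
by rewrite (short_exact_ker ex) adm_rangeP.
Qed.

Lemma ex_adm_sub X (W : submod X) : E X -> closed W ->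
  exists A : adm_sub E X, adm_range A = W.
Proof.
move=> EX [Y [th [EY thW]]].
have infl : inflation E (incl W).
  exists (im_mod th), (to_im th); split=> //; [exact: SubCat_subm|exact: SubCat_im|].
  exact: incl_im_exact.
exists (AdmSub infl); apply: submod_eq; apply/seteqP; split=> x.
  by move=> [w _ <-]; exact: sub_modP.
by move=> Wx; exists (to_sub Wx).
Qed.

(** An inclusion of images is automatically an inflation: the cokernel embeds in X / A, and E is
    closed under submodules. *)
Lemma adm_leP X (A B : adm_sub E X) :
  adm_le A B <-> forall x, adm_range A x -> adm_range B x.
Proof.
split=> [[h [_ hE]] _ [a _ <-]|AB]; first by exists (h a).
have [|h hE] := @lin_lift _ _ _ _ (adm_map B) (adm_map A) (@adm_inj _ B).
  by move=> a; apply/adm_rangeP/AB; exists a.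
exists h; split=> //; have [N [g [EA EX EN ex]]] := adm_infl A.
exists (im_mod (g \o adm_map B)), (to_im (g \o adm_map B)).
split; [by []|exact: adm_dom_E|exact: SubCat_im|split; [|exact: to_im_surj|]].
  by move=> a a' e; apply: (@adm_inj _ A); rewrite -!hE e.
apply/seteqP; split=> [_ [a _ <-]|b /(to_im_eq0 (g \o adm_map B) b) gb].
  apply/(to_im_eq0 (g \o adm_map B) (h a)) => /=; rewrite hE.
  by apply/(short_exact_ker ex); exists a.
have [a ab] := (short_exact_ker ex _).1 gb.
by exists a => //; apply: (@adm_inj _ B); rewrite hE.
Qed.

Lemma adm_eqP X (A B : adm_sub E X) : adm_eq A B <-> adm_range A = adm_range B.
Proof.
split=> [[h [/bij_inj_surj[_ hS] hE]]|e].
  apply: submod_eq; apply/seteqP; split=> _ [a _ <-].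
    by exists (h a).
  by have [a' <-] := hS a; exists a'.
have /adm_leP[h [_ hE]] : forall x, adm_range A x -> adm_range B x by rewrite e.
exists h; split=> //; apply/bij_inj_surj; split.
  by move=> a a' eh; apply: (@adm_inj _ A); rewrite -!hE eh.
move=> b; have [a _ ab] : adm_range A (adm_map B b) by rewrite e; exists b.
by exists a; apply: (@adm_inj _ B); rewrite hE.
Qed.

Definition factor X (W W' : submod X) N : Prop :=
  (forall x, W x -> W' x) /\
  exists g : {linear sub_mod W' -> N}, surj g /\ forall w, g w = 0 <-> W (val w).

Lemma adm_quotient_factor X (A B : adm_sub E X) N : E N ->
  factor (adm_range A) (adm_range B) N -> adm_quotient A B N.
Proof.
move=> EN [/adm_leP[h [hi hE]] [g [gS gE]]].
have BW b : adm_range B (adm_map B b) by exists b.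
have cL : linear (fun b => to_sub (BW b)).
  by move=> a x y; apply: val_inj; rewrite [RHS]linearP /= linearP.
exists h, (g \o lin_of cL); split=> //.
split; [exact: adm_dom_E|exact: adm_dom_E|by []|split].
- by move=> a a' e; apply: (@adm_inj _ A); rewrite -!hE e.
- move=> y; have [w <-] := gS y; have [b _ bw] := sub_modP w.
  by exists b => /=; congr (g _); apply: val_inj; rewrite /= bw.
- apply/seteqP; split=> [_ [a _ <-]|b /gE /= [a _ ab]].
    by apply/gE => /=; rewrite hE; exists a.
  by exists a => //; apply: (@adm_inj _ B); rewrite hE.
Qed.

Lemma adm_quotient_iso X (A B : adm_sub E X) N N' :
  adm_quotient A B N -> adm_quotient A B N' -> iso N N'.
Proof.
move=> [h [g [[_ _ _ ex] hE]]] [h' [g' [[_ _ _ ex'] hE']]].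
have [_ gS _] := ex; have [_ gS' _] := ex'.
apply: (surj_iso gS gS') => b; rewrite (short_exact_ker ex) (short_exact_ker ex').
by split=> -[a ab]; exists a; rewrite -ab; apply: (@adm_inj _ B); rewrite hE hE'.
Qed.

(* [series l W]: a chain of closed submodules from 0 to [W] with simple factors,
   listed in [l] from bottom to top. *)
Inductive series X : seq (lmodType K) -> submod X -> Prop :=
| series_nil W : closed W -> (forall x, W x -> x = 0) -> series [::] W
| series_rcons l V W N : series l V -> closed W -> simple_in E N ->
    factor V W N -> series (rcons l N) W.

Lemma factor_im A X (f : {linear A -> X}) (W W' : submod A) N : injective f ->
  factor W W' N -> factor (sm_im f W) (sm_im f W') N.
Proof.
move=> fI [WW' [g [gS gE]]]; split; first by move=> _ [a /WW' Wa <-]; exists a.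
have [||k kE] := @lin_lift _ _ _ _ (f \o incl W') (incl (sm_im f W')).
- by apply: inj_comp => //; exact: incl_inj.
- by move=> z; have [a Wa az] := sub_modP z; exists (to_sub Wa).
exists (g \o k); split=> [y|w].
  have [w <-] := gS y; have Ww : sm_im f W' (f (val w)) by exists (val w) => //; exact: sub_modP.
  exists (to_sub Ww) => /=; congr (g _); apply: incl_inj; apply: fI.
  by have := kE (to_sub Ww).
have kw : f (val (k w)) = val w := kE w.
split=> [/gE Wk|[a Wa aw]]; first by rewrite -kw; exists (val (k w)).
by apply/gE; rewrite -(fI _ _ (etrans aw (esym kw))).
Qed.

Lemma factor_pre X N (p : {linear X -> N}) (W W' : submod N) M : surj p ->
  factor W W' M -> factor (sm_pre p W) (sm_pre p W') M.
Proof.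
move=> pS [WW' [g [gS gE]]]; split; first by move=> x; exact: WW'.
have [|k kE] := @lin_lift _ _ _ _ (incl W') (p \o incl (sm_pre p W')) (@incl_inj _ _ W').
  by move=> z; exists (to_sub (sub_modP z : W' (p (val z)))).
exists (g \o k); split=> [y|w].
  have [w <-] := gS y; have [x xw] := pS (val w).
  have Wx : sm_pre p W' x by rewrite /= xw; exact: sub_modP.
  exists (to_sub Wx) => /=; congr (g _); apply: incl_inj.
  by have := kE (to_sub Wx) => /= ->; rewrite xw.
rewrite /= gE; have : val (k w) = p (val w) := kE w.
by move=> ->.
Qed.

Lemma closed_im A X N (f : {linear A -> X}) (g : {linear X -> N}) (W : submod A) :
  conflation E f g -> closed W -> closed (sm_im f W).
Proof.
move=> [EA EX EN ex] [Y [th [EY thW]]]; have [fI _ _] := ex.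
have [|k kE] := @lin_lift _ _ _ _ f (incl (sm_im f sm_full)) fI.
  by move=> z; have [a _ az] := sub_modP z; exists a.
apply: (@closed_trans _ (sm_im f sm_full) _ Y (th \o k)) => //.
- exists N, g; split=> // x; rewrite (short_exact_ker ex).
  by split=> [[a <-]|[a _ <-]]; exists a.
- by move=> _ [a _ <-]; exists a.
have kw w : f (k w) = val w := kE w.
move=> w; split=> [/thW Wk|[a Wa aw]]; first by rewrite -kw; exists (k w).
by apply/thW; rewrite -(fI _ _ (etrans aw (esym (kw w)))).
Qed.

Lemma series_im A X N (f : {linear A -> X}) (g : {linear X -> N}) l (W : submod A) :
  conflation E f g -> series l W -> series l (sm_im f W).
Proof.
move=> fg; have [_ _ _ [fI _ _]] := fg.
elim=> {l W} [W cW W0|l V W M _ IH cW sM fac].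
  apply: series_nil; first exact: closed_im fg cW.
  by move=> _ [a /W0 -> <-]; exact: linear0.
by apply: (series_rcons IH (closed_im fg cW) sM); exact: factor_im.
Qed.

Lemma series_cat A X N (f : {linear A -> X}) (g : {linear X -> N}) l l' (W : submod N) :
  conflation E f g -> series l (@sm_full _ A) -> series l' W ->
  series (l ++ l') (sm_pre g W).
Proof.
move=> fg sA; have [_ _ _ ex] := fg; have [_ gS _] := ex.
elim=> {l' W} [W _ W0|l' V W M _ IH cW sM fac].
  rewrite cats0; have := series_im fg sA; congr (series l _).
  apply: submod_eq; apply/seteqP; split=> [_ [a _ <-]|x /= /W0].
    have -> : sm_set (sm_pre g W) (f a) = W (g (f a)) by [].
    have -> : g (f a) = 0 by apply/(short_exact_ker ex); exists a.
    exact: sm0.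
  by move=> /(short_exact_ker ex)[a <-]; exists a.
rewrite -rcons_cat; apply: series_rcons IH _ sM (factor_pre gS fac).
by have [Y [th [EY thW]]] := cW; exists Y, (th \o g); split=> // x; exact: thW.
Qed.

Lemma closed_full X : E X -> closed (@sm_full _ X).
Proof.
move=> EX; have zL : linear (fun _ : X => 0 : X) by move=> a x y; rewrite scaler0 addr0.
by exists X, (lin_of zL).
Qed.

Lemma closed_zero X : E X -> closed (@sm_zero _ X).
Proof. by move=> EX; exists X, idfun. Qed.

Lemma series_simple X : simple_in E X -> series [:: X] (@sm_full _ X).
Proof.
move=> sX; have [EX _ _] := sX.
apply: (@series_rcons X [::] sm_zero) => //.
- by apply: series_nil => //; exact: closed_zero.
- exact: closed_full.
split=> //; exists (incl sm_full); split=> // x.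
by exists (@to_sub _ _ sm_full x I).
Qed.

Lemma conflation_len A X N (f : {linear A -> X}) (g : {linear X -> N}) :
  conflation E f g -> ~ is_zero A -> ~ is_zero N ->
  (len A < len X)%N /\ (len N < len X)%N.
Proof.
move=> [EA EX EN ex] nA nN; rewrite (len_exactE ex (SubCat_fin_len EX)).
rewrite -[X in (X < _)%N]addn0 ltn_add2l -[X in _ /\ (X < _)%N]add0n ltn_add2r !lt0n.
by split; apply/eqP; [move/(len_eq0 (SubCat_fin_len EN))|move/(len_eq0 (SubCat_fin_len EA))].
Qed.

Lemma SubCat_ind (P : lmodType K -> Prop) :
  (forall X, is_zero X -> P X) -> (forall X, simple_in E X -> P X) ->
  (forall A X N (f : {linear A -> X}) (g : {linear X -> N}),
    conflation E f g -> P A -> P N -> P X) -> forall X, E X -> P X.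
Proof.
move=> P0 Ps Pc X; move: {2}(len X) (leqnn (len X)) => n; elim: n X => [|n IH] X le EX.
  by apply: P0; apply: len_eq0 (SubCat_fin_len EX) _; apply/eqP; rewrite -leqn0.
have [Xz|nz] := pselect (is_zero X); first exact: P0.
have [ex|nex] := pselect (exists (L N : lmodType K) (f : {linear L -> X}) (g : {linear X -> N}),
  [/\ conflation E f g, ~ is_zero L & ~ is_zero N]); last by apply: Ps.
have [L [N [f [g [fg nL nN]]]]] := ex; have [ltL ltN] := conflation_len fg nL nN.
have [EL _ EN _] := fg.
by apply: (Pc _ _ _ _ _ fg); apply: IH => //; rewrite -ltnS; exact: leq_trans le.
Qed.

Lemma ex_series X : E X -> exists l, series l (@sm_full _ X).
Proof.
move: X; apply: SubCat_ind => [X X0|X sX|A X N f g fg [l sl] [l' sl']].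
- exists [::]; apply: series_nil => [|x _]; last exact: X0.
  by apply: closed_full; exact: SubCat_zero.
- by exists [:: X]; exact: series_simple.
exists (l ++ l'); have := series_cat fg sl sl'; congr (series _ _).
exact: submod_eq.
Qed.

Lemma series_chain X l (W : submod X) : series l W ->
  exists c : nat -> submod X, [/\ c (size l) = W, forall x, c 0%N x -> x = 0,
    forall i, closed (c i) &
    forall i, (i < size l)%N -> simple_in E (nth U l i) /\ factor (c i) (c i.+1) (nth U l i)].
Proof.
elim=> {l W} [W cW W0|l V W N _ [c [cl c0 cc cf]] cW sN fac].
  by exists (fun _ => W).
exists (fun i => if (i <= size l)%N then c i else W); split.
- by rewrite size_rcons ltnn.
- by move=> x; exact: c0.
- by move=> i; case: ifP.
move=> i; rewrite size_rcons ltnS leq_eqVlt nth_rcons => /orP[/eqP->|lt].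
  by rewrite ltnn eqxx /= cl.
by rewrite lt orbT; exact: cf.
Qed.

Lemma factor_strict X (V W : submod X) N : simple_in E N -> factor V W N ->
  V <> W.
Proof.
move=> [_ nz _] [VW [g [gS gE]]] e; apply: nz => y; have [w <-] := gS y.
by apply/gE; rewrite e; exact: sub_modP.
Qed.

(** The map with kernel [Z], restricted to [W], factors through the simple object N and is therefore
    injective or zero there. *)
Lemma factor_cover X (V W Z : submod X) N : E X -> simple_in E N -> factor V W N ->
  closed Z -> (forall x, V x -> Z x) -> (forall x, Z x -> W x) -> Z = V \/ Z = W.
Proof.
move=> EX sN [VW [g [gS gE]]] [Y [th [EY thZ]]] VZ ZW.
have [|h hE] := lin_factor (f := th \o incl W) gS.
  by move=> w /gE Vw; apply/thZ/VZ.
have [h0|h0] := simple_in_ker h sN EY.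
  left; apply: submod_eq; apply/seteqP; split=> // x Zx.
  have := (gE (to_sub (ZW x Zx))).1; rewrite val_to_sub; apply; apply: h0.
  by rewrite hE /=; exact/thZ.
right; apply: submod_eq; apply/seteqP; split=> // x Wx; apply/thZ.
exact: (etrans (esym (hE (to_sub Wx))) (h0 _)).
Qed.

Lemma composition_series_of X l : E X -> series l (@sm_full _ X) ->
  exists c : 'I_(size l).+1 -> adm_sub E X, composition_series c /\
    forall i : 'I_(size l), series_factor c i (nth U l i).
Proof.
move=> EX /series_chain[w [wl w0 wc wf]].
have /choice[a aE] (i : nat) := ex_adm_sub EX (wc i).
have wmono i j : (i <= j)%N -> (j <= size l)%N -> forall x, w i x -> w j x.
  move=> ij; rewrite -(subnK ij); elim: (j - i)%N => [//|k IH] le x wx.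
  by have [_ [h _]] := wf (k + i)%N le; apply: h; apply: IH => //; exact: ltnW.
exists (fun i => a i); split; last first.
  move=> i; have [sN fac] := wf i (ltn_ord i).
  by apply: adm_quotient_factor; [by case: sN|rewrite !aE].
split.
- move=> x; apply: (lin_inj0 (@adm_inj _ (a 0%N))); apply: w0.
  by rewrite -aE; exists x.
- apply/bij_inj_surj; split; first exact: adm_inj.
  by move=> x; apply/adm_rangeP; rewrite aE wl.
- move=> i j ij; split.
    by apply/adm_leP; rewrite !aE; apply: wmono; [exact: ltnW|rewrite -ltnS; exact: ltn_ord].
  move=> /adm_eqP; rewrite !aE => e.
  have jl : (j <= size l)%N by rewrite -ltnS; exact: ltn_ord.
  have il : (i < size l)%N := leq_trans ij jl.
  have [sN fac] := wf i il; apply: (factor_strict sN fac).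
  apply: submod_eq; apply/seteqP; split=> x; first by have [h _] := fac; exact: h.
  by move=> /(wmono _ _ ij jl); rewrite e.
move=> B Bc.
have Bw i : (i <= size l)%N -> (forall x, adm_range B x -> w i x) \/
    (forall x, w i x -> adm_range B x).
  move=> il; have := Bc (Ordinal (il : (i < (size l).+1)%N)) => /=.
  by move=> [/adm_leP|/adm_leP]; rewrite aE; [left|right].
suff [i [il e]] : exists i, (i <= size l)%N /\ adm_range B = w i.
  by exists (Ordinal (il : (i < (size l).+1)%N)); apply/adm_eqP; rewrite /= aE.
(* With i the last index such that [w i] lies in [B], comparability places [B] between two
   consecutive terms, where [factor_cover] leaves no room. *)
pose P i := (i <= size l)%N && `[< forall x, w i x -> adm_range B x >].
have P0 : exists i, P i.
  by exists 0%N; apply/andP; split=> //; apply/asboolP => x /w0 ->; exact: sm0.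
have Pb i : P i -> (i <= size l)%N by case/andP.
have [i /andP[il /asboolP wB] imax] := ex_maxnP P0 Pb.
move: il; rewrite leq_eqVlt => /orP[/eqP e|lt].
  exists (size l); split=> //; apply: submod_eq; apply/seteqP; split=> x; first by rewrite wl.
  by rewrite -e; exact: wB.
have [Bsub|wsub] := Bw i.+1 lt; last first.
  have : P i.+1 by rewrite /P lt; exact/asboolP.
  by move/imax; rewrite ltnn.
have [sN fac] := wf i lt.
have [e|e] := factor_cover EX sN fac (adm_range_closed B) wB Bsub.
  by exists i; split=> //; exact: ltnW.
by exists i.+1.
Qed.

Section Composition.
Variables (X : lmodType K) (n : nat) (c : 'I_n.+1 -> adm_sub E X).
Hypothesis EX : E X.
Hypothesis cs : composition_series c.

Lemma composition_mono (i j : 'I_n.+1) : (i <= j)%N ->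
  forall x, adm_range (c i) x -> adm_range (c j) x.
Proof.
rewrite leq_eqVlt => /orP[/eqP/val_inj-> //|ij]; apply/adm_leP.
by case: cs => _ _ h _; case: (h _ _ ij).
Qed.

(** A conflation inside the factor would refine the chain: the preimage [B] of its subobject is
    closed by [closed_trans] and comparable with every term, so maximality makes it a term of the
    chain, and then one end of the conflation is zero. *)
Lemma composition_factor (i : 'I_n) :
  exists N, simple_in E N /\ series_factor c i N.
Proof.
case: cs => c0 cn clt cmax.
pose i0 := widen_ord (leqnSn n) i; pose i1 := lift ord0 i.
have [le ne] : adm_lt (c i0) (c i1) by apply: clt; rewrite /= /bump.
have [h [[N [g fg]] hE]] := le; have [E0 E1 EN ex] := fg; have [hI gS _] := ex.
exists N; split; last by exists h, g.
split=> //.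
  move=> Nz; apply: ne; exists h; split=> //; apply/bij_inj_surj; split=> // b.
  by apply/(short_exact_ker ex); exact: Nz.
move=> [L [N' [f [p [fp nL nN']]]]]; have [EL _ EN' exf] := fp; have [_ pS _] := exf.
pose B := sm_im (adm_map (c i1)) (sm_ker (p \o g)).
have cB : closed B.
  have [|k kE] := @lin_lift _ _ _ _ (adm_map (c i1)) (incl (adm_range (c i1))) (@adm_inj _ _).
    by move=> z; have [a _ az] := sub_modP z; exists a.
  have kw w : adm_map (c i1) (k w) = val w := kE w.
  apply: (closed_trans (th := p \o g \o k) EX (adm_range_closed (c i1)) EN').
    by move=> _ [a _ <-]; exists a.
  move=> w; split=> [e|[a pa aw]]; first by rewrite -kw; exists (k w).
  by rewrite /= -[k w](@adm_inj _ (c i1) a) // kw.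
have [b bE] := ex_adm_sub EX cB.
have lo x : adm_range (c i0) x -> B x.
  move=> [a _ <-]; exists (h a); last by rewrite hE.
  have gh : g (h a) = 0 by apply/(short_exact_ker ex); exists a.
  by rewrite /= gh linear0.
have hi x : B x -> adm_range (c i1) x by move=> [a _ <-]; exists a.
have [j /adm_eqP] : exists j, adm_eq b (c j).
  apply: cmax => j; have [ji|ij] := leqP j i.
    right; apply/adm_leP => x xj; rewrite bE; apply: lo.
    exact: (composition_mono (j := i0) ji).
  left; apply/adm_leP => x; rewrite bE => /hi.
  exact: (composition_mono (i := i1)).
rewrite bE => e; have [ji|ij] := leqP j i.
  apply: nL => y; have [z zy] := gS (f y).
  have pfy : p (f y) = 0 by apply/(short_exact_ker exf); exists y.
  have : B (adm_map (c i1) z) by exists z; rewrite /= ?zy.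
  rewrite e => /(composition_mono (j := i0) ji) [a _ /esym az].
  have zh : z = h a by apply: (@adm_inj _ (c i1)); rewrite hE.
  have fI : injective f by case: exf.
  apply: (lin_inj0 fI); rewrite -zy zh; apply/(short_exact_ker ex); by exists a.
apply: nN' => y; have [z <-] := pS y; have [u <-] := gS z.
have : B (adm_map (c i1) u).
  by rewrite e; apply: (composition_mono (i := i1)) => //; exists u.
by move=> [v pv /adm_inj <-].
Qed.
End Composition.

(** Values are rational rather than natural so that linear combinations and matrix ranks are
    available. *)
Definition additive_on (h : lmodType K -> rat) : Prop :=
  forall A X N (f : {linear A -> X}) (g : {linear X -> N}),
    conflation E f g -> h X = h A + h N.

Section Additive.
Variable h : lmodType K -> rat.
Hypothesis ha : additive_on h.

Lemma additive_zero X : is_zero X -> h X = 0.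
Proof.
move=> X0; have cf : conflation E (idfun : {linear X -> X}) (idfun : {linear X -> X}).
  split; try exact: SubCat_zero; split=> [//|x|]; first by exists x.
  by apply/seteqP; split=> x _; [exact: X0|exists x].
by apply: (addIr (h X)); rewrite -(ha cf) add0r.
Qed.

Lemma additive_iso X Y : E X -> iso X Y -> h X = h Y.
Proof.
move=> EX i; have [f fb] := i; have [fI fS] := (bij_inj_surj f).1 fb.
have zL : linear (fun _ : Y => 0 : sub_mod (@sm_zero _ Y)).
  by move=> a x y; rewrite scaler0 addr0.
have Z : is_zero (sub_mod (@sm_zero _ Y)).
  by move=> x; apply: val_inj; rewrite linear0; exact: sub_modP x.
have cf : conflation E f (lin_of zL).
  split; [by []|exact: SubCat_iso i EX|exact: SubCat_zero|split=> // [y|]].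
    by exists 0; rewrite [RHS]Z.
  by apply/seteqP; split=> y _ //; have [x <-] := fS y; exists x.
by rewrite (ha cf) (additive_zero Z) addr0.
Qed.

Lemma additive_vanish : (forall X, simple_in E X -> h X = 0) ->
  forall X, E X -> h X = 0.
Proof.
move=> hs; apply: (@SubCat_ind (fun X => h X = 0)) => [X X0|//|A X N f g fg hA hN].
  exact: additive_zero.
by rewrite (ha fg) hA hN addr0.
Qed.

Lemma additive_series X n (c : 'I_n.+1 -> adm_sub E X) (N : 'I_n -> lmodType K) :
  E X -> composition_series c -> (forall i, series_factor c i (N i)) ->
  h X = \sum_(i < n) h (N i).
Proof.
move=> EX [c0 cn _ _] cN.
have key k : (k <= n)%N ->
    h (adm_dom (c (inord k))) = \sum_(i < n | (i < k)%N) h (N i).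
  elim: k => [|k IH] kn.
    rewrite big_pred0_eq (_ : inord 0 = ord0); last by apply: val_inj; rewrite /= inordK.
    exact: additive_zero.
  pose i := Ordinal kn; have [f [g [fg _]]] := cN i.
  have e0 : widen_ord (leqnSn n) i = inord k.
    by apply: val_inj; rewrite /= inordK // ltnS ltnW.
  have e1 : lift ord0 i = inord k.+1 by apply: val_inj; rewrite /= inordK.
  rewrite -e1 (ha fg) e0 IH; last exact: ltnW.
  rewrite [RHS](bigD1 i) //= addrC; congr (_ + _); apply: eq_bigl => j.
  by rewrite ltnS ltn_neqAle andbC.
have := key n (leqnn n); have -> : inord n = ord_max :> 'I_n.+1.
  by apply: val_inj; rewrite /= inordK.
rewrite (additive_iso (adm_dom_E _) (ex_intro _ _ cn)) => ->.
by apply: eq_bigl => i; rewrite ltn_ord.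
Qed.
End Additive.

Definition mult (s : lmodType K) (l : seq (lmodType K)) : nat :=
  count (fun N => `[< iso N s >]) l.

Lemma multE s l : mult s l = (\sum_(i < size l) (`[< iso (nth U l i) s >] : nat))%N.
Proof. by rewrite /mult -sumn_count sumnE big_map (big_nth U) big_mkord. Qed.

Lemma JHP_mult (s X : lmodType K) l l' : JHP E -> E X ->
  series l (@sm_full _ X) -> series l' (@sm_full _ X) -> mult s l = mult s l'.
Proof.
move=> jhp EX /(composition_series_of EX)[c [cs cf]] /(composition_series_of EX)[d [ds df]].
have [e [p pE]] := jhp X EX _ _ c d cs ds.
rewrite !multE [RHS](reindex (fun i : 'I_(size l) => p (cast_ord e i))) /=.
  apply: eq_bigr => i _; congr nat_of_bool; have [N [N' [cN dN' NN']]] := pE i.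
  have i1 := adm_quotient_iso (cf i) cN.
  have i2 := adm_quotient_iso (df _) dN'.
  have i3 := iso_trans (iso_trans i1 NN') (iso_sym i2).
  by apply/asboolP/asboolP => h; [exact: iso_trans (iso_sym i3) h|exact: iso_trans i3 h].
apply: onW_bij; exists (fun j => cast_ord (esym e) ((p^-1)%g j)) => i /=.
  by rewrite permK cast_ordK.
by rewrite cast_ordKV permKV.
Qed.
End SubCategory.

(** * Lengths of Hom modules *)

Section HomLength.
Variables (R : comPzRingType) (L : pzAlg R) (U : lmodType L^c).
Hypothesis fL : fin_len (restr (L^c)^o : lmodType R).
Hypothesis fU : fingen U.
Hypothesis extU : ext_injective (SubCat U) U.
Let E := SubCat U.
Let fK : fin_len ((L^c)^o : lmodType L^c) := fin_len_restr fL.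
Let c := alg_central L.
Implicit Types A X Y Z M N P : lmodType L^c.

Definition hom_len X M : nat := len (chom c X M).

Lemma fin_len_hom X M : E X -> E M -> fin_len (chom c X M).
Proof. by move=> [fX _] [fM _]; apply: fin_len_chom => //; exact: fin_len_alg. Qed.

Lemma hom_len_exact X M A N (f : {linear A -> X}) (g : {linear X -> N}) :
  surj g -> (forall x, g (f x) = 0) ->
  (forall p : {linear X -> M}, (forall x, p (f x) = 0) ->
    exists q : {linear N -> M}, forall x, q (g x) = p x) ->
  short_exact (chom_pre c M g) (to_im (chom_pre c M f)).
Proof.
move=> gS gf fac; split.
- move=> p q e; apply: chomP => y; have [x <-] := gS y.
  exact: (congr1 (fun k : chom c X M => k x) e).
- exact: to_im_surj.
apply/seteqP; split=> [_ [q _ <-]|p].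
  apply/(to_im_eq0 (chom_pre c M f)); apply: chomP => x.
  by rewrite !chom_preE gf linear0.
move=> /(to_im_eq0 (chom_pre c M f) p) p0.
have [|q qE] := fac p; first by move=> x; exact: (congr1 (fun k : chom c A M => k x) p0).
by exists (to_chom c q) => //; apply: chomP.
Qed.

Lemma hom_len_additive M : direct_summand M U ->
  additive_on U (fun X => (hom_len X M)%:R).
Proof.
move=> dM A X N f g fg; have [EA EX EN ex] := fg; have [fI gS _] := ex.
have EM := SubCat_summand fK fU dM.
have /direct_summandP[a [e ae]] := dM.
have ext : surj (chom_pre c M f).
  move=> p; have [F FE] := extU (a \o p) EX EN ex.
  by exists (to_chom c (e \o F)); apply: chomP => x; rewrite chom_preE to_chomE /= FE /= ae.
have := @hom_len_exact X M A N f g gS _ _.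
case=> [x|p p0|s1 s2 s3]; first by apply/(short_exact_ker ex); exists x.
  by apply: (lin_factor gS) => x /(short_exact_ker ex)[y <-].
rewrite /hom_len (len_exactE (And3 s1 s2 s3) (fin_len_hom EX EM)).
by rewrite (im_surj_len ext (fin_len_hom EA EM)) natrD addrC.
Qed.

Lemma hom_len_prod X M N : E X -> E M -> E N ->
  hom_len X (M * N)%type = (hom_len X M + hom_len X N)%N.
Proof.
move=> EX EM EN; have [fp <-] := len_prod (fin_len_hom EX EM) (fin_len_hom EX EN).
apply: (proj2 (len_iso _ fp)).
have gL (p : chom c X M * chom c X N) : linear (fun x => (p.1 x, p.2 x)).
  by move=> a x y; congr pair; rewrite linearP.
have fL' : linear (fun p => to_chom c (lin_of (gL p)) : chom c X (M * N)%type).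
  by move=> a p q; apply: chomP.
exists (lin_of fL'); apply/bij_inj_surj; split.
  move=> [p q] [p' q'] e; congr pair; apply: chomP => x.
    exact: (congr1 (fun k : chom c X (M * N)%type => (k x).1) e).
  exact: (congr1 (fun k : chom c X (M * N)%type => (k x).2) e).
move=> p; have p1L : linear (fun x => (p x).1) by move=> a x y; rewrite linearP.
have p2L : linear (fun x => (p x).2) by move=> a x y; rewrite linearP.
exists (to_chom c (lin_of p1L), to_chom c (lin_of p2L)); apply: chomP => x.
by rewrite to_chomE /=; case: (p x).
Qed.

(* Bongartz: compare the lengths of the exact sequences
   [0 -> Hom(C,Z) -> Hom(M^k,Z) -> Hom(N,Z)] for Z = M, N, where N -> M^k is a
   left approximation and C is the largest quotient of its cokernel in [E]. *)
Lemma hom_len_split M N : E M -> E N ->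
  (forall X, E X -> hom_len X M = hom_len X N) ->
  exists k (g : {linear N -> {ffun 'I_k -> M}}) (p : {linear {ffun 'I_k -> M} -> N}),
    cancel g p.
Proof.
move=> EM EN eMN; have [s sP] := fin_len_fingen (fin_len_hom EN EM).
pose k := size s; pose Y : lmodType L^c := {ffun 'I_k -> M}.
have EY : E Y by exact: SubCat_ffun.
have gL : linear (fun x : N => [ffun i : 'I_k => (s`_i : chom c N M) x] : Y).
  by move=> a x y; apply/ffunP => i; rewrite !ffunE linearP.
pose g : {linear N -> Y} := lin_of gL; exists k, g.
(* The coordinates of [g] generate Hom(N, M) over R, so every map N -> M factors through [g]. *)
have gM : surj (chom_pre c M g).
  move=> f; have [a ->] := sP f.
  have prL (i : 'I_k) : linear (fun y : Y => y i) by move=> b x y; rewrite !ffunE.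
  exists (\sum_(i < k) a i *: to_chom c (lin_of (prL i))).
  rewrite linear_sum; apply: eq_bigr => i _; rewrite linearZ; congr (_ *: _).
  by apply: chomP => x; rewrite chom_preE to_chomE /= ffunE.
(* Among the maps to objects of E that kill the image of [g], one with the smallest kernel; pairing
   it with any other such map shows that the others factor through it. Its image is the [C] of the
   comparison. *)
have [|[Z0 phi] [[EZ0 phig] phimin]] := @ex_minimal {Z : lmodType L^c & {linear Y -> Z}}
    (fun q => E (projT1 q) /\ forall x, projT2 q (g x) = 0)
    (fun q => len (sub_mod (sm_ker (projT2 q)))).
  have zL : linear (fun _ : Y => 0 : M) by move=> a x y; rewrite scaler0 addr0.
  by exists (existT _ M (lin_of zL)).
have {EZ0}EZ0 : E Z0 := EZ0.
have {phig}phig : forall x, phi (g x) = 0 := phig.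
have phiker Z (q : {linear Y -> Z}) : E Z -> (forall x, q (g x) = 0) ->
    forall y, phi y = 0 -> q y = 0.
  move=> EZ qg y py; apply: contrapT => qy.
  have pL : linear (fun y => (phi y, q y)) by move=> a u v; congr pair; rewrite linearP.
  pose W : lmodType L^c := (Z0 * Z)%type; pose pr : {linear Y -> W} := lin_of pL.
  have prg : E W /\ forall x, pr (g x) = 0.
    split=> [|x]; first exact: SubCat_prod.
    by rewrite /pr /= phig qg.
  have := phimin (existT (fun V : lmodType L^c => {linear Y -> V}) W pr) prg.
  apply/negP; rewrite -ltnNge; apply: len_strict; first exact: (SubCat_fin_len fK EY).
  split; first by move=> z [].
  by exists y; split=> // -[_].
pose C := im_mod phi; pose pi := to_im phi.
have EC : E C by exact: SubCat_im.
have piS : surj pi by exact: to_im_surj.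
have pig x : pi (g x) = 0 by apply/(to_im_eq0 phi).
have ex Z : E Z -> short_exact (chom_pre c Z pi) (to_im (chom_pre c Z g)).
  move=> EZ; apply: hom_len_exact => // q qg; apply: (lin_factor piS) => y.
  by move=> /(to_im_eq0 phi y); exact: phiker.
have lM := len_exactE (ex M EM) (fin_len_hom EY EM).
have lN := len_exactE (ex N EN) (fin_len_hom EY EN).
rewrite (im_surj_len gM (fin_len_hom EN EM)) in lM.
rewrite -!/(hom_len _ _) in lM lN.
(* Replacing M by N at Y, C and N makes the two length formulas differ in one term only: the maps N
   -> N that factor through [g] have the length of all of Hom(N, N). Hence the identity factors
   through [g]. *)
rewrite (eMN Y EY) (eMN C EC) (eMN N EN) lN in lM.
have [|p pE] := len_inj_surj (@incl_inj _ _ (sm_im (chom_pre c N g) sm_full))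
    (fin_len_hom EN EN) _ (to_chom c (idfun : {linear N -> N})).
  by rewrite -(leq_add2l (hom_len C N)) lM.
have [q _ qE] := sub_modP p; exists (q : {linear Y -> N}) => x.
have : chom_pre c N g q = to_chom c (idfun : {linear N -> N}) by rewrite -pE qE.
by move=> /(congr1 (fun k : chom c N N => k x)).
Qed.

Section DirectSums.
Variables (n : nat) (S : 'I_n -> lmodType L^c).
Hypothesis iS : forall i, indecomposable (S i) /\ direct_summand (S i) U.
Hypothesis Sinj : forall i j, iso (S i) (S j) -> i = j.

Let ES i : E (S i) := SubCat_summand fK fU (iS i).2.

(** Repetitions in the list record multiplicities; functions on the empty type give the zero
    module. *)
Fixpoint dsum (s : seq 'I_n) : lmodType L^c :=
  if s is i :: s' then (S i * dsum s')%type else {ffun 'I_0 -> U}.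

Lemma SubCat_dsum s : E (dsum s).
Proof.
elim: s => [|i s IH] /=; last exact: (SubCat_prod fK (ES i) IH).
by apply: SubCat_ffun => //; exact: SubCat_gen.
Qed.

Lemma hom_len_dsum X s : E X ->
  hom_len X (dsum s) = (\sum_(i <- s) hom_len X (S i))%N.
Proof.
move=> EX; elim: s => [|i s IH].
  rewrite big_nil; apply: (proj2 (len_zero _)) => f; apply: chomP => x.
  by apply/ffunP => -[].
by rewrite big_cons /= hom_len_prod //; [rewrite IH|exact: SubCat_dsum].
Qed.

Lemma dsum_summand s j : j \in s -> direct_summand (S j) (dsum s).
Proof.
elim: s => //= i s IH; rewrite inE => /orP[/eqP->|/IH dj].
  by exists (dsum s); exact: iso_refl.
apply: direct_summand_trans dj _; exists (S i); exact: iso_prodC.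
Qed.

(** The automorphism of P is a sum of one term through the first summand and one through the rest,
    and one of the two is bijective because P is local. *)
Lemma dsum_retract P s (a : {linear P -> dsum s}) (b : {linear dsum s -> P}) :
  fin_len P -> indecomposable P -> bijective (b \o a) ->
  exists2 i, i \in s & iso P (S i).
Proof.
move=> fP iP; elim: s a b => [|i s IH] a b ba.
  case: iP => nz _; case: nz => x; apply: (bij_inj ba) => /=.
  by congr (b _); apply/ffunP => -[].
have a1L : linear (fun x => (a x).1) by move=> r x y; rewrite linearP.
have a2L : linear (fun x => (a x).2) by move=> r x y; rewrite linearP.
have b1L : linear (fun u : S i => b (u, 0)).
  move=> r x y; rewrite -linearP; congr (b _); congr pair.
  by rewrite /= scaler0 addr0.
have b2L : linear (fun u : dsum s => b (0, u)).
  move=> r x y; rewrite -linearP; congr (b _); congr pair.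
  by rewrite /= scaler0 addr0.
pose F (t : bool) : {linear P -> P} :=
  if t then (lin_of b1L \o lin_of a1L : {linear P -> P})
  else (lin_of b2L \o lin_of a2L : {linear P -> P}).
have [|[] Fb] := @local_sum _ P bool [:: true; false] F (b \o a) fP iP ba.
- move=> x; rewrite !big_cons big_nil addr0 /= -linearD; congr (b _).
  by case: (a x) => u v; congr pair; rewrite /= ?addr0 ?add0r.
- by exists i; [exact: mem_head|exact: retract_iso iP.1 (iS i).1 Fb].
- by have [j js] := IH _ _ Fb; exists j => //; rewrite inE js orbT.
Qed.

(** By [hom_len_split] the sum over [t] is a summand of a power of the sum over [s]. An index j in
    [t] would make S j a retract of the sum over [s], hence isomorphic to some S i with i in [s]. *)
Lemma hom_len_dsum_disjoint s t : (forall X, E X ->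
    hom_len X (dsum s) = hom_len X (dsum t)) ->
  (forall i, i \in s -> i \notin t) -> forall i, i \notin t.
Proof.
move=> est dst j; apply/negP => jt.
have [k [g [p gp]]] := hom_len_split (SubCat_dsum s) (SubCat_dsum t) est.
have /direct_summandP[a [e ae]] := dsum_summand jt.
have fS := SubCat_fin_len fK (ES j).
have prL (l : 'I_k) : linear (fun x => g (a x) l : dsum s).
  by move=> r x y; rewrite !linearP !ffunE.
have inL (l : 'I_k) : linear (fun y : dsum s => e (p [ffun m => if m == l then y else 0])).
  move=> r x y; rewrite -!linearP; congr (e (p _)); apply/ffunP => m.
  by rewrite !ffunE; case: (m == l); rewrite ?scaler0 ?addr0.
have idb : bijective (idfun : {linear S j -> S j}) by exists id.
have [|l bl] := @local_sum _ (S j) 'I_k (index_enum 'I_k)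
  (fun l => lin_of (inL l) \o lin_of (prL l)) idfun fS (iS j).1 idb.
  move=> x; rewrite -[LHS](ae x) -(gp (a x)) /= -!linear_sum; congr (e (p _)).
  apply/ffunP => m; rewrite sum_ffunE (bigD1 m) //= big1 ?addr0 ?ffunE ?eqxx //.
  by move=> l lm; rewrite ffunE eq_sym (negPf lm).
have [i si /Sinj e'] := dsum_retract fS (iS j).1 bl.
by have := dst i si; rewrite -e' jt.
Qed.

Definition nseqs (m : 'I_n -> nat) : seq 'I_n :=
  flatten [seq nseq (m i) i | i <- enum 'I_n].

Lemma mem_nseqs m i : (i \in nseqs m) = (0 < m i)%N.
Proof.
apply/flatten_mapP/idP => [[j _]|mi]; first by rewrite mem_nseq => /andP[h /eqP->].
by exists i; rewrite ?mem_enum // mem_nseq mi eqxx.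
Qed.

Lemma sum_nseqs m (F : 'I_n -> nat) :
  (\sum_(i <- nseqs m) F i = \sum_(i < n) m i * F i)%N.
Proof.
rewrite big_flatten big_map big_enum; apply: eq_bigr => i _.
by rewrite big_nseq iter_addn_0 mulnC.
Qed.

(** The positive and negative parts of [z] are the multiplicities of two direct sums without common
    summands and with equal Hom lengths, so both sums are empty. *)
Lemma hom_len_free_int (z : 'I_n -> int) :
  (forall X, E X -> \sum_(i < n) (z i)%:~R * (hom_len X (S i))%:R = 0 :> rat) ->
  forall i, z i = 0.
Proof.
move=> z0; pose p i := if z i is Posz m then m else 0%N.
pose q i := if z i is Negz m then m.+1 else 0%N.
have zpq i : (z i)%:~R = (p i)%:R - (q i)%:R :> rat.
  by rewrite /p /q; case: (z i) => m; rewrite ?subr0 // NegzE sub0r mulrNz.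
have pq i : (0 < p i)%N -> (q i == 0)%N by rewrite /p /q; case: (z i).
have epq X : E X -> hom_len X (dsum (nseqs p)) = hom_len X (dsum (nseqs q)).
  move=> EX; rewrite !hom_len_dsum // !sum_nseqs.
  apply/eqP; rewrite -(Num.Theory.eqr_nat rat) !natr_sum -subr_eq0 -sumrB.
  apply/eqP; apply: etrans (z0 X EX); apply: eq_bigr => i _.
  by rewrite zpq mulrBl !natrM.
have dpq i : i \in nseqs p -> i \notin nseqs q.
  by rewrite !mem_nseqs => /pq/eqP->.
have dqp i : i \in nseqs q -> i \notin nseqs p.
  by apply: contraL => /dpq.
have qz := hom_len_dsum_disjoint epq dpq.
have pz := hom_len_dsum_disjoint (fun X EX => esym (epq X EX)) dqp.
move=> i; have := qz i; have := pz i; rewrite !mem_nseqs -!eqn0Ngt /p /q.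
by case: (z i) => // m /eqP->.
Qed.

Lemma hom_len_free (a : 'I_n -> rat) :
  (forall X, E X -> \sum_(i < n) a i * (hom_len X (S i))%:R = 0) ->
  forall i, a i = 0.
Proof.
move=> a0; pose D := \prod_(i < n) denq (a i).
pose z i := numq (a i) * \prod_(j < n | j != i) denq (a j).
have zE i : (z i)%:~R = D%:~R * a i.
  rewrite /D (bigD1 i) //= !intrM -[X in _ = _ * X]divq_num_den.
  rewrite [X in _ = X * _]mulrC -mulrA [X in _ = _ * X]mulrCA divff ?mulr1 1?mulrC //.
  by rewrite intr_eq0 denq_neq0.
have z0 : forall i, z i = 0.
  apply: hom_len_free_int => X EX.
  transitivity (D%:~R * \sum_(i < n) a i * (hom_len X (S i))%:R : rat).
    by rewrite mulr_sumr; apply: eq_bigr => i _; rewrite zE mulrA.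
  by rewrite a0 // mulr0.
move=> i; have := zE i; rewrite z0 => /esym/eqP; rewrite mulf_eq0 intr_eq0.
case/orP => [/eqP D0|/eqP //].
have : D != 0 by apply/prodf_neq0 => j _; exact: denq_neq0.
by rewrite D0 eqxx.
Qed.
End DirectSums.
End HomLength.

(** * Counting simple objects *)

(** A bound on lists of pairwise non-isomorphic objects yields an exact count: a longest list is
    complete, since a missing object would prolong it. *)
Lemma ex_iso_classes (K : pzRingType) (P : lmodType K -> Prop) n :
  (forall t (S : 'I_t -> lmodType K), (forall i, P (S i)) ->
    (forall i j, iso (S i) (S j) -> i = j) -> (t <= n)%N) ->
  exists t, (t <= n)%N /\ num_iso_classes P t.
Proof.
move=> bound.
have [||t [[S [PS Sinj]] tmax]] := @ex_maximal nat (fun t => exists S : 'I_t -> lmodType K,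
    (forall i, P (S i)) /\ forall i j, iso (S i) (S j) -> i = j) id n.
- have S0 (i : 'I_0) : lmodType K by case: i.
  by exists 0%N, S0; split=> -[].
- by move=> t [S [PS Sinj]]; exact: bound PS Sinj.
exists t; split; first exact: bound PS Sinj.
exists S; split=> // M PM; apply: contrapT => nM.
suff : (t.+1 <= t)%N by rewrite ltnn.
apply: tmax; exists (fun i : 'I_t.+1 => if unlift ord0 i is Some j then S j else M).
split=> [i|i j]; first by case: unliftP.
case: unliftP => [i' ->|->]; case: unliftP => [j' ->|->] //.
- by move=> /Sinj->.
- by move=> /iso_sym h; case: nM; exists i'.
- by move=> h; case: nM; exists j'.
Qed.

Lemma row_kernel m k (B : 'M[rat]_(m, k)) : (k < m)%N ->
  exists2 v : 'rV_m, v != 0 & v *m B = 0.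
Proof.
move=> km; have : kermx B != 0.
  rewrite kermx_eq0 /row_free; apply/eqP => e.
  by have := rank_leq_col B; rewrite e leqNgt km.
by move=> /rowV0Pn[v /sub_kermxP vB v0]; exists v.
Qed.

Lemma labels_perm p n (a b : 'I_p -> 'I_n) :
  (forall l, \sum_(i < p) (a i == l) = \sum_(i < p) (b i == l))%N ->
  exists s : 'S_p, forall i, a i = b (s i).
Proof.
move=> ab; pose ta := [tuple a i | i < p]; pose tb := [tuple b i | i < p].
have /tuple_permP[s sE] : perm_eq ta tb.
  apply/allP => l _ /=; apply/eqP.
  have cE (f : 'I_p -> 'I_n) : count_mem l [tuple f i | i < p] = (\sum_(i < p) (f i == l))%N.
    rewrite -sumn_count sumnE big_map /= big_map enumT; exact: eq_bigr.
  by rewrite !cE ab.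
exists s => i; have e : ta = [tuple tnth tb (s i) | i < p] by exact: val_inj.
by rewrite -[a i](tnth_mktuple a) -/ta e !tnth_mktuple.
Qed.

(** * Simple quotient modules of objects of E *)

Section SimpleQuotients.
Variables (K : pzRingType) (U : lmodType K).
Hypothesis fK : fin_len (K^o : lmodType K).
Hypothesis fU : fingen U.
Let E := SubCat U.
Implicit Types X Y S : lmodType K.

(** [S] need not lie in E, and then X' -> X is not an inflation; the difference h X - h X' replaces
    the value of h at [S]. *)
Definition simple_quotient S : Prop := simple_mod S /\
  exists X X' (i : {linear X' -> X}) (p : {linear X -> S}),
    [/\ E X, E X' & short_exact i p].

(* Both differences equal [h Q - h X' - h Y'] for the pullback [Q] of [p] and [q]. *)
Lemma additive_pullback h X X' Y Y' S (i : {linear X' -> X}) (p : {linear X -> S})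
    (j : {linear Y' -> Y}) (q : {linear Y -> S}) : additive_on U h ->
  E X -> E X' -> E Y -> E Y' -> short_exact i p -> short_exact j q ->
  h X - h X' = h Y - h Y'.
Proof.
move=> ha EX EX' EY EY' ip jq; have [iI pS _] := ip; have [jI qS _] := jq.
have dL : linear (fun z : X * Y => p z.1 - q z.2).
  by move=> a x y; rewrite /= [p _]linearP [q _]linearP scalerBr opprD addrACA.
pose Q := sm_ker (lin_of dL).
have EQ : E (sub_mod Q) by apply: SubCat_subm => //; exact: SubCat_prod.
have Qi x : Q (i x, 0).
  have pi0 : p (i x) = 0 by apply/(short_exact_ker ip); exists x.
  by rewrite /= pi0 linear0 subrr.
have Qj y : Q (0, j y).
  have qj0 : q (j y) = 0 by apply/(short_exact_ker jq); exists y.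
  by rewrite /= qj0 linear0 subrr.
have f1L : linear (fun x => to_sub (Qi x)).
  move=> a x y; apply: val_inj; rewrite [RHS]linearP; congr pair.
    exact: linearP.
  by rewrite /= scaler0 addr0.
have f2L : linear (fun y => to_sub (Qj y)).
  move=> a x y; apply: val_inj; rewrite [RHS]linearP; congr pair; last exact: linearP.
  by rewrite /= scaler0 addr0.
have g1L : linear (fun z : sub_mod Q => (val z).2) by move=> a x y; rewrite linearP.
have g2L : linear (fun z : sub_mod Q => (val z).1) by move=> a x y; rewrite linearP.
have Qz (z : sub_mod Q) : p (val z).1 = q (val z).2.
  by apply/eqP; rewrite -subr_eq0; apply/eqP; exact: sub_modP z.
(* Unlike the two given sequences, those through the pullback have all terms in E: the projection of
   Q to Y has kernel X', the one to X has kernel Y'. *)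
have c1 : conflation E (lin_of f1L) (lin_of g1L).
  split=> //; split.
  - by move=> x y /(congr1 val) [/iI].
  - move=> y; have [x xy] := pS (q y).
    have Qxy : Q (x, y) by rewrite /= xy subrr.
    by exists (to_sub Qxy).
  apply/seteqP; split=> [_ [x _ <-] //|z].
  move=> z0'; have z0 : (val z).2 = 0 := z0'.
  have [x xz] : exists x, i x = (val z).1.
    by apply/(short_exact_ker ip); rewrite Qz z0 linear0.
  by exists x => //; apply: val_inj; rewrite [RHS]surjective_pairing z0 -xz.
have c2 : conflation E (lin_of f2L) (lin_of g2L).
  split=> //; split.
  - by move=> x y /(congr1 val) [/jI].
  - move=> x; have [y yx] := qS (p x).
    have Qxy : Q (x, y) by rewrite /= yx subrr.
    by exists (to_sub Qxy).
  apply/seteqP; split=> [_ [x _ <-] //|z].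
  move=> z0'; have z0 : (val z).1 = 0 := z0'.
  have [y yz] : exists y, j y = (val z).2.
    by apply/(short_exact_ker jq); rewrite -Qz z0 linear0.
  by exists y => //; apply: val_inj; rewrite [RHS]surjective_pairing z0 -yz.
have := ha _ _ _ _ _ c1; rewrite (ha _ _ _ _ _ c2) => e.
apply/eqP; rewrite subr_eq addrAC -subr_eq opprK [h X + _]addrC e addrC.
exact/eqP.
Qed.

Lemma quo_max_simple X (W : submod X) : ~ (forall x, W x) ->
  (forall V : submod X, ~ (forall x, V x) -> (forall x, W x -> V x) -> V = W) ->
  simple_mod (quo_mod W).
Proof.
move=> nW Wmax; split.
  by move=> z; apply: nW => x; apply/quo_eq0; exact: z.
move=> V; have [full|nf] := pselect (forall x, sm_pre (quo W) V x).
  by left=> y; have [x <-] := quo_surj y; exact: full.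
right=> y Vy; have [x xy] := quo_surj y.
have e : sm_pre (quo W) V = W.
  apply: Wmax => // z /quo_eq0 qz.
  have -> : sm_set (sm_pre (quo W) V) z = V (quo W z) by [].
  by rewrite qz; exact: sm0.
have Wx : W x.
  rewrite -e; have -> : sm_set (sm_pre (quo W) V) x = V (quo W x) by [].
  by rewrite xy.
by rewrite -xy; apply/quo_eq0.
Qed.

(** Induction on length: a maximal submodule W of Y lies in E, and h Y - h W equals the difference
    over the pair chosen for the simple module Y / W. *)
Lemma additive_determined t : num_iso_classes simple_quotient t ->
  exists X X' : 'I_t -> lmodType K, [/\ forall k, E (X k), forall k, E (X' k) &
    forall h, additive_on U h -> (forall k, h (X k) = h (X' k)) ->
      forall Y, E Y -> h Y = 0].
Proof.
move=> [S [PS _ Sall]].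
have /choice[X] k : exists X, exists X' (i : {linear X' -> X}) (p : {linear X -> S k}),
    [/\ E X, E X' & short_exact i p] by case: (PS k) => _ [X xs]; exists X.
move=> /choice[X' XX']; exists X, X'; split=> [k|k|h ha hX].
- by case: (XX' k) => i [p []].
- by case: (XX' k) => i [p []].
move=> Y; move: {2}(len Y) (leqnn (len Y)) => n; elim: n Y => [|n IH] Y le EY.
  apply: (additive_zero ha); apply: len_eq0 (SubCat_fin_len fK EY) _.
  by apply/eqP; rewrite -leqn0.
have [Yz|Ynz] := pselect (is_zero Y); first exact: (additive_zero ha).
have fY := SubCat_fin_len fK EY.
have [|W [nW Wmax]] := @ex_max_submod _ Y (fun W => ~ forall x, W x) fY.
  by exists sm_zero => h'; apply: Ynz.
have EW : E (sub_mod W) by exact: SubCat_subm.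
have hW : h (sub_mod W) = 0.
  by apply: IH => //; rewrite -ltnS; apply: leq_trans le; exact: len_strict_full.
have ex : short_exact (incl W) (quo W).
  split; [exact: incl_inj|exact: quo_surj|rewrite range_incl].
  by apply/seteqP; split=> x /quo_eq0.
have [|k [f fb]] := Sall (quo_mod W).
  by split; [exact: quo_max_simple|exists Y, (sub_mod W), (incl W), (quo W)].
have [fI fS] := (bij_inj_surj f).1 fb.
have ex' : short_exact (incl W) (f \o quo W).
  split; [exact: incl_inj| |rewrite range_incl].
    by move=> s; have [z <-] := fS s; have [y <-] := quo_surj z; exists y.
  apply/seteqP; split=> x /=.
    by move=> /quo_eq0 qx; exact: (etrans (congr1 f qx) (linear0 f)).
  by move=> /(lin_inj0 fI)/quo_eq0.
have [i [p [EX EX' ip]]] := XX' k.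
have := additive_pullback ha EY EW EX EX' ex' ip.
by rewrite hW hX subrr subr0.
Qed.
End SimpleQuotients.

(** * Evaluation matrices and the two implications *)

Section Main.
Variables (R : comPzRingType) (L : pzAlg R) (U : lmodType L^c).
Hypothesis fL : fin_len (restr (L^c)^o : lmodType R).
Hypothesis fU : fingen U.
Hypothesis extU : ext_injective (SubCat U) U.
Let E := SubCat U.
Let fK : fin_len ((L^c)^o : lmodType L^c) := fin_len_restr fL.

Lemma additive_on_sum n (v : 'I_n -> rat) (h : 'I_n -> lmodType L^c -> rat) :
  (forall i, additive_on U (h i)) ->
  additive_on U (fun X => \sum_(i < n) v i * h i X).
Proof.
move=> ha A X N f g fg; rewrite -big_split; apply: eq_bigr => i _ /=.
by rewrite (ha i _ _ _ _ _ fg) mulrDr.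
Qed.

Section Summands.
Variables (n : nat) (S : 'I_n -> lmodType L^c).
Hypothesis iS : forall i, indecomposable (S i) /\ direct_summand (S i) U.
Hypothesis Sinj : forall i j, iso (S i) (S j) -> i = j.

Let h i X : rat := (hom_len X (S i))%:R.
Let ha i : additive_on U (h i) := hom_len_additive fL fU extU (iS i).2.

(** A combination of Hom lengths that vanishes at the simple objects vanishes on E by induction
    along conflations, so [hom_len_free] makes its coefficients zero. *)
Lemma simple_eval_free t (s : 'I_t -> lmodType L^c) (v : 'rV_n) :
  (forall M, simple_in E M -> exists k, iso M (s k)) ->
  v *m (\matrix_(i, k) h i (s k)) = 0 -> v = 0.
Proof.
move=> sall vH; apply/rowP => i; rewrite mxE.
apply: (hom_len_free fL fU iS Sinj (a := fun i => v 0 i)).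
apply: (additive_vanish fK (additive_on_sum (fun i => v 0 i) ha)) => M sM.
have [EM _ _] := sM; have [k Mk] := sall M sM.
have /rowP/(_ k) := vH; rewrite !mxE => e; apply: etrans e.
by apply: eq_bigr => j _; rewrite mxE (additive_iso fK (ha j) EM Mk).
Qed.

Lemma num_simple_ge t : num_iso_classes (simple_in E) t -> (n <= t)%N.
Proof.
move=> [s [_ _ sall]]; rewrite leqNgt; apply/negP => tn.
have [v v0 vH] := row_kernel (\matrix_(i, k) h i (s k)) tn.
by rewrite (simple_eval_free sall vH) eqxx in v0.
Qed.

Lemma JHP_of_num_simple : num_iso_classes (simple_in E) n -> JHP E.
Proof.
move=> [s [sS sinj sall]] X EX p q c d cs ds.
pose H := \matrix_(i, k) h i (s k).
have Hu : H \in unitmx.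
  rewrite -row_free_unit -kermx_eq0; apply/eqP/row_matrixP => i; rewrite row0.
  by apply: (simple_eval_free sall); apply/sub_kermxP; exact: row_sub.
(* The column of multiplicities solves a linear system with matrix [H] whose right-hand side depends
   on X only. *)
have data m (e : 'I_m.+1 -> adm_sub E X) : composition_series e ->
    exists (N : 'I_m -> lmodType L^c) (l : 'I_m -> 'I_n),
    [/\ forall i, series_factor e i (N i), forall i, iso (N i) (s (l i)) &
      H *m (\col_k (\sum_(i < m) (l i == k))%:R) = \col_i h i X].
  move=> es.
  have /choice[N NE] i := composition_factor fK fU extU EX es i.
  have /choice[l lE] i := sall (N i) (NE i).1.
  exists N, l; split=> //; first by move=> i; case: (NE i).
  apply/colP => i; rewrite !mxE.
  rewrite (additive_series fK (ha i) EX es (fun j => (NE j).2)).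
  under eq_bigr => k _ do rewrite !mxE natr_sum mulr_sumr.
  rewrite exchange_big; apply: eq_bigr => j _.
  have [[EN _ _] _] := NE j; rewrite (additive_iso fK (ha i) EN (lE j)).
  rewrite (bigD1 (l j)) //= eqxx mulr1 big1 ?addr0 // => k kl.
  by rewrite eq_sym (negPf kl) mulr0.
have [N [l [NE lE lH]]] := data _ _ cs; have [N' [l' [NE' lE' lH']]] := data _ _ ds.
have cnt k : (\sum_(i < p) (l i == k) = \sum_(i < q) (l' i == k))%N.
  have /colP/(_ k) := etrans (esym (mulKmx Hu _)) (congr1 (mulmx (invmx H)) (etrans lH (esym lH'))).
  rewrite mulKmx // !mxE => /eqP; rewrite Num.Theory.eqr_nat => /eqP.
  exact.
(* The multiplicities of a series add up to its length, so equal multiplicities force p = q. *)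
have tot m (f : 'I_m -> 'I_n) : (\sum_k \sum_(i < m) (f i == k))%N = m.
  rewrite exchange_big /= -[RHS]card_ord -sum1_card; apply: eq_bigr => i _.
  by rewrite (bigD1 (f i)) //= eqxx big1 // => k kf; rewrite eq_sym (negPf kf).
have e : p = q by rewrite -(tot p l) -(tot q l'); exact: eq_bigr.
subst q; have [u uE] := labels_perm cnt.
exists erefl, u => i; exists (N i), (N' (u i)); rewrite cast_ord_id.
split=> //; apply: iso_trans (lE i) _; rewrite uE; exact: iso_sym.
Qed.
End Summands.

Section Multiplicity.
Hypothesis jhp : JHP E.

Variable ser : lmodType L^c -> seq (lmodType L^c).
Hypothesis serP : forall X, E X -> series U (ser X) (@sm_full _ X).

(** Concatenating the chosen series of A and N gives a series of X, and under (JHP) it has the same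
    multiplicities as the chosen series of X. *)
Lemma mult_additive s : additive_on U (fun X => (mult s (ser X))%:R).
Proof.
move=> A X N f g fg; have [EA EX EN ex] := fg.
rewrite -natrD -count_cat; congr _%:R.
apply: (JHP_mult fK s jhp EX (serP EX)).
have := series_cat fK fU extU fg (serP EA) (serP EN); congr (series _ _ _).
exact: submod_eq.
Qed.

Lemma mult_simple s s' : simple_in E s' -> mult s (ser s') = `[< iso s' s >] :> nat.
Proof.
move=> ss'; have [Es' _ _] := ss'.
rewrite (JHP_mult fK s jhp Es' (serP Es') (series_simple ss')).
by rewrite /mult /= addn0.
Qed.

End Multiplicity.

(** With more simple objects than pairs, some nonzero combination of multiplicities has equal values
    on both members of every pair and so vanishes on E. Its value at s k is the coefficient v k, a
    contradiction. *)
Lemma JHP_num_simple_le t n (s : 'I_t -> lmodType L^c) : JHP E ->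
  num_iso_classes (simple_quotient U) n -> (forall i, simple_in E (s i)) ->
  (forall i j, iso (s i) (s j) -> i = j) -> (t <= n)%N.
Proof.
move=> jhp /(additive_determined fK)[X [X' [EX EX' det]]] sS sinj.
rewrite leqNgt; apply/negP => nt.
(* Outside E the chosen list is empty and carries no condition. *)
have /choice[ser serP] (Y : lmodType L^c) :
    exists l, E Y -> series U l (@sm_full _ Y).
  have [EY|nE] := pselect (E Y); last by exists [::].
  by have [l sl] := ex_series fK fU extU EY; exists l.
pose m j Y : rat := (mult (s j) (ser Y))%:R.
have [v v0 vB] := row_kernel (\matrix_(j, k) (m j (X k) - m j (X' k))) nt.
have h0 := det _ (additive_on_sum (fun j => v 0 j) (fun j => mult_additive jhp serP (s j))).
move/negP: v0; apply; apply/eqP/rowP => k; rewrite mxE.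
have [Es _ _] := sS k; rewrite -(h0 _ (s k) Es).
  rewrite (bigD1 k) //= big1 => [|j jk].
    rewrite /m (mult_simple jhp serP) // (_ : `[< _ >] = true) ?mulr1 ?addr0 //.
    exact/asboolP/iso_refl.
  rewrite /m (mult_simple jhp serP) // (_ : `[< _ >] = false) ?mulr0 //.
  by apply/asboolP => /sinj kj; rewrite kj eqxx in jk.
move=> l; apply/eqP; rewrite -subr_eq0 -sumrB; apply/eqP.
have /rowP/(_ l) := vB; rewrite !mxE => e; apply: etrans e.
by apply: eq_bigr => j _; rewrite mxE mulrBr.
Qed.
End Main.

Theorem corollary5p14 (R : comPzRingType) (L : pzAlg R) (hL : artin_algebra L)
    (U : lmodType L^c) (hU : support_tauinv_tilting U)
    (hT : torsionfree_class (SubCat U)) (hF : functorially_finite (SubCat U)) :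
  JHP (SubCat U) <->
  exists n : nat,
    num_iso_classes (simple_in (SubCat U)) n /\ num_indec_summands U n.
Proof.
have [_ fL] := artin_algebra_fin_len hL.
have [fU [extU [n [nU [I [IU Ibound]]]]]] := support_tilting_facts hL hU.
split=> [jhp|[m [mS [S [iS Sinj _]]]]]; last first.
  exact: (JHP_of_num_simple fL fU extU iS Sinj mS).
exists n; split=> //; have [S [iS Sinj _]] := nU.
(* A simple quotient of an object of E is killed by [I], as that object embeds in a power of U; so
   there are at most n of them. *)
have [|t [tn simq]] := @ex_iso_classes _ (simple_quotient U) n.
  move=> t Q QS Qinj; apply: (Ibound t Q) Qinj => [i|i a s Ia]; first by case: (QS i).
  have [_ [X [X' [_ [p [[_ [k [f fI]]] _ [_ pS _]]]]]]] := QS i.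
  have [x <-] := pS s; rewrite -linearZ (_ : a *: x = 0) ?linear0 //.
  by apply: fI; rewrite linear0 linearZ; apply/ffunP => z; rewrite !ffunE; exact: IU.
(* The bound from above also shows that the number of simple objects is finite, which the bound from
   below requires. *)
have [|r [rn sims]] := @ex_iso_classes _ (simple_in (SubCat U)) n.
  move=> r s ss sinj; apply: leq_trans tn.
  exact: (JHP_num_simple_le fL fU extU jhp simq ss sinj).
suff <- : r = n by [].
by apply/eqP; rewrite eqn_leq rn; exact: (num_simple_ge fL fU extU iS Sinj sims).
Qed.
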